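(* Let $X, Y\subset\Omega$ be two disjoint compact domains in $\mathbb{R}^2$ with $\mathrm{dist}(X,Y)\ge \gamma\,\mathrm{diam}(Y)$ for some $\gamma=O(1)$. Let $p=2$ or $p=\infty$. Then for any $\varepsilon>0$, if there are functions $f_l\in L^p(X)$, $g_l\in L^p(Y)$, $l=1,\dots,N^{\varepsilon}$, such that $$\Big\|G_n(\mathbf{x},\mathbf{y})-\sum_{l=1}^{N^{\varepsilon}} f_l(\mathbf{x})\,g_l(\mathbf{y})\Big\|_{L^p(X\times Y)}\le \varepsilon\,\|G_n\|_{L^p(X\times Y)},\qquad \mathbf{x}\in X,\ \mathbf{y}\in Y,$$ then $N^{\varepsilon}\ge O(n^{2-\delta})$ for any small $\delta>0$ when $n$ is sufficiently large.
   Context: $\Omega\subset\mathbb{R}^2$ is a bounded convex domain. The coefficient $\sigma_t$ is a real-valued function, smooth over $\Omega$, with $0<\sigma_0\le\sigma_t\le\sigma_1<\infty$ for some constants $\sigma_0,\sigma_1$. For $\mathbf{x}\ne\mathbf{y}$ in $\Omega$ set $$E(\mathbf{x},\mathbf{y})=\exp\Big(-|\mathbf{x}-\mathbf{y}|\int_0^1\sigma_t(\mathbf{x}+(\mathbf{y}-\mathbf{x})s)\,ds\Big),\qquad G_n(\mathbf{x},\mathbf{y})=\frac{E(\mathbf{x},\mathbf{y})}{|\mathbf{x}-\mathbf{y}|}\,e^{-in\arg(\mathbf{x}-\mathbf{y})},$$ where $n$ is a nonnegative integer and $\arg(\mathbf{x}-\mathbf{y})$ is the polar angle of $\mathbf{x}-\mathbf{y}\in\mathbb{R}^2$.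 Here $\gamma=O(1)$ is a positive constant independent of $n$. The functions $f_l,g_l$ and the number $N^{\varepsilon}$ may depend on $n$. ''$N^{\varepsilon}\ge O(n^{2-\delta})$ for $n$ sufficiently large'' means that $N^{\varepsilon}\ge c\,n^{2-\delta}$ for all sufficiently large $n$, with a constant $c>0$ independent of $n$ and of the choice of $f_l,g_l$.
   Formalization: The claim is proved for 0 < ε < 1 instead of any ε > 0; for ε ≥ 1 it is false, since the single zero term f_1 = g_1 = 0 already satisfies the error bound for every n with N = 1. *)

(* Defs.v *)
From HB Require Import structures.
From mathcomp Require Import all_boot all_order all_algebra.
From mathcomp Require Import complex.
From mathcomp Require Import all_classical all_reals all_analysis.

Set Implicit Arguments.
Unset Strict Implicit.
Unset Printing Implicit Defensive.

Import Order.TTheory GRing.Theory Num.Theory.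
Import numFieldNormedType.Exports.

Local Open Scope classical_set_scope.
Local Open Scope ring_scope.
Local Open Scope complex_scope.

Section Plane.
Context {R : realType}.

(* The norm MathComp puts on [R * R] is the sup norm; the Euclidean one is
   needed for |x - y|, dist and diam. *)
Definition enorm (u : R * R) : R := Num.sqrt (u.1 ^+ 2 + u.2 ^+ 2).

(* [inf] and [sup] are real-valued and take the value 0 on the empty set (and
   on sets not bounded in the relevant direction); only nonempty compact
   arguments matter here. *)
Definition dist_set (X Y : set (R * R)) : R :=
  inf [set enorm (z.1 - z.2) | z in X `*` Y].

Definition diam (Y : set (R * R)) : R :=
  sup [set enorm (z.1 - z.2) | z in Y `*` Y].

(* Principal value, in ]-pi, pi]; the branch is irrelevant in [kernelG], where
   the angle is multiplied by an integer and exponentiated. *)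
Definition polar_angle (u : R * R) : R :=
  if 0 <= u.2 then acos (u.1 / enorm u) else - acos (u.1 / enorm u).

(* A compact set that is the closure of a domain, i.e. of a nonempty connected
   open set (which can then be taken to be the interior). *)
Definition compact_domain (K : set (R * R)) : Prop :=
  [/\ compact K, K° !=set0, connected K° & closure K° = K].

Definition axis (i : bool) : R * R := if i then (0, 1) else (1, 0).

Definition partial (i : bool) (f : R * R -> R) : R * R -> R :=
  fun x => 'D_(axis i) f x.

(* C^infinity on an open set [A]: the iterated partial derivatives of all
   orders, taken in any sequence, exist and are continuous at every point of
   [A]. *)
Definition smooth_on (A : set (R * R)) (f : R * R -> R) : Prop :=
  forall (s : seq bool) (x : R * R), A x ->
    {for x, continuous (foldr partial f s)} /\
    forall i, derivable (foldr partial f s) x (axis i).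

Definition lebesgue1 : {measure set (measurableTypeR R) -> \bar R} :=
  @lebesgue_measure R.

Definition kernelE (sigma : R * R -> R) (x y : R * R) : R :=
  expR (- (enorm (x - y) *
           \int[lebesgue1]_(s in `[0, 1]) sigma (x + s *: (y - x)))).

Definition expi (t : R) : R[i] := cos t +i* sin t.

Definition kernelG (sigma : R * R -> R) (n : nat) (x y : R * R) : R[i] :=
  (kernelE sigma x y / enorm (x - y))%:C *
  expi (- (n%:R * polar_angle (x - y))).

End Plane.

Section Lp.
Context {d : measure_display} {T : measurableType d} {R : realType}.
Variables (mu : {measure set T -> \bar R}) (p : \bar R) (D : set T).

Definition Lp_norm (F : T -> R[i]) : \bar R :=
  'N[mu]_p[(fun x => (\1_D x * ComplexField.Normc.normc (F x))%:E)].

(* [R[i]] carries no sigma-algebra in the library: a complex function is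
   measurable when its real and imaginary parts are. *)
Definition in_Lp (F : T -> R[i]) : Prop :=
  [/\ measurable_fun D (fun x => complex.Re (F x)),
      measurable_fun D (fun x => complex.Im (F x)) &
      (Lp_norm F < +oo)%E].

End Lp.

(* The library proves this, but its canonical instance on [m1 \x m2] is shadowed
   by the one for subprobabilities, hence the explicit instance on [lebesgue2]
   below. *)
Lemma product_measure1_sigma_finite d1 d2 (T1 : measurableType d1)
    (T2 : measurableType d2) (R : realType)
    (m1 : {sigma_finite_measure set T1 -> \bar R})
    (m2 : {sigma_finite_measure set T2 -> \bar R}) :
  sigma_finite setT (m1 \x m2)%E.
Proof.
have /sigma_finiteP[F [TF ndF Foo]] := sigma_finiteT m1.
have /sigma_finiteP[G [TG ndG Goo]] := sigma_finiteT m2.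
exists (fun n => F n `*` G n).
  rewrite -setXTT TF TG predeqE => -[x y]; split.
    move=> [/= [n _ Fnx] [k _ Gky]]; exists (maxn n k) => //; split.
    - by move: x Fnx; exact/subsetPset/ndF/leq_maxl.
    - by move: y Gky; exact/subsetPset/ndG/leq_maxr.
  by move=> [n _ []/= ? ?]; split; exists n.
move=> k; have [? ?] := Foo k; have [? ?] := Goo k.
split; first exact: measurableX.
by rewrite product_measure1E// lte_mul_pinfty// ge0_fin_numE.
Qed.

Definition lebesgue2 {R : realType} :
    set (measurableTypeR R * measurableTypeR R) -> \bar R :=
  (lebesgue_measure \x lebesgue_measure)%E.

HB.instance Definition _ (R : realType) := Measure.on (@lebesgue2 R).
HB.instance Definition _ (R : realType) :=
  Measure_isSigmaFinite.Build _ _ _ (@lebesgue2 R)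
    (@product_measure1_sigma_finite _ _ _ _ _
      (@lebesgue_measure R) (@lebesgue_measure R)).

Definition lebesgue4 {R : realType} :
    set ((measurableTypeR R * measurableTypeR R) *
         (measurableTypeR R * measurableTypeR R)) -> \bar R :=
  (lebesgue2 \x lebesgue2)%E.

HB.instance Definition _ (R : realType) := Measure.on (@lebesgue4 R).

(* Main.v *)
From HB Require Import structures.
Require Import Defs.
From mathcomp Require Import all_boot all_order all_algebra.
From mathcomp Require Import complex.
From mathcomp Require Import all_classical all_reals all_analysis.
From mathcomp Require Import measurable_realfun ess_sup_inf.
From mathcomp Require Import ring lra.

Set Implicit Arguments.
Unset Strict Implicit.
Unset Printing Implicit Defensive.

Import Order.TTheory GRing.Theory Num.Theory.
Import numFieldNormedType.Exports.

Local Open Scope classical_set_scope.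
Local Open Scope ring_scope.

(** Write the kernel as [A * expi (- n * arg (x - y))], with a positive amplitude
[A] that is continuous on [X `*` Y]. On a pair of small boxes the amplitude is
nearly constant, and what has to be shown is that the pure phase restricted to a
pair of boxes is numerically of rank almost [n ^+ 2].

This is seen on its singular values [s_i]. The sum of the [s_i ^+ 2] is the
squared norm of the phase, hence of order [1]. The sum of the [s_i ^+ 4] is the
squared norm of the Gram kernel
[H (x, x') = \int_y cos (n * (arg (x - y) - arg (x' - y)))] ([gram_kernel],
[phase_gram]). In complex notation the gradient in [y] of
[arg (x - y) - arg (x' - y)] is, up to a conjugation and a unit factor,
[(x - x') / ((x - y) * (x' - y))]; on small boxes one of its two coordinates is
bounded below by a multiple of [|x - x'|] for all [y] at once
([phase_gradient]). A single integration by parts in that coordinate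
([oscillatory_integral]) gives [|H (x, x')| <= C / (n * |x - x'|)]
([phase_gram_decay]), so that the squared norm of [H] is of order
[(ln n / n) ^+ 2]. Many small singular values are therefore needed to make up a
sum of squares of order [1]: at least of the order of [(n / ln n) ^+ 2], which
exceeds [n `^ (2 - delta)].

To turn this into a bound for separated sums [v], without spectral theory, the
quantity that is estimated is [\int (2 * K * v - v ^+ 2)], which is the squared
norm of [K] minus that of the error [K - v]. By orthonormalization in [x] and
Bessel's inequality it is at most [(t * N + \int H ^+ 2 / t) / 2] for all [t > 0]
when [v] has [N] terms ([finite_rank_bound]); so it can be bounded below by a
positive constant only if [N] is large ([local_rank_bound]). Nothing is asked of
the factors of [v] but square integrability, so that they can be truncated to
arbitrary measurable sets.

It remains to produce a cell where this quantity is bounded below. On a cell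
where [A] is nearly constant it is at least the [deficit], that is, roughly the
squared amplitude minus the squared error ([cell_gap]). For [p = 2] the integral
of the deficit over [X `*` Y] is a fraction of that of [A ^+ 2]
([large_deficit_L2]), and one of the finitely many cells of a cover keeps a fixed
part of it ([pigeonhole_cover]). For [p = +oo] the same is done in a
neighbourhood of a maximum point of [A], where the error is a fraction of [A]
itself ([large_deficit_sup]); this has positive measure because [X] and [Y] are
closures of their interiors. *)

(** * Orthonormal families for a semi-inner product *)

Section GramSchmidt.
Context {R : realType} {V : lmodType R}.
Variables (S : {pred V}) (B : V -> V -> R).
Hypothesis S0 : 0 \in S.
Hypothesis SP : forall a v w, v \in S -> w \in S -> a *: v + w \in S.
Hypothesis BC : forall v w, B v w = B w v.
Hypothesis BP : forall a v w u, v \in S -> w \in S -> u \in S ->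
  B u (a *: v + w) = a * B u v + B u w.
Hypothesis B_ge0 : forall v, v \in S -> 0 <= B v v.

Let SZ a v : v \in S -> a *: v \in S.
Proof. by move=> vS; have := SP a vS S0; rewrite addr0. Qed.

Let B0 u : u \in S -> B u 0 = 0.
Proof.
by move=> uS; have := BP (-1) S0 S0 uS; rewrite scaler0 addr0 mulN1r addNr.
Qed.

Let BZ a v u : v \in S -> u \in S -> B u (a *: v) = a * B u v.
Proof. by move=> vS uS; have := BP a vS S0 uS; rewrite addr0 B0// addr0. Qed.

Let S_sum I (r : seq I) (c : I -> R) (f : I -> V) :
  (forall i, f i \in S) -> \sum_(i <- r) c i *: f i \in S.
Proof.
move=> fS; elim: r => [|i r IHr]; first by rewrite big_nil.
by rewrite big_cons; exact: SP.
Qed.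

Let B_sum I (r : seq I) (c : I -> R) (f : I -> V) u : u \in S ->
  (forall i, f i \in S) ->
  B u (\sum_(i <- r) c i *: f i) = \sum_(i <- r) c i * B u (f i).
Proof.
move=> uS fS; elim: r => [|i r IHr]; first by rewrite !big_nil B0.
by rewrite !big_cons BP// ?IHr// S_sum.
Qed.

(** Only a semi-inner product is available on square integrable functions, so
vectors of length zero have to be discarded; this is what makes it possible. *)
Lemma semi_inner_null w k : w \in S -> k \in S -> B w w = 0 -> B k w = 0.
Proof.
move=> wS kS ww.
have key t : 0 <= t ^+ 2 * B k k + 2 * t * B k w.
  have kwS : t *: k + w \in S by exact: SP.
  have := B_ge0 kwS; rewrite BP// [B _ k]BC [B _ w]BC !BP// ww (BC w k); lra.
have [//|kw0] := eqVneq (B k w) 0.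
have kk := B_ge0 kS.
have kk1 : 0 < B k k + 1 by lra.
have := key (- (B k w / (B k k + 1))).
set b := B k w in kw0 *; set a := B k k in kk kk1 *.
have -> : (- (b / (a + 1))) ^+ 2 * a + 2 * - (b / (a + 1)) * b =
  - (b ^+ 2 * (a + 2) / (a + 1) ^+ 2) by field; lra.
rewrite oppr_ge0 leNgt => /negP[]; apply: divr_gt0; last exact: exprn_gt0.
by rewrite mulr_gt0//; [rewrite exprn_even_gt0//= |lra].
Qed.

(** [us] reproduces [v] when the scalar product with [v] can be computed from
the coefficients on [us]. *)
Definition reproduces (us : seq V) (v : V) : Prop :=
  forall k, k \in S -> B k v = \sum_(e <- us) B k e * B e v.

(** Orthonormality of [us] is expressed by [reproduces us u] and [B u u = 1]
for all [u] in [us], which is the form in which it gets used. *)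
Lemma gram_schmidt (fs : seq V) : {subset fs <= S} ->
  exists us : seq V, [/\ (size us <= size fs)%N, {subset us <= S},
    (forall u, u \in us -> B u u = 1 /\ reproduces us u) &
    forall f, f \in fs -> reproduces us f].
Proof.
elim: fs => [|f fs IHfs] fsS; first by exists [::]; split.
have fS : f \in S by apply: fsS; rewrite mem_head.
have [|us [sz usS us1 usfs]] := IHfs.
  by move=> g gfs; apply: fsS; rewrite in_cons gfs orbT.
pose w := f - \sum_(e <- us | e \in S) B e f *: e.
have sumE : \sum_(e <- us | e \in S) B e f *: e =
    \sum_(e <- us) B e f *: (if e \in S then e else 0).
  by rewrite big_mkcond; apply: eq_bigr => e _; case: ifP; rewrite ?scaler0.
have ifS (e : V) : (if e \in S then e else 0) \in S by case: ifP.
have wS : w \in S.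
  rewrite /w sumE; have := SP (-1) (S_sum us (fun e => B e f) ifS) fS.
  by rewrite scaleN1r addrC.
have Bkw k : k \in S -> B k w = B k f - \sum_(e <- us) B k e * B e f.
  move=> kS; rewrite /w sumE addrC -scaleN1r BP// ?S_sum// B_sum//.
  rewrite mulN1r addrC; congr (_ - _); apply: eq_big_seq => e /usS eS.
  by rewrite eS mulrC.
have wus e : e \in us -> B e w = 0.
  move=> eus; rewrite Bkw ?usS//; have [_ rep] := us1 _ eus.
  have := rep _ fS; rewrite (BC f e) => ->.
  apply/eqP; rewrite subr_eq0; apply/eqP/eq_bigr => e' _.
  by rewrite mulrC (BC f e') (BC e e').
have [ww|ww] := eqVneq (B w w) 0.
  exists us; split=> //; first exact: leqW.
  move=> g; rewrite in_cons => /predU1P[->|/usfs//] k kS.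
  by have := Bkw _ kS; rewrite (semi_inner_null wS kS ww) => /eqP;
    rewrite eq_sym subr_eq0 => /eqP.
have ww0 : 0 < B w w by rewrite lt_neqAle eq_sym ww B_ge0.
pose s := Num.sqrt (B w w); have s0 : 0 < s by rewrite sqrtr_gt0.
have s2 : s ^+ 2 = B w w by rewrite sqr_sqrtr// ltW.
pose u := s^-1 *: w; have uS : u \in S by exact: SZ.
have uu : B u u = 1.
  by rewrite {2}/u BZ// BC BZ// -s2; field; rewrite gt_eqF.
have uE k : k \in S -> B k u = s^-1 * B k w by move=> kS; rewrite BZ.
exists (u :: us); split => //.
- by move=> e; rewrite in_cons => /predU1P[->|/usS].
- move=> e; rewrite in_cons => /predU1P[->|eus].
    split=> // k kS; rewrite big_cons uu mulr1 big1_seq ?addr0//= => e' e'us.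
    by rewrite uE ?usS// wus// mulr0 mulr0.
  have [ee rep] := us1 _ eus; split=> // k kS.
  by rewrite big_cons (BC u e) (uE e) ?usS// (wus e)// mulr0 mulr0 add0r rep.
- move=> g; rewrite in_cons => /predU1P[->|gfs] k kS; rewrite big_cons.
    have -> : B u f = s.
      have := Bkw _ wS; rewrite big1_seq ?subr0 => [ww'|e /andP[_ eus]].
        by rewrite BC /u BZ// BC -ww' -s2; field; rewrite gt_eqF.
      by rewrite (BC w e) wus ?mul0r.
    by rewrite uE// mulrAC mulVf ?gt_eqF// mul1r Bkw// subrK.
  rewrite (usfs _ gfs _ kS) [X in X + _](_ : _ = 0) ?add0r//.
  rewrite (usfs _ gfs _ uS) big1_seq ?mulr0//= => e eus.
  by rewrite (BC u e) (uE e) ?usS// (wus e)// mulr0 mul0r.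
Qed.

(** Bessel's inequality after completing the square: a vector [v] of the span
of [fs] cannot approach [k] better than the projection of [k] does. *)
Lemma bessel_span us I (r : seq I) (h : I -> R) (f : I -> V) k v :
  {subset us <= S} -> (forall i, f i \in S) ->
  (forall i, reproduces us (f i)) -> k \in S ->
  v = \sum_(i <- r) h i *: f i ->
  2 * B k v - B v v <= \sum_(e <- us) B k e ^+ 2.
Proof.
move=> usS fS rep kS vE.
have vS : v \in S by rewrite vE; exact: S_sum.
have repv w : w \in S -> B w v = \sum_(e <- us) B w e * B e v.
  move=> wS; rewrite vE B_sum//.
  under eq_bigr do rewrite rep// mulr_sumr.
  rewrite exchange_big /=; apply: eq_big_seq => e /usS eS.
  by rewrite B_sum// mulr_sumr; apply: eq_bigr => i _; rewrite mulrCA.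
rewrite !repv// mulr_sumr -sumrB; apply: ler_sum => e _.
by rewrite (BC v e); have := sqr_ge0 (B k e - B e v); lra.
Qed.

End GramSchmidt.

(** * Square integrable functions *)

Section SquareIntegrable.
Context {d} {T : measurableType d} {R : realType}.
Variable mu : {measure set T -> \bar R}.
Implicit Types f g : T -> R.

Lemma Lfun2P f : f \in Lfun mu 2%:E <->
  measurable_fun setT f /\ mu.-integrable setT (EFin \o (fun x => f x ^+ 2)).
Proof.
split=> [f2|[mf /integrableP[_ fi]]].
  split; last exact: Lfun2_integrable_sqr.
  by move: f2 => /[!inE] /andP[/[!inE]].
rewrite inE; apply/andP; split; rewrite inE//=.
rewrite /finite_norm unlock /Lnorm; apply: poweR_lty.
apply: le_lt_trans fi; rewrite le_eqVlt; apply/orP; left; apply/eqP.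
apply: eq_integral => x _ /=.
by rewrite powR_mulrn// -normrX.
Qed.

Lemma Lfun2_measurable f : f \in Lfun mu 2%:E -> measurable_fun setT f.
Proof. by case/Lfun2P. Qed.

Lemma Lfun2_comb (a : R) f g : f \in Lfun mu 2%:E -> g \in Lfun mu 2%:E ->
  a *: f + g \in Lfun mu 2%:E.
Proof.
have p1 : (1 <= 2%:E :> \bar R)%E by rewrite lee_fin ler1n.
exact: (Lfun_submod_closed mu p1).2.
Qed.

Lemma Lfun2_0 : (0 : T -> R) \in Lfun mu 2%:E.
Proof.
have p1 : (1 <= 2%:E :> \bar R)%E by rewrite lee_fin ler1n.
exact: (Lfun_submod_closed mu p1).1.
Qed.

Lemma Lfun2_integrableM f g : f \in Lfun mu 2%:E -> g \in Lfun mu 2%:E ->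
  mu.-integrable setT (fun x => (f x * g x)%:E).
Proof.
by move=> f2 g2; apply/(Lfun1_integrable mu (f \* g)); exact: Lfun2_mul_Lfun1.
Qed.

Lemma Lfun2_le f g : measurable_fun setT f -> g \in Lfun mu 2%:E ->
  (forall x, `|f x| <= `|g x|) -> f \in Lfun mu 2%:E.
Proof.
move=> mf /Lfun2P[mg ig] fg; apply/Lfun2P; split=> //.
apply: le_integrable ig => //=.
  by apply/measurable_EFinP; exact: measurable_funX.
by move=> x _ /=; rewrite lee_fin !normrX lerXn2r ?nnegrE.
Qed.

Definition inner2 f g : R := \int[mu]_x (f x * g x).

Lemma inner2C f g : inner2 f g = inner2 g f.
Proof. by apply: eq_Rintegral => x _; rewrite mulrC. Qed.

Lemma inner2P (a : R) f g h : f \in Lfun mu 2%:E -> g \in Lfun mu 2%:E ->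
  h \in Lfun mu 2%:E -> inner2 h (a *: f + g) = a * inner2 h f + inner2 h g.
Proof.
move=> f2 g2 h2; rewrite /inner2.
rewrite -RintegralZl//; last exact: Lfun2_integrableM.
rewrite -RintegralD//; last 2 first.
- have := integrableZl measurableT a (Lfun2_integrableM h2 f2).
  by apply: eq_integrable => // x _ /=; rewrite EFinM.
- exact: Lfun2_integrableM.
by apply: eq_Rintegral => x _; rewrite /= !fctE mulrDr mulrCA.
Qed.

Lemma inner2_ge0 f : 0 <= inner2 f f.
Proof. by apply: Rintegral_ge0 => x _; rewrite -expr2 sqr_ge0. Qed.

Lemma integrable_sumR (J : Type) (r : seq J) (h : J -> T -> R) :
  (forall j, mu.-integrable setT (EFin \o h j)) ->
  mu.-integrable setT (EFin \o (fun x => \sum_(j <- r) h j x)).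
Proof.
move=> ih; rewrite (_ : EFin \o _ = fun x => \sum_(i <- r) (h i x)%:E)%E.
  by apply: integrable_sum => // i _; exact: ih.
by apply/funext => x /=; rewrite sumEFin.
Qed.

Lemma Rintegral_sum (J : Type) (r : seq J) (h : J -> T -> R) :
  (forall j, mu.-integrable setT (EFin \o h j)) ->
  \int[mu]_x (\sum_(j <- r) h j x) = \sum_(j <- r) \int[mu]_x h j x.
Proof.
move=> ih; elim: r => [|j r IHr].
  by under eq_Rintegral do rewrite big_nil; rewrite big_nil Rintegral_cst ?mul0r.
under eq_Rintegral do rewrite big_cons.
by rewrite RintegralD// ?big_cons ?IHr//; exact: integrable_sumR.
Qed.

Lemma Lfun2_sum (J : Type) (r : seq J) (c : J -> R) (h : J -> T -> R) :
  (forall j, h j \in Lfun mu 2%:E) ->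
  \sum_(j <- r) c j *: h j \in Lfun mu 2%:E.
Proof.
move=> h2; elim: r => [|j r IHr]; first by rewrite big_nil Lfun2_0.
by rewrite big_cons; exact: Lfun2_comb.
Qed.

End SquareIntegrable.

Section Tensor.
Context {d1 d2} {T1 : measurableType d1} {T2 : measurableType d2} {R : realType}.
Variable m1 : {sigma_finite_measure set T1 -> \bar R}.
Variable m2 : {sigma_finite_measure set T2 -> \bar R}.

Lemma measurable_tensor (f : T1 -> R) (g : T2 -> R) :
  measurable_fun setT f -> measurable_fun setT g ->
  measurable_fun setT (fun z : T1 * T2 => f z.1 * g z.2).
Proof.
move=> mf mg; apply: measurable_funM.
  exact: (measurableT_comp mf).
exact: (measurableT_comp mg).
Qed.

Lemma integrable_tensor (f : T1 -> R) (g : T2 -> R) :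
  m1.-integrable setT (EFin \o f) -> m2.-integrable setT (EFin \o g) ->
  (m1 \x m2)%E.-integrable setT (fun z => (f z.1 * g z.2)%:E).
Proof.
move=> /[dup] intf /integrableP[mf fi] /[dup] intg /integrableP[mg gi].
have mfg : measurable_fun setT (fun z : T1 * T2 => (f z.1 * g z.2)%:E).
  by apply/measurable_EFinP; apply: measurable_tensor; exact/measurable_EFinP.
apply/(integrable12ltyP m1 m2 mfg).
under eq_integral => x _.
  under eq_integral => y _ do rewrite /= normrM EFinM.
  rewrite ge0_integralZl//=; last by do 2 apply: measurableT_comp => //;
    exact/measurable_EFinP.
  over.
rewrite /= ge0_integralZr//=; last 2 first.
- by do 2 apply: measurableT_comp => //; exact/measurable_EFinP.
- exact: integral_ge0.
by apply: lte_mul_pinfty => //; rewrite ?integral_ge0// ge0_fin_numE// integral_ge0.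
Qed.

Lemma Fubini_Rintegral21 (f : T1 * T2 -> R) :
  (m1 \x m2)%E.-integrable setT (EFin \o f) ->
  (forall y, m1.-integrable setT (fun x => (f (x, y))%:E)) ->
  [/\ m2.-integrable setT (EFin \o (fun y => \int[m1]_x f (x, y))) &
  \int[(m1 \x m2)%E]_z f z = \int[m2]_y \int[m1]_x f (x, y)].
Proof.
move=> intf ify.
have E : EFin \o (fun y => \int[m1]_x f (x, y)) = fubini_G m1 (EFin \o f).
  apply/funext => y /=; rewrite /Rintegral fineK; first by rewrite /fubini_G.
  exact: (integrable_fin_num measurableT (ify y)).
split; last first.
  rewrite /Rintegral -[in LHS]integral21_prod_meas1//.
  by congr fine; apply: eq_integral => y _; rewrite -E.
rewrite E; apply/integrableP; split; first exact: (measurable_fubini_G intf).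
have /integrableP[mf _] := intf.
apply: le_lt_trans ((integrable21ltyP m1 m2 mf).1 intf).
apply: ge0_le_integral => //.
- by apply: measurableT_comp => //; exact: (measurable_fubini_G intf).
- by apply: (measurable_fun_fubini_tonelli_G (abse \o (EFin \o f))) => //=;
    exact: measurableT_comp.
- move=> y _; apply: le_abse_integral => //.
  by have /integrableP[] := ify y.
Qed.

Lemma Fubini_Rintegral12 (f : T1 * T2 -> R) :
  (m1 \x m2)%E.-integrable setT (EFin \o f) ->
  (forall x, m2.-integrable setT (fun y => (f (x, y))%:E)) ->
  [/\ m1.-integrable setT (EFin \o (fun x => \int[m2]_y f (x, y))) &
  \int[(m1 \x m2)%E]_z f z = \int[m1]_x \int[m2]_y f (x, y)].
Proof.
move=> intf ify.
have E : EFin \o (fun y => \int[m2]_x f (y, x)) = fubini_F m2 (EFin \o f).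
  apply/funext => y /=; rewrite /Rintegral fineK; first by rewrite /fubini_F.
  exact: (integrable_fin_num measurableT (ify y)).
split; last first.
  rewrite /Rintegral -[in LHS]integral12_prod_meas1//.
  by congr fine; apply: eq_integral => y _; rewrite -E.
by rewrite E; exact: (integrable_fubini_F intf).
Qed.

Lemma Rintegral_tensor (f : T1 -> R) (g : T2 -> R) :
  m1.-integrable setT (EFin \o f) -> m2.-integrable setT (EFin \o g) ->
  \int[(m1 \x m2)%E]_z (f z.1 * g z.2) = (\int[m1]_x f x) * (\int[m2]_y g y).
Proof.
move=> intf intg.
have [|_ ->] := Fubini_Rintegral12 (integrable_tensor intf intg).
  move=> x; have := integrableZl measurableT (f x) intg.
  by apply: eq_integrable => // y _ /=; rewrite EFinM.
rewrite -RintegralZr//; apply: eq_Rintegral => x _ /=.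
by rewrite RintegralZl.
Qed.

End Tensor.

(** * Finite rank functions and the Gram kernel *)

HB.instance Definition _ (R : realType) :=
  Measure_isSigmaFinite.Build _ _ _ (@lebesgue4 R)
    (@product_measure1_sigma_finite _ _ _ _ _ (@lebesgue2 R) (@lebesgue2 R)).

Section Sections.
Context {d1 d2} {T1 : measurableType d1} {T2 : measurableType d2} {R : realType}.

Lemma measurable_Rintegral2 (m2 : {sigma_finite_measure set T2 -> \bar R})
    (f : T1 * T2 -> R) : measurable_fun setT f ->
  measurable_fun setT (fun x => \int[m2]_y f (x, y)).
Proof.
move=> mf.
have mfE : measurable_fun setT (EFin \o f) by exact/measurable_EFinP.
suff h (g : T1 * T2 -> \bar R) : measurable_fun setT g ->
    measurable_fun setT (fubini_F m2 g).
  exact: (measurableT_comp (fine_measurable measurableT) (h _ mfE)).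
move=> mg.
rewrite (_ : fubini_F m2 g = fubini_F m2 g^\+%E \- fubini_F m2 g^\-%E)%E; last first.
  apply/funext => x; rewrite [LHS]integralE.
  under eq_integral do rewrite funepos_comp/=.
  by under [X in (_ - X)%E = _]eq_integral do rewrite funeneg_comp/=.
apply: emeasurable_funB; apply: measurable_fun_fubini_tonelli_F => //.
  exact: measurable_funepos.
exact: measurable_funeneg.
Qed.

Lemma Lfun2_tensor (m1 : {sigma_finite_measure set T1 -> \bar R})
    (m2 : {sigma_finite_measure set T2 -> \bar R}) (f : T1 -> R) (g : T2 -> R) :
  f \in Lfun m1 2%:E -> g \in Lfun m2 2%:E ->
  (fun z : T1 * T2 => f z.1 * g z.2) \in Lfun (m1 \x m2)%E 2%:E.
Proof.
move=> /Lfun2P[mf intf] /Lfun2P[mg intg]; apply/Lfun2P; split.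
  exact: measurable_tensor.
have := integrable_tensor intf intg; apply: eq_integrable => // z _ /=.
by rewrite exprMn.
Qed.

End Sections.

Section FiniteRank.
Context {R : realType}.
Local Notation P := (measurableTypeR R * measurableTypeR R)%type.
Local Notation mu := (@lebesgue2 R).
Local Notation mu2 := (@lebesgue4 R).
Variables (I J : finType) (K : I -> P -> P -> R) (b1 b2 : P -> R).
Variables (F : J -> P -> R) (G : I -> J -> P -> R).
Hypothesis mK : forall k, measurable_fun setT (fun z : P * P => K k z.1 z.2).
Hypothesis Kb : forall k x y, `|K k x y| <= b1 x * b2 y.
Hypothesis b1_2 : b1 \in Lfun mu 2%:E.
Hypothesis b2_2 : b2 \in Lfun mu 2%:E.
Hypothesis F2 : forall j, F j \in Lfun mu 2%:E.
Hypothesis G2 : forall k j, G k j \in Lfun mu 2%:E.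

Let V k (z : P * P) : R := \sum_(j : J) F j z.1 * G k j z.2.

Let gap k z : R := 2 * K k z.1 z.2 * V k z - V k z ^+ 2.

(** The kernel of the operator [\sum_k K_k K_k^T]: its squared norm is the sum of
the fourth powers of the singular values. *)
Definition gram_kernel (z : P * P) : R := \sum_k inner2 mu (K k z.1) (K k z.2).

Let K2 k : (fun z : P * P => K k z.1 z.2) \in Lfun mu2 2%:E.
Proof.
apply: (Lfun2_le (g := fun z : P * P => b1 z.1 * b2 z.2)) => //.
  exact: Lfun2_tensor.
by move=> z; rewrite (le_trans (Kb _ _ _))// ler_norm.
Qed.

Let Kx k y : K k ^~ y \in Lfun mu 2%:E.
Proof.
apply: (Lfun2_le (g := b2 y *: b1)); first exact: measurable_fun_pair1 (mK k).
  by have := Lfun2_comb (b2 y) b1_2 (Lfun2_0 mu); rewrite addr0.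
move=> x; rewrite (le_trans (Kb _ _ _))// (le_trans (ler_norm _))//.
by rewrite mulrC.
Qed.

Let Ky k x : K k x \in Lfun mu 2%:E.
Proof.
apply: (Lfun2_le (g := b1 x *: b2)); first exact: measurable_fun_pair2 (mK k).
  by have := Lfun2_comb (b1 x) b2_2 (Lfun2_0 mu); rewrite addr0.
by move=> y; rewrite (le_trans (Kb _ _ _))// (le_trans (ler_norm _)).
Qed.

Let V2 k : V k \in Lfun mu2 2%:E.
Proof.
rewrite (_ : V k = \sum_(j : J) 1 *: (fun z : P * P => F j z.1 * G k j z.2)).
  by apply: Lfun2_sum => j; exact: Lfun2_tensor.
apply/funext => z; rewrite fct_sumE; apply: eq_bigr => j _.
by rewrite scale1r.
Qed.

Lemma integrable_gap k : mu2.-integrable setT (EFin \o gap k).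
Proof.
have h1 := Lfun2_integrableM (K2 k) (V2 k).
have h2 := Lfun2_integrableM (V2 k) (V2 k).
have := integrableB measurableT (integrableZl measurableT 2 h1) h2.
apply: eq_integrable => // z _ /=; rewrite -?EFinM -?EFinB; congr EFin.
by rewrite /gap; ring.
Qed.

Lemma Lfun2_gram_kernel : gram_kernel \in Lfun mu2 2%:E.
Proof.
rewrite (_ : gram_kernel =
  \sum_k 1 *: (fun z : P * P => inner2 mu (K k z.1) (K k z.2))); last first.
  by apply/funext => z; rewrite fct_sumE; apply: eq_bigr => k _; rewrite scale1r.
apply: Lfun2_sum => k.
have mKK : measurable_fun setT
    (fun w : (P * P) * P => K k w.1.1 w.2 * K k w.1.2 w.2).
  apply: measurable_funM.
  - apply: (measurableT_comp (mK k) (g := fun w : (P * P) * P => (w.1.1, w.2))).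
    apply: measurable_fun_pair => //.
    exact: measurableT_comp measurable_fst measurable_fst.
  - apply: (measurableT_comp (mK k) (g := fun w : (P * P) * P => (w.1.2, w.2))).
    apply: measurable_fun_pair => //.
    exact: measurableT_comp measurable_snd measurable_fst.
apply: (Lfun2_le (g := fun z : P * P => inner2 mu b2 b2 * b1 z.1 * b1 z.2)).
- exact: (measurable_Rintegral2 mu mKK).
- rewrite (_ : (fun z => _) =
      inner2 mu b2 b2 *: (fun z : P * P => b1 z.1 * b1 z.2) + 0).
    exact: (Lfun2_comb _ (Lfun2_tensor b1_2 b1_2) (Lfun2_0 mu2)).
  by rewrite addr0; apply/funext => z; rewrite -mulrA.
- move=> z; have iKK := Lfun2_integrableM (Ky k z.1) (Ky k z.2).
  rewrite (le_trans (le_normr_Rintegral measurableT iKK))//.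
  rewrite (le_trans _ (ler_norm _))// -mulrA [leRHS]mulrC.
  rewrite -RintegralZl//; last exact: Lfun2_integrableM.
  apply: le_Rintegral => //.
  - have := integrable_abse (Lfun2_integrableM (Ky k z.1) (Ky k z.2)).
    by apply: eq_integrable => // y _ /=; rewrite abse_EFin.
  - have := integrableZl measurableT (b1 z.1 * b1 z.2) (Lfun2_integrableM b2_2 b2_2).
    by apply: eq_integrable => // y _ /=; rewrite EFinM.
  - by move=> y _; rewrite normrM mulrACA; apply: ler_pM.
Qed.

(** Integrating over [y] the squared coefficient of [K k ^~ y] along [e] gives
the quadratic form of the Gram kernel at [e]. *)
Let coef_int k e : e \in Lfun mu 2%:E ->
  [/\ mu.-integrable setT (EFin \o (fun y => inner2 mu (K k ^~ y) e ^+ 2)),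
  mu2.-integrable setT (EFin \o
    (fun z => e z.1 * e z.2 * inner2 mu (K k z.1) (K k z.2))) &
  \int[mu]_y (inner2 mu (K k ^~ y) e ^+ 2) =
  \int[mu2]_z (e z.1 * e z.2 * inner2 mu (K k z.1) (K k z.2))].
Proof.
move=> e2.
pose g (w : (P * P) * P) : R :=
  (K k w.1.1 w.2 * e w.1.1) * (K k w.1.2 w.2 * e w.1.2).
have me := Lfun2_measurable e2.
have mg : measurable_fun setT g.
  apply: measurable_funM; apply: measurable_funM.
  - apply: (measurableT_comp (mK k) (g := fun w : (P * P) * P => (w.1.1, w.2))).
    apply: measurable_fun_pair => //.
    exact: measurableT_comp measurable_fst measurable_fst.
  - apply: (measurableT_comp me (g := fun w : (P * P) * P => w.1.1)).
    exact: measurableT_comp measurable_fst measurable_fst.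
  - apply: (measurableT_comp (mK k) (g := fun w : (P * P) * P => (w.1.2, w.2))).
    apply: measurable_fun_pair => //.
    exact: measurableT_comp measurable_snd measurable_fst.
  - apply: (measurableT_comp me (g := fun w : (P * P) * P => w.1.2)).
    exact: measurableT_comp measurable_snd measurable_fst.
have ib := Lfun2_integrableM b1_2 e2.
have ib2 := Lfun2_integrableM b2_2 b2_2.
have ig : (mu2 \x mu)%E.-integrable setT (EFin \o g).
  have ibb : mu2.-integrable setT
      (EFin \o (fun z : P * P => b1 z.1 * e z.1 * (b1 z.2 * e z.2))).
    exact: (integrable_tensor ib ib).
  apply: (le_integrable measurableT _ _ (integrable_tensor ibb ib2)) => /=.
    exact/measurable_EFinP.
  move=> w _ /=; rewrite lee_fin /g !normrM.
  have h1 := Kb k w.1.1 w.2; have h2 := Kb k w.1.2 w.2.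
  have := ler_pM (normr_ge0 _) (normr_ge0 _) h1 h2.
  move=> /(ler_wpM2r (normr_ge0 (e w.1.1 * e w.1.2))).
  rewrite normrM mulrACA => /le_trans; apply.
  apply: (le_trans (ler_norm _)); rewrite !normrM !normr_id.
  rewrite le_eqVlt; apply/orP; left; apply/eqP; ring.
have intx y : mu2.-integrable setT (fun z => (g (z, y))%:E).
  have h := Lfun2_integrableM (Kx k y) e2.
  exact: (integrable_tensor h h).
have inty z : mu.-integrable setT (fun y => (g (z, y))%:E).
  have := integrableZl measurableT (e z.1 * e z.2)
    (Lfun2_integrableM (Ky k z.1) (Ky k z.2)).
  apply: eq_integrable => // y _ /=; rewrite -EFinM; congr EFin.
  rewrite /g /=; ring.
have [int1 E1] := Fubini_Rintegral21 ig intx.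
have [int2 E2] := Fubini_Rintegral12 ig inty.
have F1 y : \int[mu2]_z g (z, y) = inner2 mu (K k ^~ y) e ^+ 2.
  have h := Lfun2_integrableM (Kx k y) e2.
  by rewrite expr2 -(Rintegral_tensor h h).
have F3 z : \int[mu]_y g (z, y) = e z.1 * e z.2 * inner2 mu (K k z.1) (K k z.2).
  rewrite -RintegralZl//; last exact: Lfun2_integrableM.
  by apply: eq_Rintegral => y _; rewrite /g /=; ring.
split.
- by apply: eq_integrable int1 => // y _ /=; rewrite F1.
- by apply: eq_integrable int2 => // z _ /=; rewrite F3.
- transitivity (\int[mu]_y \int[mu2]_z g (z, y)).
    by apply: eq_Rintegral => y _; rewrite F1.
  by rewrite -E1 E2; apply: eq_Rintegral => z _; rewrite F3.
Qed.

(** The functions [V k] use at most [#|J|] orthonormal functions of [x]; by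
Bessel's inequality the gap is at most the integral of the Gram kernel against
the kernel [p] of the projection on their span, whose squared norm is their
number. The inequality of arithmetic and geometric means, with a free
parameter [t], then separates the rank from the Gram kernel. *)
Lemma finite_rank_bound (t : R) : 0 < t ->
  \int[mu2]_z (\sum_k gap k z) <=
  (t * #|J|%:R + t^-1 * \int[mu2]_z (gram_kernel z ^+ 2)) / 2.
Proof.
move=> t0; rewrite Rintegral_sum; last by move=> k; exact: integrable_gap.
have H2 := Lfun2_gram_kernel.
pose S : {pred (P -> R)} := Lfun mu 2%:E.
have S0 : 0 \in S by exact: Lfun2_0.
have SP a v w : v \in S -> w \in S -> a *: v + w \in S by exact: Lfun2_comb.
have BC := inner2C mu.
have BP a v w u : v \in S -> w \in S -> u \in S -> inner2 mu u (a *: v + w) =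
    a * inner2 mu u v + inner2 mu u w by exact: inner2P.
have Bge0 v : v \in S -> 0 <= inner2 mu v v by move=> _; exact: inner2_ge0.
have [|us [szus usS us1 usF]] :=
    gram_schmidt S0 SP BC BP Bge0 (fs := [seq F j | j <- enum J]).
  by move=> _ /mapP[j _ ->]; exact: F2.
have repF j : reproduces S (inner2 mu) us (F j).
  by apply: usF; apply: map_f; rewrite mem_enum.
rewrite size_map -cardE in szus.
pose n := size us; pose u (i : 'I_n) : P -> R := nth 0 us i.
have uS i : u i \in Lfun mu 2%:E by apply: usS; rewrite mem_nth.
have sumE (f : (P -> R) -> R) : \sum_(e <- us) f e = \sum_i f (u i).
  by rewrite (big_nth 0) big_mkord.
(* Bessel's inequality in [x], for each fixed [y] *)
have step1 k : \int[mu2]_z gap k z <=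
    \sum_i \int[mu]_y (inner2 mu (K k ^~ y) (u i) ^+ 2).
  have Vx y : (fun x => V k (x, y)) = \sum_j G k j y *: F j.
    by apply/funext => x; rewrite fct_sumE; apply: eq_bigr => j _; rewrite mulrC.
  have Vx2 y : (fun x => V k (x, y)) \in Lfun mu 2%:E.
    by rewrite Vx; exact: Lfun2_sum.
  have gx y : mu.-integrable setT (fun x => (gap k (x, y))%:E).
    have h1 := Lfun2_integrableM (Kx k y) (Vx2 y).
    have h2 := Lfun2_integrableM (Vx2 y) (Vx2 y).
    have := integrableB measurableT (integrableZl measurableT 2 h1) h2.
    apply: eq_integrable => // x _ /=; rewrite -?EFinM -?EFinB; congr EFin.
    by rewrite /gap/=; ring.
  have [int1 ->] := Fubini_Rintegral21 (integrable_gap k) gx.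
  have ci i := (coef_int k (uS i)).
  rewrite -Rintegral_sum; last by move=> i; have [] := ci i.
  apply: le_Rintegral => //.
    by apply: integrable_sumR => i; have [] := ci i.
  move=> y _.
  have -> : \int[mu]_x gap k (x, y) = 2 * inner2 mu (K k ^~ y)
     (fun x => V k (x, y)) - inner2 mu (fun x => V k (x, y)) (fun x => V k (x, y)).
    have h1 := Lfun2_integrableM (Kx k y) (Vx2 y).
    have h2 := Lfun2_integrableM (Vx2 y) (Vx2 y).
    rewrite /inner2 -RintegralZl// -RintegralB//; last first.
      have := integrableZl measurableT 2 h1.
      by apply: eq_integrable => // x _ /=; rewrite EFinM.
    by apply: eq_Rintegral => x _; rewrite /gap /=; ring.
  have := bessel_span S0 SP BC BP (r := enum J) (h := fun j => G k j y)
    usS F2 repF (Kx k y).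
  move=> /(_ (fun x => V k (x, y))); rewrite sumE; apply.
  by rewrite Vx big_enum.
apply: (le_trans (ler_sum _ (fun k _ => step1 k))).
pose p (z : P * P) : R := \sum_i u i z.1 * u i z.2.
have p2 : p \in Lfun mu2 2%:E.
  rewrite (_ : p = \sum_i 1 *: (fun z : P * P => u i z.1 * u i z.2)).
    by apply: Lfun2_sum => i; exact: Lfun2_tensor.
  apply/funext => z; rewrite fct_sumE; apply: eq_bigr => i _.
  by rewrite scale1r.
have -> : \sum_k \sum_i \int[mu]_y (inner2 mu (K k ^~ y) (u i) ^+ 2) =
    \int[mu2]_z (p z * gram_kernel z).
  transitivity (\sum_k \sum_i \int[mu2]_z
      (u i z.1 * u i z.2 * inner2 mu (K k z.1) (K k z.2))).
    apply: eq_bigr => k _; apply: eq_bigr => i _.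
    by have [] := coef_int k (uS i).
  under eq_bigr => k _.
    rewrite -Rintegral_sum; last by move=> i; have [] := coef_int k (uS i).
    over.
  rewrite -Rintegral_sum => [|k]; last first.
    by apply: integrable_sumR => i; have [] := coef_int k (uS i).
  apply: eq_Rintegral => z _; rewrite /p /gram_kernel mulr_sumr.
  by apply: eq_bigr => k _; rewrite mulr_suml.
have pp : \int[mu2]_z (p z * p z) = n%:R.
  transitivity (\int[mu2]_z \sum_i \sum_j
      ((u i z.1 * u j z.1) * (u i z.2 * u j z.2))).
    apply: eq_Rintegral => z _; rewrite /p mulr_suml; apply: eq_bigr => i _.
    by rewrite mulr_sumr; apply: eq_bigr => j _; rewrite mulrACA.
  have iuu i j := Lfun2_integrableM (uS i) (uS j).
  have it i j := integrable_tensor (iuu i j) (iuu i j).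
  rewrite Rintegral_sum; last by move=> i; apply: integrable_sumR => j; exact: it.
  rewrite -[n in RHS]card_ord -sumr_const; apply: eq_bigr => i _.
  rewrite Rintegral_sum; last by move=> j; exact: it.
  have [uu rep] := us1 (u i) (mem_nth 0 (ltn_ord i)).
  rewrite -uu (rep _ (uS i)) sumE; apply: eq_bigr => j _.
  by rewrite (Rintegral_tensor (iuu i j) (iuu i j)) (BC (u j)).
have ipp := Lfun2_integrableM p2 p2.
have iHH := Lfun2_integrableM H2 H2.
have HH : \int[mu2]_z (gram_kernel z ^+ 2) = \int[mu2]_z (gram_kernel z * gram_kernel z).
  by apply: eq_Rintegral => z _; rewrite expr2.
apply: (@le_trans _ _ (\int[mu2]_z (t / 2 * (p z * p z) +
    t^-1 / 2 * (gram_kernel z * gram_kernel z)))).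
  apply: le_Rintegral => //.
  - exact: Lfun2_integrableM.
  - exact: (integrableD measurableT (integrableZl measurableT (t / 2) ipp)
      (integrableZl measurableT (t^-1 / 2) iHH)).
  - move=> z _; rewrite -subr_ge0.
    have -> : t / 2 * (p z * p z) + t^-1 / 2 * (gram_kernel z * gram_kernel z) -
        p z * gram_kernel z = (t * p z - gram_kernel z) ^+ 2 / (2 * t).
      by field; rewrite gt_eqF.
    by rewrite divr_ge0 ?sqr_ge0// mulr_ge0// ltW.
rewrite RintegralD//; last 2 first.
- exact: (integrableZl measurableT (t / 2) ipp).
- exact: (integrableZl measurableT (t^-1 / 2) iHH).
rewrite !RintegralZl// pp HH.
have : (n%:R : R) <= #|J|%:R by rewrite ler_nat.
move=> /(ler_wpM2l (ltW t0)); lra.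
Qed.

End FiniteRank.

(** * Oscillatory integrals *)

Section Oscillation.
Context {R : realType}.
Local Notation mu := (@lebesgue_measure R).

(** One integration by parts: the antiderivative [S / w] of the leading term
is bounded by [lambda^-1], and only its variation is left to integrate. *)
Lemma oscillatory_integral (a b lambda m : R) (C S w dw : R -> R) : a < b ->
  0 < lambda ->
  (forall t, a <= t <= b -> is_derive t 1 C (- (w t * S t))) ->
  (forall t, a <= t <= b -> is_derive t 1 S (w t * C t)) ->
  (forall t, a <= t <= b -> is_derive t 1 w (dw t)) ->
  (forall t, a <= t <= b -> {for t, continuous dw}) ->
  (forall t, a <= t <= b -> lambda <= `|w t|) ->
  (forall t, a <= t <= b -> `|dw t| <= m) ->
  (forall t, `|S t| <= 1) ->
  `|\int[mu]_(t in `[a, b]) C t| <= 2 / lambda + (b - a) * m / lambda ^+ 2.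
Proof.
move=> ab l0 dC dS dwE cdw wl dwm S1.
have cont (f df : R -> R) (h : forall t, a <= t <= b -> is_derive t 1 f (df t)) t :
    a <= t <= b -> {for t, continuous f}.
  by move=> /h ?; apply: differentiable_continuous; apply/derivable1_diffP.
have cC := cont _ (fun t => - (w t * S t)) dC.
have cS := cont _ (fun t => w t * C t) dS; have cw := cont _ dw dwE.
have w0 t : a <= t <= b -> w t != 0.
  by move=> /wl; rewrite -normr_gt0; exact: lt_le_trans.
pose r t := S t * dw t / w t ^+ 2.
pose f t := C t - r t.
pose Phi t := S t / w t.
have dPhi t : a <= t <= b -> is_derive t 1 Phi (f t).
  move=> tab; have := dS _ tab; have := dwE _ tab => ? ?.
  have ? := w0 _ tab; apply: is_derive_eq.
  rewrite /f /r /GRing.scale /=; field; exact: w0.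
have cr t : a <= t <= b -> {for t, continuous r}.
  move=> tab; apply: cvgM; first by apply: cvgM; [exact: cS|exact: cdw].
  apply: cvgV; first by rewrite expf_neq0// w0.
  exact: (cvgM (cw _ tab) (cw _ tab)).
have cf t : a <= t <= b -> {for t, continuous f}.
  by move=> tab; apply: cvgB; [exact: cC|exact: cr].
have within (g : R -> R) : (forall t, a <= t <= b -> {for t, continuous g}) ->
    {within `[a, b], continuous g}.
  move=> cg; apply: continuous_in_subspaceT => t /[!inE]/= tab.
  by apply: cg; rewrite in_itv in tab.
have intg (g : R -> R) : (forall t, a <= t <= b -> {for t, continuous g}) ->
    mu.-integrable `[a, b] (EFin \o g).
  move=> cg; apply: continuous_compact_integrable; first exact: segment_compact.
  exact: within.
have cPhi := cont _ f dPhi.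
have FTC : \int[mu]_(t in `[a, b]) f t = Phi b - Phi a.
  rewrite /Rintegral (continuous_FTC2 ab (F := Phi) (within _ cf))//; last first.
    move=> t; rewrite in_itv/= => /andP[at_ tb].
    have := dPhi t; rewrite (ltW at_) (ltW tb) => /(_ isT) ?.
    by rewrite derive1E derive_val.
  split.
  - move=> t; rewrite in_itv/= => /andP[at_ tb].
    by have := dPhi t; rewrite (ltW at_) (ltW tb) => /(_ isT) [].
  - by apply: cvg_at_right_filter; apply: cPhi; rewrite lexx ltW.
  - by apply: cvg_at_left_filter; apply: cPhi; rewrite lexx ltW.
have -> : \int[mu]_(t in `[a, b]) C t = Phi b - Phi a +
    \int[mu]_(t in `[a, b]) r t.
  rewrite -FTC -RintegralD//; [|exact: intg..].
  by apply: eq_Rintegral => t _; rewrite /f subrK.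
have Phi_le t : a <= t <= b -> `|Phi t| <= lambda^-1.
  move=> tab; rewrite normrM -[leRHS]mul1r ler_pM// normfV lef_pV2 ?posrE//.
    exact: wl.
  by rewrite normr_gt0 w0.
rewrite (le_trans (ler_normD _ _))// lerD//.
  rewrite (le_trans (ler_normB _ _))// mulr_natl mulr2n.
  by rewrite lerD// Phi_le// lexx ltW.
rewrite (le_trans (le_normr_Rintegral _ (intg _ cr)))//.
have m0 : 0 <= m by rewrite (le_trans _ (dwm a _))// lexx ltW.
have -> : (b - a) * m / lambda ^+ 2 = \int[mu]_(t in `[a, b]) (m / lambda ^+ 2).
  rewrite Rintegral_cst//= lebesgue_measure_itv/= lte_fin ab/=.
  by rewrite -mulrA mulrC.
apply: le_Rintegral => //.
- exact: (integrable_norm (intg _ cr)).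
- by apply: intg => t _; exact: cvg_cst.
- move=> t /= /[!in_itv]/= tab; rewrite /r !normrM normfV normrX.
  apply: ler_pM => //; first by rewrite -[m]mul1r ler_pM// dwm.
  rewrite lef_pV2 ?posrE ?exprn_gt0 ?normr_gt0 ?w0//.
  by rewrite lerXn2r ?nnegrE ?(ltW l0)// wl.
Qed.

End Oscillation.

(** * The phase as a power of the direction *)

Section Phase.
Context {R : realType}.
Implicit Types (u v x y : R * R) (n : nat).
Local Notation P := (measurableTypeR R * measurableTypeR R)%type.

Definition nsq u : R := u.1 ^+ 2 + u.2 ^+ 2.

Lemma nsq_ge0 u : 0 <= nsq u.
Proof. by rewrite addr_ge0// sqr_ge0. Qed.

Lemma enorm_gt0 u : (0 < enorm u) = (0 < nsq u).
Proof. by rewrite sqrtr_gt0. Qed.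

Lemma enorm_sqr u : enorm u ^+ 2 = nsq u.
Proof. by rewrite sqr_sqrtr// nsq_ge0. Qed.

(** The direction of [u] as a complex number, so that [circ u ^+ n] is
[expi (n%:R * polar_angle u)]: unlike the polar angle, it is smooth away from
the origin. *)
Definition circ u : R[i] := ((u.1 / enorm u) +i* (u.2 / enorm u))%C.
Definition pcos n u : R := complex.Re (circ u ^+ n).
Definition psin n u : R := complex.Im (circ u ^+ n).

Lemma pcosS n u : pcos n.+1 u =
  pcos n u * (u.1 / enorm u) - psin n u * (u.2 / enorm u).
Proof. by rewrite /pcos /psin exprSr; case: (circ u ^+ n). Qed.

Lemma psinS n u : psin n.+1 u =
  pcos n u * (u.2 / enorm u) + psin n u * (u.1 / enorm u).
Proof. by rewrite /pcos /psin exprSr; case: (circ u ^+ n). Qed.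

Lemma pcos0 u : pcos 0 u = 1. Proof. by []. Qed.
Lemma psin0 u : psin 0 u = 0. Proof. by []. Qed.

Lemma circ_le1 u : (u.1 / enorm u) ^+ 2 + (u.2 / enorm u) ^+ 2 <= 1.
Proof.
rewrite !exprMn -mulrDl exprVn enorm_sqr -/(nsq u).
have [->|u0] := eqVneq (nsq u) 0; first by rewrite mul0r.
by rewrite divff.
Qed.

Lemma pcos_psin_le1 n u : pcos n u ^+ 2 + psin n u ^+ 2 <= 1.
Proof.
elim: n => [|n IHn]; first by rewrite pcos0 psin0; lra.
rewrite pcosS psinS; set c := pcos n u in IHn *; set s := psin n u in IHn *.
have := circ_le1 u; set a := _ / _; set b := _ / _ => ab1.
have -> : (c * a - s * b) ^+ 2 + (c * b + s * a) ^+ 2 =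
  (c ^+ 2 + s ^+ 2) * (a ^+ 2 + b ^+ 2) by ring.
by apply: mulr_ile1 => //; rewrite addr_ge0// sqr_ge0.
Qed.

Lemma sqrD_le1 (a b : R) : a ^+ 2 + b ^+ 2 <= 1 -> `|a| <= 1.
Proof.
move=> ab; rewrite -sqrtr_sqr -[leRHS]sqrtr1 ler_sqrt//.
by apply: le_trans ab; rewrite lerDl sqr_ge0.
Qed.

Lemma pcos_le1 n u : `|pcos n u| <= 1.
Proof. exact: sqrD_le1 (pcos_psin_le1 n u). Qed.

Lemma psin_le1 n u : `|psin n u| <= 1.
Proof. by apply: (@sqrD_le1 _ (pcos n u)); rewrite addrC pcos_psin_le1. Qed.

Lemma cos_polar_angle u : 0 < nsq u ->
  cos (polar_angle u) = u.1 / enorm u /\ sin (polar_angle u) = u.2 / enorm u.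
Proof.
move=> u0; have e0 : 0 < enorm u by rewrite enorm_gt0.
have E : (u.1 / enorm u) ^+ 2 + (u.2 / enorm u) ^+ 2 = 1.
  by rewrite !exprMn -mulrDl exprVn enorm_sqr -/(nsq u) divff// gt_eqF.
have c1 : -1 <= u.1 / enorm u <= 1.
  by rewrite -ler_norml; apply: (@sqrD_le1 _ (u.2 / enorm u)); rewrite E.
have sE : sin (acos (u.1 / enorm u)) = `|u.2 / enorm u|.
  by rewrite sin_acos// -sqrtr_sqr; congr Num.sqrt; rewrite -E; ring.
rewrite /polar_angle; case: ifPn => u2.
  rewrite acosK ?in_itv//= sE; split=> //.
  by rewrite ger0_norm// divr_ge0// ltW.
rewrite cosN sinN acosK ?in_itv//= sE; split=> //.
by rewrite ltr0_norm ?opprK// pmulr_llt0 ?invr_gt0// ltNge.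
Qed.

Lemma expi_polar_angle n u : 0 < nsq u ->
  expi (- (n%:R * polar_angle u)) = (pcos n u +i* - psin n u)%C.
Proof.
move=> u0; rewrite /expi cosN sinN; have [cE sE] := cos_polar_angle u0.
suff [-> ->] : cos (n%:R * polar_angle u) = pcos n u /\
  sin (n%:R * polar_angle u) = psin n u by [].
elim: n => [|n [IHc IHs]]; first by rewrite mul0r cos0 sin0.
rewrite -addn1 natrD mulrDl mul1r cosD sinD IHc IHs cE sE addn1 pcosS psinS.
by split=> //; rewrite addrC.
Qed.

Lemma measurable_enorm : measurable_fun setT (enorm : P -> R).
Proof.
rewrite /enorm; apply: (measurableT_comp (f := @Num.sqrt R)).
  by apply: continuous_measurable_fun => x; exact: sqrt_continuous.
apply: measurable_funD; apply: measurable_funX.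
  exact: measurable_fst.
exact: measurable_snd.
Qed.

Lemma measurable_enormV : measurable_fun setT (fun u : P => (enorm u)^-1).
Proof.
rewrite (_ : (fun u => _) = fun u : P => enorm u `^ (-1)); last first.
  by apply/funext => u; rewrite powR_inv1// sqrtr_ge0.
exact: (measurableT_comp (measurable_powR (-1)) measurable_enorm).
Qed.

Lemma measurable_phase n : measurable_fun setT (pcos n : P -> R) /\
  measurable_fun setT (psin n : P -> R).
Proof.
have m1 : measurable_fun setT (fun u : P => u.1 / enorm u).
  apply: measurable_funM; first exact: measurable_fst.
  exact: measurable_enormV.
have m2 : measurable_fun setT (fun u : P => u.2 / enorm u).
  apply: measurable_funM; first exact: measurable_snd.
  exact: measurable_enormV.
elim: n => [|n [IHc IHs]].
  split; first by rewrite (_ : pcos 0 = cst 1).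
  by rewrite (_ : psin 0 = cst 0).
split.
  rewrite (_ : pcos n.+1 = fun u : P =>
    pcos n u * (u.1 / enorm u) - psin n u * (u.2 / enorm u)); last first.
    by apply/funext => u; exact: pcosS.
  by apply: measurable_funB; exact: measurable_funM.
rewrite (_ : psin n.+1 = fun u : P =>
  pcos n u * (u.2 / enorm u) + psin n u * (u.1 / enorm u)); last first.
  by apply/funext => u; exact: psinS.
by apply: measurable_funD; exact: measurable_funM.
Qed.

(** As [w] is the speed of the polar angle, the derivative of [circ] along the
curve is ['i * w] times [circ]; the powers follow by induction. *)
Lemma is_derive_phase n (u1 u2 : R -> R) (t p q : R) :
  is_derive t 1 u1 p -> is_derive t 1 u2 q -> 0 < nsq (u1 t, u2 t) ->
  let w := (u1 t * q - u2 t * p) / nsq (u1 t, u2 t) in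
  is_derive t 1 (fun s => pcos n (u1 s, u2 s))
    (- (n%:R * w * psin n (u1 t, u2 t))) /\
  is_derive t 1 (fun s => psin n (u1 s, u2 s))
    (n%:R * w * pcos n (u1 t, u2 t)).
Proof.
move=> d1 d2 u0 w.
have e0 : 0 < enorm (u1 t, u2 t) by rewrite enorm_gt0.
have en0 : enorm (u1 t, u2 t) != 0 by rewrite gt_eqF.
have e2 := enorm_sqr (u1 t, u2 t); rewrite /nsq /= in e2.
have de : is_derive t 1 (fun s => enorm (u1 s, u2 s))
    ((u1 t * p + u2 t * q) / enorm (u1 t, u2 t)).
  have dn : is_derive t 1 (fun s => u1 s ^+ 2 + u2 s ^+ 2)
      (2 * (u1 t * p + u2 t * q)).
    by apply: is_derive_eq; rewrite /GRing.scale /=; ring.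
  have := @is_derive1_comp _ Num.sqrt (fun s => u1 s ^+ 2 + u2 s ^+ 2) t _ _
    (is_derive1_sqrt u0) dn.
  move=> /is_derive_eq; apply; rewrite -/(enorm (u1 t, u2 t)).
  by field; exact: en0.
have dc : is_derive t 1 (fun s => u1 s / enorm (u1 s, u2 s))
    (- (w * (u2 t / enorm (u1 t, u2 t)))).
  have ? := @is_deriveV _ (fun s => enorm (u1 s, u2 s)) _ _ _ en0 de.
  apply: is_derive_eq; rewrite /GRing.scale /= /w /nsq /= -e2.
  have /eqP := e2; rewrite -subr_eq0 => /eqP e2'.
  apply/eqP; rewrite -subr_eq0; apply/eqP.
  set E := enorm _ in en0 e2 e2' *.
  transitivity (p * (E ^+ 2 - (u1 t ^+ 2 + u2 t ^+ 2)) / E ^+ 3); first by field.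
  by rewrite e2' mulr0 mul0r.
have ds : is_derive t 1 (fun s => u2 s / enorm (u1 s, u2 s))
    (w * (u1 t / enorm (u1 t, u2 t))).
  have ? := @is_deriveV _ (fun s => enorm (u1 s, u2 s)) _ _ _ en0 de.
  apply: is_derive_eq; rewrite /GRing.scale /= /w /nsq /= -e2.
  have /eqP := e2; rewrite -subr_eq0 => /eqP e2'.
  apply/eqP; rewrite -subr_eq0; apply/eqP.
  set E := enorm _ in en0 e2 e2' *.
  transitivity (q * (E ^+ 2 - (u1 t ^+ 2 + u2 t ^+ 2)) / E ^+ 3); first by field.
  by rewrite e2' mulr0 mul0r.
elim: n => [|n [IHc IHs]].
  rewrite !mul0r oppr0; split; exact: is_derive_cst.
split.
  rewrite (_ : (fun s => pcos n.+1 (u1 s, u2 s)) = fun s =>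
      pcos n (u1 s, u2 s) * (u1 s / enorm (u1 s, u2 s)) -
      psin n (u1 s, u2 s) * (u2 s / enorm (u1 s, u2 s))); last first.
    by apply/funext => s; exact: pcosS.
  apply: is_derive_eq.
  by rewrite /GRing.scale /= psinS /= -natr1; ring.
rewrite (_ : (fun s => psin n.+1 (u1 s, u2 s)) = fun s =>
    pcos n (u1 s, u2 s) * (u2 s / enorm (u1 s, u2 s)) +
    psin n (u1 s, u2 s) * (u1 s / enorm (u1 s, u2 s))); last first.
  by apply/funext => s; exact: psinS.
apply: is_derive_eq.
by rewrite /GRing.scale /= pcosS /= -natr1; ring.
Qed.

End Phase.

(** * Gradient of a difference of polar angles *)

Section Gradient.
Context {R : realFieldType}.

Lemma prod_bound (a b A B : R) : `|a| <= A -> `|b| <= B -> - (A * B) <= a * b <= A * B.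
Proof. by move=> aA bB; rewrite -ler_norml normrM ler_pM. Qed.

Lemma coord_le (w1 w2 L : R) : 0 <= L -> w1 ^+ 2 + w2 ^+ 2 = L ^+ 2 -> `|w1| <= L.
Proof.
move=> L0 wL; rewrite -(@ler_pXn2r _ 2) ?nnegrE// real_normK ?num_real//.
by rewrite -wL lerDl sqr_ge0.
Qed.

Lemma nsq_near (w1 w2 u1 u2 L rho : R) : 0 < L -> w1 ^+ 2 + w2 ^+ 2 = L ^+ 2 ->
  32 * rho <= L -> `|u1 - w1| <= rho -> `|u2 - w2| <= rho ->
  4 / 5 * L ^+ 2 <= u1 ^+ 2 + u2 ^+ 2 <= 6 / 5 * L ^+ 2.
Proof.
move=> L0 wL rL a1 a2.
have w1L := coord_le (ltW L0) wL.
have w2L : `|w2| <= L by apply: (@coord_le w2 w1); rewrite ?(ltW L0)// addrC.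
have r0 : 0 <= rho := le_trans (normr_ge0 _) a1.
have h1 := prod_bound w1L a1; have h2 := prod_bound w2L a2.
have s1 := prod_bound a1 a1; have s2 := prod_bound a2 a2.
have rL1 : L * rho <= L ^+ 2 / 32.
  by have := ler_wpM2l (ltW L0) rL; lra.
have rr : rho * rho <= L * rho / 32.
  by have := ler_wpM2r r0 rL; lra.
have r1 : 0 <= L * rho by rewrite mulr_ge0// ltW.
rewrite (_ : u1 ^+ 2 + u2 ^+ 2 = L ^+ 2 + 2 * (w1 * (u1 - w1)) +
  2 * (w2 * (u2 - w2)) + (u1 - w1) * (u1 - w1) + (u2 - w2) * (u2 - w2)); last first.
  by rewrite -wL; ring.
by have sq1 := sqr_ge0 (u1 - w1); have sq2 := sqr_ge0 (u2 - w2); lra.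
Qed.

(** Writing [u] and [v] as complex numbers, the gradient in [y] of
[arg (x - y) - arg (x' - y)] is essentially [(u - v) / (u * v)] with
[u = x - y] and [v = x' - y].  When [u] and [v] stay close to a fixed [w] this
is close to [(u - v) / w ^+ 2], which does not depend on [y]: whichever
coordinate of the latter dominates is bounded below uniformly in [y]. *)
Lemma phase_gradient (w1 w2 u1 u2 v1 v2 L rho z : R) : 0 < L ->
  w1 ^+ 2 + w2 ^+ 2 = L ^+ 2 -> 32 * rho <= L ->
  `|u1 - w1| <= rho -> `|u2 - w2| <= rho ->
  `|v1 - w1| <= rho -> `|v2 - w2| <= rho ->
  `|u1 - v1| <= z -> `|u2 - v2| <= z ->
  z ^+ 2 <= (u1 - v1) ^+ 2 + (u2 - v2) ^+ 2 ->
  ((u1 - v1) * (w1 ^+ 2 - w2 ^+ 2) + (u2 - v2) * (2 * w1 * w2)) ^+ 2 <=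
  ((u2 - v2) * (w1 ^+ 2 - w2 ^+ 2) - (u1 - v1) * (2 * w1 * w2)) ^+ 2 ->
  z / (5 * L ^+ 2) <=
  `|u2 / (u1 ^+ 2 + u2 ^+ 2) - v2 / (v1 ^+ 2 + v2 ^+ 2)|.
Proof.
move=> L0 wL rL a1 a2 b1 b2 z1 z2 zz dom.
have z0 : 0 <= z := le_trans (normr_ge0 _) z1.
have L2 : 0 < L ^+ 2 by rewrite exprn_gt0.
have /andP[u_lo u_hi] := nsq_near L0 wL rL a1 a2.
have /andP[v_lo v_hi] := nsq_near L0 wL rL b1 b2.
set U := u1 ^+ 2 + u2 ^+ 2 in u_lo u_hi *.
set V := v1 ^+ 2 + v2 ^+ 2 in v_lo v_hi *.
have U0 : 0 < U by apply: lt_le_trans u_lo; lra.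
have V0 : 0 < V by apply: lt_le_trans v_lo; lra.
pose p := u1 * v1 - u2 * v2; pose m := u1 * v2 + u2 * v1.
pose p0 := w1 ^+ 2 - w2 ^+ 2; pose m0 := 2 * w1 * w2.
rewrite -/p0 -/m0 in dom.
have -> : u2 / U - v2 / V = ((u2 - v2) * p - (u1 - v1) * m) / (U * V).
  rewrite (_ : (u2 - v2) * p - (u1 - v1) * m = u2 * V - v2 * U).
    by field; rewrite !gt_eqF.
  by rewrite /U /V /p /m; ring.
rewrite normrM normfV (gtr0_norm (mulr_gt0 U0 V0)).
have UV : U * V <= 2 * L ^+ 2 * L ^+ 2.
  apply: (@le_trans _ _ (6 / 5 * L ^+ 2 * (6 / 5 * L ^+ 2))).
    by apply: ler_pM => //; exact: ltW.
  have := mulr_gt0 L2 L2; lra.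
rewrite ler_pdivlMr ?mulr_gt0//.
apply: (@le_trans _ _ (2 / 5 * z * L ^+ 2)).
  have := ler_wpM2l (divr_ge0 z0 (ltW (mulr_gt0 (ltr0Sn R 4) L2))) UV.
  move=> /le_trans; apply; rewrite le_eqVlt; apply/orP; left; apply/eqP.
  by field; rewrite gt_eqF.
(* the dominating coordinate carries half of the squared length, and
   [7 / 10] is less than the square root of [1 / 2] *)
have main : 7 / 10 * z * L ^+ 2 <= `|(u2 - v2) * p0 - (u1 - v1) * m0|.
  rewrite -(@ler_pXn2r _ 2) ?nnegrE//; last first.
    by rewrite !mulr_ge0// ltW.
  rewrite real_normK ?num_real//.
  have id : ((u1 - v1) * p0 + (u2 - v2) * m0) ^+ 2 +
      ((u2 - v2) * p0 - (u1 - v1) * m0) ^+ 2 =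
      ((u1 - v1) ^+ 2 + (u2 - v2) ^+ 2) * (L ^+ 2) ^+ 2.
    by rewrite -wL /p0 /m0; ring.
  have := ler_wpM2r (sqr_ge0 (L ^+ 2)) zz; rewrite -id => h.
  have : 0 <= z ^+ 2 * (L ^+ 2) ^+ 2 by rewrite mulr_ge0// sqr_ge0.
  have -> : (7 / 10 * z * L ^+ 2) ^+ 2 = 49 / 100 * (z ^+ 2 * (L ^+ 2) ^+ 2).
    by field.
  set e1 := (_ + _) ^+ 2 in h dom; set e2 := (_ - _) ^+ 2 in h dom *.
  lra.
have w1L := coord_le (ltW L0) wL.
have w2L : `|w2| <= L by apply: (@coord_le w2 w1); rewrite ?(ltW L0)// addrC.
have r0 : 0 <= rho := le_trans (normr_ge0 _) a1.
have rL1 : L * rho <= L ^+ 2 / 32.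
  by have := ler_wpM2l (ltW L0) rL; lra.
have rr : rho * rho <= L * rho / 32.
  by have := ler_wpM2r r0 rL; lra.
have r1 : 0 <= L * rho by rewrite mulr_ge0// ltW.
have dp : `|p - p0| <= 3 / 20 * L ^+ 2.
  rewrite /p /p0 (_ : _ - _ = w1 * (v1 - w1) - w2 * (v2 - w2) + w1 * (u1 - w1) -
    w2 * (u2 - w2) + (u1 - w1) * (v1 - w1) - (u2 - w2) * (v2 - w2)); last by ring.
  have := prod_bound w1L b1; have := prod_bound w2L b2.
  have := prod_bound w1L a1; have := prod_bound w2L a2.
  have := prod_bound a1 b1; have := prod_bound a2 b2.
  by rewrite ler_norml; lra.
have dm : `|m - m0| <= 3 / 20 * L ^+ 2.
  rewrite /m /m0 (_ : _ - _ = w1 * (v2 - w2) + w2 * (v1 - w1) + w1 * (u2 - w2) +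
    w2 * (u1 - w1) + (u1 - w1) * (v2 - w2) + (u2 - w2) * (v1 - w1)); last by ring.
  have := prod_bound w1L b2; have := prod_bound w2L b1.
  have := prod_bound w1L a2; have := prod_bound w2L a1.
  have := prod_bound a1 b2; have := prod_bound a2 b1.
  by rewrite ler_norml; lra.
rewrite (_ : (u2 - v2) * p - (u1 - v1) * m = ((u2 - v2) * p0 - (u1 - v1) * m0) +
  ((u2 - v2) * (p - p0) - (u1 - v1) * (m - m0))); last by ring.
have := prod_bound z2 dp; have := prod_bound z1 dm.
rewrite -!ler_norml => k1 k2.
apply: le_trans (lerB_normD _ _).
have := ler_normB ((u2 - v2) * (p - p0)) ((u1 - v1) * (m - m0)); lra.
Qed.

(** [2 * u1 * u2 / (u1 ^+ 2 + u2 ^+ 2) ^+ 2] is twice the product of the two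
coordinates of [u / |u| ^ 2], each of which varies between [u] and [v] by at most
a multiple of [z]. *)
Lemma phase_curvature (w1 w2 u1 u2 v1 v2 L rho z : R) : 0 < L ->
  w1 ^+ 2 + w2 ^+ 2 = L ^+ 2 -> 32 * rho <= L ->
  `|u1 - w1| <= rho -> `|u2 - w2| <= rho ->
  `|v1 - w1| <= rho -> `|v2 - w2| <= rho ->
  `|u1 - v1| <= z -> `|u2 - v2| <= z ->
  `|2 * u1 * u2 / (u1 ^+ 2 + u2 ^+ 2) ^+ 2 -
    2 * v1 * v2 / (v1 ^+ 2 + v2 ^+ 2) ^+ 2| <= 104 * z / L ^+ 3.
Proof.
move=> L0 wL rL a1 a2 b1 b2 z1 z2.
have z0 : 0 <= z := le_trans (normr_ge0 _) z1.
have L2 : 0 < L ^+ 2 by rewrite exprn_gt0.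
have /andP[u_lo u_hi] := nsq_near L0 wL rL a1 a2.
have /andP[v_lo v_hi] := nsq_near L0 wL rL b1 b2.
have w1L := coord_le (ltW L0) wL.
have w2L : `|w2| <= L by apply: (@coord_le w2 w1); rewrite ?(ltW L0)// addrC.
have near (a b : R) : `|b| <= L -> `|a - b| <= rho -> `|a| <= 5 / 4 * L.
  by rewrite !ler_norml; lra.
have u1L := near _ _ w1L a1; have u2L := near _ _ w2L a2.
have v1L := near _ _ w1L b1; have v2L := near _ _ w2L b2.
set U := u1 ^+ 2 + u2 ^+ 2 in u_lo u_hi *.
set V := v1 ^+ 2 + v2 ^+ 2 in v_lo v_hi *.
have U0 : 0 < U by apply: lt_le_trans u_lo; lra.
have V0 : 0 < V by apply: lt_le_trans v_lo; lra.
have inv (a A : R) : `|a| <= 5 / 4 * L -> 4 / 5 * L ^+ 2 <= A -> `|a / A| <= 2 / L.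
  move=> aL AL; have A0 : 0 < A by apply: lt_le_trans AL; lra.
  rewrite normrM normfV (gtr0_norm A0) ler_pdivrMr//.
  apply: (le_trans aL); rewrite [leRHS]mulrAC ler_pdivlMr//; lra.
pose p := u1 * v1 - u2 * v2; pose m := u1 * v2 + u2 * v1.
have pm (a b c d : R) : `|a| <= 5 / 4 * L -> `|b| <= 5 / 4 * L -> `|c| <= 5 / 4 * L ->
    `|d| <= 5 / 4 * L -> `|a * b| + `|c * d| <= 4 * L ^+ 2.
  move=> aL bL cL dL; have := prod_bound aL bL; have := prod_bound cL dL.
  by rewrite -!ler_norml; lra.
have pL : `|p| <= 4 * L ^+ 2 by apply: le_trans (ler_normB _ _) (pm _ _ _ _ _ _ _ _).
have mL : `|m| <= 4 * L ^+ 2 by apply: le_trans (ler_normD _ _) (pm _ _ _ _ _ _ _ _).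
have UV : 16 / 25 * (L ^+ 2 * L ^+ 2) <= U * V.
  rewrite (_ : 16 / 25 * (L ^+ 2 * L ^+ 2) = 4 / 5 * L ^+ 2 * (4 / 5 * L ^+ 2)).
    by apply: ler_pM => //; rewrite mulr_ge0// ltW.
  by field.
have quot (e : R) : `|e| <= 8 * z * L ^+ 2 -> `|e / (U * V)| <= 13 * z / L ^+ 2.
  move=> eL; rewrite normrM normfV (gtr0_norm (mulr_gt0 U0 V0)).
  rewrite ler_pdivrMr ?mulr_gt0//; apply: (le_trans eL).
  rewrite [leRHS]mulrAC ler_pdivlMr//.
  have := ler_wpM2l z0 UV; have := mulr_ge0 z0 (mulr_ge0 (ltW L2) (ltW L2)); lra.
have d2 : `|u2 / U - v2 / V| <= 13 * z / L ^+ 2.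
  have -> : u2 / U - v2 / V = ((u2 - v2) * p - (u1 - v1) * m) / (U * V).
    rewrite (_ : (u2 - v2) * p - (u1 - v1) * m = u2 * V - v2 * U).
      by field; rewrite !gt_eqF.
    by rewrite /U /V /p /m; ring.
  apply: quot; apply: (le_trans (ler_normB _ _)).
  have := prod_bound z2 pL; have := prod_bound z1 mL.
  by rewrite -!ler_norml; lra.
have d1 : `|u1 / U - v1 / V| <= 13 * z / L ^+ 2.
  have -> : u1 / U - v1 / V = - ((u1 - v1) * p + (u2 - v2) * m) / (U * V).
    rewrite (_ : - ((u1 - v1) * p + (u2 - v2) * m) = u1 * V - v1 * U).
      by field; rewrite !gt_eqF.
    by rewrite /U /V /p /m; ring.
  apply: quot; rewrite normrN; apply: (le_trans (ler_normD _ _)).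
  have := prod_bound z1 pL; have := prod_bound z2 mL.
  by rewrite -!ler_norml; lra.
rewrite (_ : _ - _ = 2 * (u1 / U * (u2 / U - v2 / V)) +
  2 * (v2 / V * (u1 / U - v1 / V))); last by field; rewrite !gt_eqF.
have := prod_bound (inv _ _ u1L u_lo) d2; have := prod_bound (inv _ _ v2L v_lo) d1.
rewrite -!ler_norml (_ : 2 / L * (13 * z / L ^+ 2) = 26 * z / L ^+ 3); last first.
  by field; rewrite gt_eqF.
rewrite (_ : 104 * z / L ^+ 3 = 4 * (26 * z / L ^+ 3)); last by field; rewrite gt_eqF.
set B := 26 * z / _ => h1 h2.
by apply: (le_trans (ler_normD _ _)); rewrite !(normrM 2) normr_nat; lra.
Qed.

End Gradient.

(** * The Gram kernel of the phase *)

Section PhaseKernel.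
Context {R : realType}.
Local Notation P := (measurableTypeR R * measurableTypeR R)%type.
Local Notation mu1 := (@lebesgue_measure R).
Local Notation mu := (@lebesgue2 R).

Lemma is_derive_inversion (p q t : R) : 0 < (p - t) ^+ 2 + q ^+ 2 ->
  is_derive t 1 (fun t => q / ((p - t) ^+ 2 + q ^+ 2))
    (2 * (p - t) * q / ((p - t) ^+ 2 + q ^+ 2) ^+ 2).
Proof.
move=> h; have k : (p - t) ^+ 2 + q ^+ 2 != 0 by rewrite gt_eqF.
have d : is_derive t 1 (fun t : R => (p - t) ^+ 2 + q ^+ 2) (- 2 * (p - t)).
  by apply: is_derive_eq; rewrite /GRing.scale /=; ring.
have dV := @is_deriveV _ (fun t => (p - t) ^+ 2 + q ^+ 2) t _ 1 k d.
have -> : (fun t => q / ((p - t) ^+ 2 + q ^+ 2)) =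
    q *: (fun t => ((p - t) ^+ 2 + q ^+ 2)^-1) by [].
by apply: is_derive_eq; rewrite /GRing.scale /=; field.
Qed.

Lemma continuous_inversion_derivative (p q t : R) : 0 < (p - t) ^+ 2 + q ^+ 2 ->
  {for t, continuous (fun t => 2 * (p - t) * q / ((p - t) ^+ 2 + q ^+ 2) ^+ 2)}.
Proof.
move=> h; have k : (p - t) ^+ 2 + q ^+ 2 != 0 by rewrite gt_eqF.
have cp : {for t, continuous (fun t : R => p - t)}.
  by apply: cvgB; [exact: cvg_cst|exact: cvg_id].
have cn : {for t, continuous (fun t : R => (p - t) ^+ 2 + q ^+ 2)}.
  by apply: cvgD; [exact: (cvgM cp cp)|exact: cvg_cst].
apply: cvgM; first apply: cvgM; [|exact: cvg_cst|].
  by apply: cvgM; [exact: cvg_cst|exact: cp].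
apply: cvgV; first by rewrite expf_neq0.
exact: (cvgM cn cn).
Qed.

(** The points [x - y] and [x' - y] are [(p1 - t, p2)] and [(q1 - t, q2)], with
[t] the moving coordinate of [y]. Exchanging the two coordinates reverses the
orientation of polar angles, hence the sign [s]. *)
Lemma phase_line_integral (n s L rho z w1 w2 p1 p2 q1 q2 a b : R)
    (C S : R -> R) : 0 < n -> `|s| = 1 -> 0 < z -> a < b -> 0 < L ->
  w1 ^+ 2 + w2 ^+ 2 = L ^+ 2 -> 32 * rho <= L ->
  (forall t, a <= t <= b -> `|p1 - t - w1| <= rho /\ `|q1 - t - w1| <= rho) ->
  `|p2 - w2| <= rho -> `|q2 - w2| <= rho ->
  `|p1 - q1| <= z -> `|p2 - q2| <= z ->
  z ^+ 2 <= (p1 - q1) ^+ 2 + (p2 - q2) ^+ 2 ->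
  ((p1 - q1) * (w1 ^+ 2 - w2 ^+ 2) + (p2 - q2) * (2 * w1 * w2)) ^+ 2 <=
  ((p2 - q2) * (w1 ^+ 2 - w2 ^+ 2) - (p1 - q1) * (2 * w1 * w2)) ^+ 2 ->
  (forall t, `|S t| <= 1) ->
  let W t := s * n * (p2 / ((p1 - t) ^+ 2 + p2 ^+ 2) -
                      q2 / ((q1 - t) ^+ 2 + q2 ^+ 2)) in
  (forall t, a <= t <= b -> is_derive t 1 C (- (W t * S t))) ->
  (forall t, a <= t <= b -> is_derive t 1 S (W t * C t)) ->
  `|\int[mu1]_(t in `[a, b]) C t| <= (10 * L ^+ 2 + 2600 * (b - a) * L) / (n * z).
Proof.
move=> n0 s1 z0 ab L0 wL rL pq1 p2w q2w z1 z2 zz dom S1 W dC dS.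
have pos t : a <= t <= b -> 0 < (p1 - t) ^+ 2 + p2 ^+ 2 /\ 0 < (q1 - t) ^+ 2 + q2 ^+ 2.
  move=> /pq1[h1 h2].
  have /andP[k1 _] := nsq_near L0 wL rL h1 p2w.
  have /andP[k2 _] := nsq_near L0 wL rL h2 q2w.
  have L2 : 0 < L ^+ 2 by rewrite exprn_gt0.
  by split; [apply: lt_le_trans k1|apply: lt_le_trans k2]; lra.
have shift t : p1 - t - (q1 - t) = p1 - q1 by ring.
pose dW t := s * n * (2 * (p1 - t) * p2 / ((p1 - t) ^+ 2 + p2 ^+ 2) ^+ 2 -
  2 * (q1 - t) * q2 / ((q1 - t) ^+ 2 + q2 ^+ 2) ^+ 2).
have := @oscillatory_integral R a b (n * z / (5 * L ^+ 2))
  (n * (104 * z / L ^+ 3)) C S W dW ab.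
(* [10] is [2 * 5] and [2600] is [104 * 5 ^+ 2], from the bounds on [W] and [dW] *)
rewrite (_ : 2 / _ + _ = (10 * L ^+ 2 + 2600 * (b - a) * L) / (n * z)); last first.
  by field; rewrite !gt_eqF.
apply.
- by rewrite !(divr_gt0, mulr_gt0)// exprn_gt0.
- move=> t /pos[h1 h2].
  have d1 := is_derive_inversion h1; have d2 := is_derive_inversion h2.
  exact: (is_deriveZ (s * n) (is_deriveB d1 d2)).
- move=> t /pos[h1 h2].
  have c1 := continuous_inversion_derivative h1; have c2 := continuous_inversion_derivative h2.
  by apply: cvgM; [exact: cvg_cst|exact: (cvgB c1 c2)].
- move=> t tab; have [h1 h2] := pq1 _ tab.
  rewrite /W !normrM s1 mul1r (gtr0_norm n0) -mulrA ler_pM2l//.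
  by apply: (@phase_gradient _ w1 w2 _ _ _ _ _ rho) => //; rewrite shift.
- move=> t tab; have [h1 h2] := pq1 _ tab.
  rewrite /dW !normrM s1 mul1r (gtr0_norm n0) ler_pM2l//.
  by apply: (@phase_curvature _ w1 w2 _ _ _ _ _ rho) => //; rewrite shift.
- exact: S1.
Qed.

(** Real and imaginary part of the product of the phase at [u] with the
conjugate of the phase at [v], of argument [n * (arg u - arg v)]. *)
Definition cosdiff n (u v : R * R) : R := pcos n u * pcos n v + psin n u * psin n v.
Definition sindiff n (u v : R * R) : R := psin n u * pcos n v - pcos n u * psin n v.

Lemma diff_sqr n u v : cosdiff n u v ^+ 2 + sindiff n u v ^+ 2 <= 1.
Proof.
rewrite /cosdiff /sindiff.
have := pcos_psin_le1 n u; have := pcos_psin_le1 n v.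
move: (pcos n u) (psin n u) (pcos n v) (psin n v) => a b c d cd ab.
have -> : (a * c + b * d) ^+ 2 + (b * c - a * d) ^+ 2 =
  (a ^+ 2 + b ^+ 2) * (c ^+ 2 + d ^+ 2) by ring.
by apply: mulr_ile1 => //; rewrite addr_ge0// sqr_ge0.
Qed.

Lemma cosdiff_le1 n u v : `|cosdiff n u v| <= 1.
Proof. exact: sqrD_le1 (diff_sqr n u v). Qed.

Lemma sindiff_le1 n u v : `|sindiff n u v| <= 1.
Proof. by apply: (@sqrD_le1 _ _ (cosdiff n u v)); rewrite addrC diff_sqr. Qed.

Lemma is_derive_diff n (u1 u2 v1 v2 : R -> R) (t p q : R) :
  is_derive t 1 u1 p -> is_derive t 1 u2 q ->
  is_derive t 1 v1 p -> is_derive t 1 v2 q ->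
  0 < nsq (u1 t, u2 t) -> 0 < nsq (v1 t, v2 t) ->
  let W := n%:R * ((u1 t * q - u2 t * p) / nsq (u1 t, u2 t) -
                   (v1 t * q - v2 t * p) / nsq (v1 t, v2 t)) in
  is_derive t 1 (fun s => cosdiff n (u1 s, u2 s) (v1 s, v2 s))
    (- (W * sindiff n (u1 t, u2 t) (v1 t, v2 t))) /\
  is_derive t 1 (fun s => sindiff n (u1 s, u2 s) (v1 s, v2 s))
    (W * cosdiff n (u1 t, u2 t) (v1 t, v2 t)).
Proof.
move=> du1 du2 dv1 dv2 u0 v0 W.
have [? ?] := is_derive_phase n du1 du2 u0.
have [? ?] := is_derive_phase n dv1 dv2 v0.
split; apply: is_derive_eq; rewrite /GRing.scale /= /W /cosdiff /sindiff.
  move: (pcos n _) (psin n _) (pcos n _) (psin n _) (_ / nsq _) (_ / nsq _).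
  by move=> *; ring.
move: (pcos n _) (psin n _) (pcos n _) (psin n _) (_ / nsq _) (_ / nsq _).
by move=> *; ring.
Qed.

Definition box (c : R * R) (r : R) : set (R * R) :=
  `[c.1 - r, c.1 + r]%classic `*` `[c.2 - r, c.2 + r]%classic.

Lemma boxP c r (y : R * R) : box c r y <-> `|y.1 - c.1| <= r /\ `|y.2 - c.2| <= r.
Proof.
rewrite /box /= !in_itv/= !ler_distl; split=> [[/andP[-> ->] /andP[-> ->]]//|].
by move=> [/andP[-> ->] /andP[-> ->]].
Qed.

Lemma measurable_box c r : measurable (box c r : set P).
Proof. exact: measurableX. Qed.

Lemma indic_box c r (y : R * R) : \1_(box c r) y =
  \1_(`[c.1 - r, c.1 + r]%classic) y.1 * \1_(`[c.2 - r, c.2 + r]%classic) y.2 :> R.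
Proof. by rewrite !indicE -natrM mulnb in_setX. Qed.

Lemma Rintegral_indic d (T : measurableType d) (m : {measure set T -> \bar R})
    (D : set T) (f : T -> R) :
  \int[m]_x (\1_D x * f x) = \int[m]_(x in D) f x.
Proof.
rewrite [RHS]Rintegral_mkcond; apply: eq_Rintegral => x _.
by rewrite patch_indic mulrC.
Qed.

Lemma Rintegral_indic_seg (a b : R) : a <= b ->
  \int[mu1]_x \1_(`[a, b]%classic) x = b - a.
Proof.
move=> ab; rewrite /Rintegral integral_indic// setIT /= lebesgue_measure_itv/=.
rewrite lte_fin; case: ltgtP ab => //= -> _.
by rewrite subrr.
Qed.

Lemma integrable_indic_box c r :
  mu.-integrable setT (EFin \o \1_(box c r)).
Proof.
have := integrable_tensor (@integrable_indic_itv R (c.1 - r) (c.1 + r) true false)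
  (@integrable_indic_itv R (c.2 - r) (c.2 + r) true false).
by apply: eq_integrable => // y _ /=; rewrite indic_box.
Qed.

Lemma Lfun2_indic_box c r : (\1_(box c r) : P -> R) \in Lfun mu 2%:E.
Proof.
apply/Lfun2P; split; first exact: measurable_indic (measurable_box _ _).
have := integrable_indic_box c r; apply: eq_integrable => // y _ /=.
by rewrite indicE; case: (_ \in _); rewrite ?expr1n ?expr0n.
Qed.

Lemma Rintegral_indic_box c r : 0 <= r ->
  \int[mu]_y \1_(box c r) y = 4 * r ^+ 2.
Proof.
move=> r0; under eq_Rintegral do rewrite indic_box.
rewrite (Rintegral_tensor (@integrable_indic_itv R (c.1 - r) (c.1 + r) true false)
  (@integrable_indic_itv R (c.2 - r) (c.2 + r) true false)).
by rewrite !Rintegral_indic_seg; [ring|lra..].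
Qed.

Lemma measurable_cosdiff n (x x' : R * R) :
  measurable_fun setT (fun y : P => cosdiff n (x - y) (x' - y)).
Proof.
have [mc ms] := @measurable_phase R n.
have mB (c : R * R) : measurable_fun setT (fun y : P => (c - y : P)).
  apply: measurable_fun_pair.
    by apply: measurable_funB => //; exact: measurable_fst.
  by apply: measurable_funB => //; exact: measurable_snd.
by apply: measurable_funD; apply: measurable_funM;
  [apply: (measurableT_comp mc)|apply: (measurableT_comp mc)|
   apply: (measurableT_comp ms)|apply: (measurableT_comp ms)]; exact: mB.
Qed.

(** The Gram kernel of the phase: two values of [x] interact through an
oscillating integral over a box of values of [y]. *)
Definition phase_gram n (b : R * R) (r : R) (x x' : R * R) : R :=
  \int[mu]_y (\1_(box b r) y * cosdiff n (x - y) (x' - y)).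

Let integrable_cosdiff n b r x x' :
  mu.-integrable setT (fun y => (\1_(box b r) y * cosdiff n (x - y) (x' - y))%:E).
Proof.
apply: le_integrable (integrable_indic_box b r) => //.
  apply/measurable_EFinP; apply: measurable_funM.
    exact: measurable_indic (measurable_box _ _).
  exact: measurable_cosdiff.
move=> y _; rewrite lee_fin normrM ler_piMr//; exact: cosdiff_le1.
Qed.

Lemma phase_gram_le n b r x x' : 0 <= r -> `|phase_gram n b r x x'| <= 4 * r ^+ 2.
Proof.
move=> r0; have ic := integrable_cosdiff n b r x x'.
rewrite -(Rintegral_indic_box b r0).
apply: (le_trans (le_normr_Rintegral measurableT ic)).
apply: le_Rintegral => //.
- exact: (integrable_norm ic).
- exact: integrable_indic_box.
- move=> y _; rewrite normrM ger0_norm// ler_piMr//; exact: cosdiff_le1.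
Qed.

(** A bound for the integral along one coordinate, uniform in the other one, is
enough; which coordinate that is depends on [x - x']. *)
Lemma phase_gram_line n b r x x' B : 0 <= r ->
  (forall y2, `|y2 - b.2| <= r ->
    `|\int[mu1]_(t in `[b.1 - r, b.1 + r]) cosdiff n (x - (t, y2)) (x' - (t, y2))|
    <= B) \/
  (forall y1, `|y1 - b.1| <= r ->
    `|\int[mu1]_(t in `[b.2 - r, b.2 + r]) cosdiff n (x - (y1, t)) (x' - (y1, t))|
    <= B) ->
  `|phase_gram n b r x x'| <= 2 * r * B.
Proof.
move=> r0 HB; have ic := integrable_cosdiff n b r x x'.
have mc := @measurable_cosdiff n x x'.
have seg c (f : R -> R) : measurable_fun setT f -> (forall t, `|f t| <= 1) ->
    mu1.-integrable setT (fun t => (\1_(`[c - r, c + r]%classic) t * f t)%:E).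
  move=> mf f1; apply: le_integrable (@integrable_indic_itv R (c - r) (c + r) true false) => //.
    by apply/measurable_EFinP; apply: measurable_funM => //; exact: measurable_indic.
  by move=> t _; rewrite lee_fin normrM ler_piMr.
have segZ c k (f : R -> R) : measurable_fun setT f -> (forall t, `|f t| <= 1) ->
    mu1.-integrable setT (fun t => (k * (\1_(`[c - r, c + r]%classic) t * f t))%:E).
  move=> mf f1; have := integrableZl measurableT k (seg c f mf f1).
  by apply: eq_integrable.
have fin c (k : R -> R) : (forall t, `|t - c| <= r -> `|k t| <= B) ->
    mu1.-integrable setT (EFin \o (fun t => \1_(`[c - r, c + r]%classic) t * k t)) ->
    `|\int[mu1]_t (\1_(`[c - r, c + r]%classic) t * k t)| <= 2 * r * B.
  move=> kB ik; apply: (le_trans (le_normr_Rintegral measurableT ik)).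
  rewrite (_ : 2 * r * B = \int[mu1]_t (B * \1_(`[c - r, c + r]%classic) t)); last first.
    rewrite RintegralZl//; last exact: integrable_indic_itv.
    by rewrite Rintegral_indic_seg; [ring|lra].
  apply: le_Rintegral => //.
  - exact: (integrable_norm ik).
  - have := integrableZl measurableT B (@integrable_indic_itv R (c - r) (c + r) true false).
    by apply: eq_integrable.
  - move=> t _; rewrite normrM indicE.
    case: (boolP (t \in _)) => [|_]; last by rewrite normr0 mul0r mulr0.
    by rewrite inE/= in_itv/= -ler_distl normr1 mul1r mulr1 => /kB.
case: HB => HB.
- have h y : mu1.-integrable setT (fun t => (\1_(box b r) (t, y) *
      cosdiff n (x - (t, y)) (x' - (t, y)))%:E).
    have := segZ b.1 (\1_(`[b.2 - r, b.2 + r]%classic) y) _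
      (measurable_fun_pair1 y mc) (fun t => cosdiff_le1 n _ _).
    apply: eq_integrable => // t _ /=; rewrite indic_box /=; congr EFin; ring.
  have [i2 E] := Fubini_Rintegral21 ic h.
  have F y : \int[mu1]_t (\1_(box b r) (t, y) *
      cosdiff n (x - (t, y)) (x' - (t, y))) = \1_(`[b.2 - r, b.2 + r]%classic) y *
      \int[mu1]_(t in `[b.1 - r, b.1 + r]) cosdiff n (x - (t, y)) (x' - (t, y)).
    rewrite -[X in _ = _ * X]Rintegral_indic -RintegralZl//; last first.
      exact: (seg b.1 _ (measurable_fun_pair1 y mc) (fun t => cosdiff_le1 n _ _)).
    by apply: eq_Rintegral => t _; rewrite indic_box /=; ring.
  rewrite [phase_gram _ _ _ _ _]E; under eq_Rintegral do rewrite F.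
  apply: fin => //; apply: eq_integrable i2 => // t _ /=.
  by rewrite F.
- have h y : mu1.-integrable setT (fun t => (\1_(box b r) (y, t) *
      cosdiff n (x - (y, t)) (x' - (y, t)))%:E).
    have := segZ b.2 (\1_(`[b.1 - r, b.1 + r]%classic) y) _
      (measurable_fun_pair2 y mc) (fun t => cosdiff_le1 n _ _).
    apply: eq_integrable => // t _ /=; rewrite indic_box /=; congr EFin; ring.
  have [i2 E] := Fubini_Rintegral12 ic h.
  have F y : \int[mu1]_t (\1_(box b r) (y, t) *
      cosdiff n (x - (y, t)) (x' - (y, t))) = \1_(`[b.1 - r, b.1 + r]%classic) y *
      \int[mu1]_(t in `[b.2 - r, b.2 + r]) cosdiff n (x - (y, t)) (x' - (y, t)).
    rewrite -[X in _ = _ * X]Rintegral_indic -RintegralZl//; last first.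
      exact: (seg b.2 _ (measurable_fun_pair2 y mc) (fun t => cosdiff_le1 n _ _)).
    by apply: eq_Rintegral => t _; rewrite indic_box /=; ring.
  rewrite [phase_gram _ _ _ _ _]E; under eq_Rintegral do rewrite F.
  apply: fin => //; apply: eq_integrable i2 => // t _ /=.
  by rewrite F.
Qed.

End PhaseKernel.

(** * Decay of the Gram kernel *)

Section Decay.
Context {R : realType}.
Local Notation P := (measurableTypeR R * measurableTypeR R)%type.
Local Notation mu1 := (@lebesgue_measure R).
Local Notation mu := (@lebesgue2 R).
Implicit Types (a b x y : R * R).

Definition decay_const (L r : R) : R := 2 * r * (10 * L ^+ 2 + 2600 * (2 * r) * L).

(** The coordinate in which to integrate by parts is the one that dominates in
[(x - x') / (a - b) ^+ 2], seen as complex numbers. *)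
Lemma phase_gram_decay n a b (r : R) x x' (z : R) : (0 < n)%N -> 0 < r ->
  64 * r <= enorm (a - b) -> box a r x -> box a r x' ->
  0 < z -> `|x.1 - x'.1| <= z -> `|x.2 - x'.2| <= z ->
  z ^+ 2 <= (x.1 - x'.1) ^+ 2 + (x.2 - x'.2) ^+ 2 ->
  `|phase_gram n b r x x'| * (n%:R * z) <= decay_const (enorm (a - b)) r.
Proof.
move=> n0 r0 rL xa xa' z0 z1 z2 zz.
have /boxP[x1 x2] := xa; have /boxP[y1 y2] := xa'.
set L := enorm (a - b) in rL *.
have L0 : 0 < L by apply: lt_le_trans rL; rewrite mulr_gt0.
have nR : 0 < n%:R :> R by rewrite ltr0n.
have wL : (a.1 - b.1) ^+ 2 + (a.2 - b.2) ^+ 2 = L ^+ 2 by rewrite enorm_sqr.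
clearbody L.
(* [x - y] stays within [2 * r] of [a - b] in each coordinate *)
have rL' : 32 * (2 * r) <= L by lra.
have near (p q c d : R) : `|p - c| <= r -> `|q - d| <= r ->
    `|p - q - (c - d)| <= 2 * r.
  by rewrite !ler_norml; lra.
have nearP (w1 w2 u1 u2 : R) : w1 ^+ 2 + w2 ^+ 2 = L ^+ 2 ->
    `|u1 - w1| <= 2 * r -> `|u2 - w2| <= 2 * r -> 0 < u1 ^+ 2 + u2 ^+ 2.
  move=> w h1 h2; have /andP[k1 _] := nsq_near L0 w rL' h1 h2.
  by apply: lt_le_trans k1; rewrite mulr_gt0 ?exprn_gt0//; lra.
rewrite -ler_pdivlMr ?mulr_gt0// /decay_const.
set B := _ + _; rewrite (_ : _ / _ = 2 * r * (B / (n%:R * z))); last by rewrite mulrA.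
apply: phase_gram_line; first exact: ltW.
have two_r c : 2 * r = (c + r) - (c - r) by ring.
pose e1 := (x.1 - x'.1) * ((a.1 - b.1) ^+ 2 - (a.2 - b.2) ^+ 2) +
  (x.2 - x'.2) * (2 * (a.1 - b.1) * (a.2 - b.2)).
pose e2 := (x.2 - x'.2) * ((a.1 - b.1) ^+ 2 - (a.2 - b.2) ^+ 2) -
  (x.1 - x'.1) * (2 * (a.1 - b.1) * (a.2 - b.2)).
have dm (p t : R) : is_derive t 1 (fun t => p - t) (-1).
  by apply: is_derive_eq; ring.
have dc (p t : R) : is_derive t 1 (fun=> p) 0 by exact: is_derive_cst.
have seg_lt c : c - r < c + r by rewrite ltrD2l gtrN.
have seg (c t : R) : c - r <= t <= c + r -> `|t - c| <= r.
  by rewrite ler_norml; lra.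
have [dom|dom] := leP (e1 ^+ 2) (e2 ^+ 2); [left=> s sb|right=> s sb].
- rewrite /B (two_r b.1).
  have x21 : x.2 - s - (x'.2 - s) = x.2 - x'.2 by ring.
  have pos (p : R * R) t : box a r p -> b.1 - r <= t <= b.1 + r ->
      0 < (p.1 - t) ^+ 2 + (p.2 - s) ^+ 2.
    move=> /boxP[h1 h2] /seg tb.
    by apply: (nearP (a.1 - b.1) (a.2 - b.2)) => //; apply: near.
  have d t (tb : b.1 - r <= t <= b.1 + r) := is_derive_diff n (dm x.1 t)
    (dc (x.2 - s) t) (dm x'.1 t) (dc (x'.2 - s) t) (pos x t xa tb) (pos x' t xa' tb).
  have WE t : n%:R * (((x.1 - t) * 0 - (x.2 - s) * -1) / nsq (x.1 - t, x.2 - s) -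
      ((x'.1 - t) * 0 - (x'.2 - s) * -1) / nsq (x'.1 - t, x'.2 - s)) =
      1 * n%:R * ((x.2 - s) / ((x.1 - t) ^+ 2 + (x.2 - s) ^+ 2) -
        (x'.2 - s) / ((x'.1 - t) ^+ 2 + (x'.2 - s) ^+ 2)).
    by rewrite /nsq /= !mulr0 !sub0r !mulrN1 !opprK mul1r.
  refine (@phase_line_integral R n%:R 1 L (2 * r) z (a.1 - b.1) (a.2 - b.2)
    x.1 (x.2 - s) x'.1 (x'.2 - s) _ _ _
    (fun t => sindiff n (x - (t, s)) (x' - (t, s)))
    nR (normr1 _) z0 _ L0 wL rL' _ (near _ _ _ _ x2 sb) (near _ _ _ _ y2 sb)
    z1 _ _ _ _ _ _).
  + exact: seg_lt.
  + by move=> t /seg tb; split; exact: near.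
  + by rewrite x21.
  + by rewrite x21.
  + by rewrite x21.
  + by move=> t; exact: sindiff_le1.
  + by move=> t tb; have [+ _] := d t tb; rewrite WE.
  + by move=> t tb; have [_] := d t tb; rewrite WE.
- rewrite /B (two_r b.2).
  have x21 : x.1 - s - (x'.1 - s) = x.1 - x'.1 by ring.
  have pos (p : R * R) t : box a r p -> b.2 - r <= t <= b.2 + r ->
      0 < (p.1 - s) ^+ 2 + (p.2 - t) ^+ 2.
    move=> /boxP[h1 h2] /seg tb.
    by apply: (nearP (a.1 - b.1) (a.2 - b.2)) => //; apply: near.
  have d t (tb : b.2 - r <= t <= b.2 + r) := is_derive_diff n (dc (x.1 - s) t)
    (dm x.2 t) (dc (x'.1 - s) t) (dm x'.2 t) (pos x t xa tb) (pos x' t xa' tb).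
  have WE t : n%:R * (((x.1 - s) * -1 - (x.2 - t) * 0) / nsq (x.1 - s, x.2 - t) -
      ((x'.1 - s) * -1 - (x'.2 - t) * 0) / nsq (x'.1 - s, x'.2 - t)) =
      -1 * n%:R * ((x.1 - s) / ((x.2 - t) ^+ 2 + (x.1 - s) ^+ 2) -
        (x'.1 - s) / ((x'.2 - t) ^+ 2 + (x'.1 - s) ^+ 2)).
    rewrite /nsq /= !mulr0 !subr0 ![(_ - t) ^+ 2 + _]addrC.
    by rewrite !mulrN1 !mulNr mul1r -opprD mulrN.
  refine (@phase_line_integral R n%:R (-1) L (2 * r) z (a.2 - b.2) (a.1 - b.1)
    x.2 (x.1 - s) x'.2 (x'.1 - s) _ _ _
    (fun t => sindiff n (x - (s, t)) (x' - (s, t)))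
    nR (normrN1 _) z0 _ L0 _ rL' _ (near _ _ _ _ x1 sb) (near _ _ _ _ y1 sb)
    z2 _ _ _ _ _ _).
  + exact: seg_lt.
  + by rewrite addrC.
  + by move=> t /seg tb; split; exact: near.
  + by rewrite x21.
  + by rewrite x21 addrC.
  + rewrite x21; have := ltW dom; rewrite /e1 /e2; congr (_ <= _); ring.
  + by move=> t; exact: sindiff_le1.
  + by move=> t tb; have [+ _] := d t tb; rewrite WE.
  + by move=> t tb; have [_] := d t tb; rewrite WE.
Qed.

End Decay.

(** * Damping factors *)

Section GramIntegral.
Context {R : realType}.
Local Notation P := (measurableTypeR R * measurableTypeR R)%type.
Local Notation mu1 := (@lebesgue_measure R).
Local Notation mu := (@lebesgue2 R).
Local Notation mu2 := (@lebesgue4 R).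
Implicit Types (a b x y : R * R) (n : nat).

Definition damp n (t : R) : R := (1 + n%:R * `|t|)^-1.

Lemma damp_den_gt0 n (t : R) : 0 < 1 + n%:R * `|t| :> R.
Proof. by rewrite ltr_wpDr// mulr_ge0. Qed.

Lemma damp_ge0 n (t : R) : 0 <= damp n t.
Proof. by rewrite invr_ge0 ltW// damp_den_gt0. Qed.

Lemma damp_le1 n (t : R) : damp n t <= 1.
Proof. by rewrite invf_le1 ?damp_den_gt0// lerDl mulr_ge0. Qed.

Definition gram_const (L r : R) : R := 4 * r ^+ 2 + decay_const L r.

Lemma decay_const_ge0 (L r : R) : 0 <= L -> 0 <= r -> 0 <= decay_const L r.
Proof.
move=> L0 r0; rewrite /decay_const; have := mulr_ge0 r0 L0; have := sqr_ge0 L.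
move=> h1 h2; apply: mulr_ge0; first lra.
by set u := L ^+ 2 in h1 *; set v := r * L in h2 *; rewrite -!mulrA -/v; lra.
Qed.

(** Bounding by a product of functions of one coordinate each loses only a
logarithm in the end, and makes the integral below explicit. *)
Lemma phase_gram_damp n a b (r : R) x x' : (0 < n)%N -> 0 < r ->
  64 * r <= enorm (a - b) -> box a r x -> box a r x' ->
  phase_gram n b r x x' ^+ 2 <= gram_const (enorm (a - b)) r ^+ 2 *
    (damp n (x.1 - x'.1) * damp n (x.2 - x'.2)).
Proof.
move=> n0 r0 rL xa xa'; set C := gram_const _ _.
have L0 : 0 <= enorm (a - b) by exact: sqrtr_ge0.
have D0 := decay_const_ge0 L0 (ltW r0).
set h := `|phase_gram n b r x x'|.
have h0 : 0 <= h by exact: normr_ge0.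
pose z := Num.max `|x.1 - x'.1| `|x.2 - x'.2|.
have z1 : `|x.1 - x'.1| <= z by rewrite le_max lexx.
have z2 : `|x.2 - x'.2| <= z by rewrite le_max lexx orbT.
have zz : z ^+ 2 <= (x.1 - x'.1) ^+ 2 + (x.2 - x'.2) ^+ 2.
  by rewrite /z /Num.max; case: ifP => _; rewrite real_normK ?num_real//;
    rewrite ?lerDr ?lerDl sqr_ge0.
have hz : h * (n%:R * z) <= decay_const (enorm (a - b)) r.
  have := le_trans (normr_ge0 _) z1; rewrite le_eqVlt => /predU1P[<-|z0].
    by rewrite mulr0 mulr0.
  exact: (phase_gram_decay n0 r0 rL xa xa' z0 z1 z2 zz).
have hd (t : R) : `|t| <= z -> h * (1 + n%:R * `|t|) <= C.
  move=> tz; rewrite mulrDr mulr1 lerD//; first exact: phase_gram_le (ltW r0).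
  by apply: le_trans hz; rewrite ler_wpM2l// ler_wpM2l.
have -> : phase_gram n b r x x' ^+ 2 = h * h by rewrite /h -normrM -expr2 ger0_norm ?sqr_ge0.
have := ler_pM (mulr_ge0 h0 (ltW (damp_den_gt0 _ _)))
  (mulr_ge0 h0 (ltW (damp_den_gt0 _ _))) (hd _ z1) (hd _ z2).
rewrite mulrACA -expr2 -ler_pdivlMr ?mulr_gt0 ?damp_den_gt0// => /le_trans; apply.
by rewrite /damp -invfM.
Qed.

Lemma integral_inv_affine (p q al be : R) : p < q -> be != 0 ->
  (forall t, p <= t <= q -> 0 < al + be * t) ->
  \int[mu1]_(t in `[p, q]) (al + be * t)^-1 =
  (ln (al + be * q) - ln (al + be * p)) / be.
Proof.
move=> pq be0 pos.
pose F t := ln (al + be * t) / be.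
have dF t : p <= t <= q -> is_derive t 1 F (al + be * t)^-1.
  move=> tpq; have d : is_derive t 1 (fun t => al + be * t) be.
    by apply: is_derive_eq; rewrite /GRing.scale /=; ring.
  have dl := @is_derive1_comp _ (@ln R) (fun t => al + be * t) t _ _
    (is_derive1_ln (pos _ tpq)) d.
  rewrite (_ : F = be^-1 *: (@ln R \o (fun t => al + be * t))); last first.
    by apply/funext => s; rewrite /F /= mulrC.
  apply: is_derive_eq; rewrite /GRing.scale /=; field.
  by rewrite be0 gt_eqF// pos.
have cF t : p <= t <= q -> {for t, continuous F}.
  by move=> /dF ?; apply: differentiable_continuous; apply/derivable1_diffP.
rewrite /Rintegral (continuous_FTC2 pq (F := F)).
- by rewrite /F -EFinB /= mulrBl.
- apply: continuous_in_subspaceT => t /[!inE]/= /[!in_itv]/= tpq.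
  apply: cvgV; first by rewrite gt_eqF// pos.
  by apply: cvgD; [exact: cvg_cst|apply: cvgM; [exact: cvg_cst|exact: cvg_id]].
- split.
  + move=> t; rewrite in_itv/= => /andP[pt tq].
    by have := dF t; rewrite (ltW pt) (ltW tq) => /(_ isT) [].
  + by apply: cvg_at_right_filter; apply: cF; rewrite lexx ltW.
  + by apply: cvg_at_left_filter; apply: cF; rewrite lexx ltW.
- move=> t; rewrite in_itv/= => /andP[pt tq].
  have := dF t; rewrite (ltW pt) (ltW tq) => /(_ isT) ?.
  by rewrite derive1E derive_val.
Qed.

Lemma measurable_damp n (s : R) : measurable_fun setT (fun t : measurableTypeR R => damp n (s - t)).
Proof.
apply: continuous_measurable_fun => t; apply: cvgV; first by rewrite gt_eqF// damp_den_gt0.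
apply: cvgD; first exact: cvg_cst.
apply: cvgM; first exact: cvg_cst.
by apply: cvg_norm; apply: cvgB; [exact: cvg_cst|exact: cvg_id].
Qed.

Lemma integrable_damp n (c r s : R) :
  mu1.-integrable setT (fun t => (\1_(`[c - r, c + r]%classic) t * damp n (s - t))%:E).
Proof.
apply: le_integrable (@integrable_indic_itv R (c - r) (c + r) true false) => //.
  by apply/measurable_EFinP; apply: measurable_funM;
    [exact: measurable_indic|exact: measurable_damp].
move=> t _; rewrite lee_fin normrM ler_piMr// ger0_norm ?damp_ge0//.
exact: damp_le1.
Qed.

Lemma integral_damp n (c r s : R) : (0 < n)%N -> 0 < r -> `|s - c| <= r ->
  \int[mu1]_t (\1_(`[c - r, c + r]%classic) t * damp n (s - t)) <=
  2 * ln (1 + 2 * r * n%:R) / n%:R.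
Proof.
move=> n0 r0 sc; have nR : 0 < n%:R :> R by rewrite ltr0n.
pose f1 (t : R) := \1_(`[s - 2 * r, s]%classic) t * (1 + n%:R * s + - n%:R * t)^-1.
pose f2 (t : R) := \1_(`[s, s + 2 * r]%classic) t * (1 - n%:R * s + n%:R * t)^-1.
have E1 : \int[mu1]_t f1 t = ln (1 + 2 * r * n%:R) / n%:R.
  rewrite /f1 Rintegral_indic integral_inv_affine//.
  - rewrite (_ : 1 + n%:R * s + - n%:R * s = 1); last by ring.
    rewrite (_ : 1 + n%:R * s + - n%:R * (s - 2 * r) = 1 + 2 * r * n%:R); last by ring.
    by rewrite ln1 sub0r invrN mulrNN.
  - lra.
  - by rewrite oppr_eq0 gt_eqF.
  - move=> t /andP[_ ts]; have : n%:R * t <= n%:R * s by rewrite ler_pM2l.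
    lra.
have E2 : \int[mu1]_t f2 t = ln (1 + 2 * r * n%:R) / n%:R.
  rewrite /f2 Rintegral_indic integral_inv_affine//.
  - rewrite (_ : 1 - n%:R * s + n%:R * s = 1); last by ring.
    rewrite (_ : 1 - n%:R * s + n%:R * (s + 2 * r) = 1 + 2 * r * n%:R); last by ring.
    by rewrite ln1 subr0.
  - lra.
  - by rewrite gt_eqF.
  - move=> t /andP[st _]; have : n%:R * s <= n%:R * t by rewrite ler_pM2l.
    lra.
have int_f p q g : (forall t, p <= t <= q -> g t = damp n (s - t)) ->
    mu1.-integrable setT (EFin \o (fun t => \1_(`[p, q]%classic) t * g t)).
  move=> gd; have : mu1.-integrable setT
      (EFin \o (fun t => \1_(`[p, q]%classic) t * damp n (s - t))).
    apply: le_integrable (@integrable_indic_itv R p q true false) => //.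
      by apply/measurable_EFinP; apply: measurable_funM;
        [exact: measurable_indic|exact: measurable_damp].
    move=> t _; rewrite lee_fin normrM ler_piMr// ger0_norm ?damp_ge0//.
    exact: damp_le1.
  apply: eq_integrable => // t _ /=; rewrite indicE; congr EFin.
  case: (boolP (t \in _)) => [|_]; last by rewrite !mul0r.
  by rewrite inE/= in_itv/= => /gd ->.
have g1 t : s - 2 * r <= t <= s -> (1 + n%:R * s + - n%:R * t)^-1 = damp n (s - t).
  move=> /andP[_ ts]; rewrite /damp ger0_norm ?subr_ge0//; congr (_^-1); ring.
have g2 t : s <= t <= s + 2 * r -> (1 - n%:R * s + n%:R * t)^-1 = damp n (s - t).
  move=> /andP[st _]; rewrite /damp ler0_norm ?subr_le0//; congr (_^-1); ring.
have i1 := int_f _ _ _ g1; have i2 := int_f _ _ _ g2.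
rewrite (_ : 2 * ln (1 + 2 * r * n%:R) / n%:R = \int[mu1]_t (f1 t + f2 t)); last first.
  by rewrite RintegralD// E1 E2; ring.
apply: le_Rintegral => //.
- exact: integrable_damp.
- exact: (integrableD measurableT i1 i2).
- move=> t _; rewrite /f1 /f2.
  have f0 p q (g : R -> R) : (forall t, p <= t <= q -> g t = damp n (s - t)) ->
      0 <= \1_(`[p, q]%classic) t * g t.
    move=> gd; rewrite indicE; case: (boolP (t \in _)) => [|_]; last by rewrite mul0r.
    by rewrite inE/= in_itv/= => /gd ->; rewrite mul1r damp_ge0.
  have p1 := f0 _ _ _ g1; have p2 := f0 _ _ _ g2.
  rewrite [X in X * _ <= _]indicE; case: (boolP (t \in _)) => [|_]; last first.
    by rewrite mul0r addr_ge0.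
  rewrite inE/= in_itv/= mul1r => tc.
  move: sc; rewrite ler_norml => sc.
  have [ts|st] := leP t s.
    have ts' : s - 2 * r <= t <= s by rewrite ts andbT; lra.
    rewrite -(g1 _ ts') -[leLHS]addr0; apply: lerD => //.
    by rewrite indicE mem_set ?mul1r//= in_itv.
  have ts' : s <= t <= s + 2 * r by rewrite (ltW st)/=; lra.
  rewrite -(g2 _ ts') -[leLHS]add0r; apply: lerD => //.
  by rewrite indicE mem_set ?mul1r//= in_itv.
Qed.

End GramIntegral.

(** * Rank of the phase on a pair of boxes *)

Section LocalRank.
Context {R : realType}.
Local Notation P := (measurableTypeR R * measurableTypeR R)%type.
Local Notation mu1 := (@lebesgue_measure R).
Local Notation mu := (@lebesgue2 R).
Local Notation mu2 := (@lebesgue4 R).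
Implicit Types (a b x y : R * R) (n : nat).

Definition log_mass n (r : R) : R := 2 * ln (1 + 2 * r * n%:R) / n%:R.

Definition damp2 n a (r : R) (z : P * P) : R := \1_(box a r) z.1 * (\1_(box a r) z.2 *
  (damp n (z.1.1 - z.2.1) * damp n (z.1.2 - z.2.2))).

Let measurable_damp2 n : measurable_fun setT
  (fun z : P * P => damp n (z.1.1 - z.2.1) * damp n (z.1.2 - z.2.2)).
Proof.
have md := measurable_damp n (0 : R).
have mc (f g : P * P -> R) : measurable_fun setT f -> measurable_fun setT g ->
    measurable_fun setT (fun z => damp n (f z - g z)).
  move=> mf mg; have := measurableT_comp md (measurable_funB mg mf).
  by apply: eq_measurable_fun => z _ /=; rewrite sub0r opprB.
apply: measurable_funM; apply: mc.
- exact: measurableT_comp measurable_fst measurable_fst.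
- exact: measurableT_comp measurable_fst measurable_snd.
- exact: measurableT_comp measurable_snd measurable_fst.
- exact: measurableT_comp measurable_snd measurable_snd.
Qed.

Let integrable_damp2 n a r : mu2.-integrable setT (EFin \o damp2 n a r).
Proof.
apply: (le_integrable measurableT _ _ (integrable_tensor (integrable_indic_box a r)
  (integrable_indic_box a r))) => /=.
- apply/measurable_EFinP; apply: measurable_funM; last apply: measurable_funM.
  + apply: (measurableT_comp (measurable_indic (measurable_box a r))).
    exact: measurable_fst.
  + apply: (measurableT_comp (measurable_indic (measurable_box a r))).
    exact: measurable_snd.
  + exact: measurable_damp2.
- move=> z _; rewrite lee_fin /damp2 mulrA normrM ler_piMr//.
  rewrite normrM !ger0_norm ?damp_ge0//.
  by apply: mulr_ile1; rewrite ?damp_ge0 ?damp_le1.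
Qed.

Lemma integral_damp2 n a (r : R) : (0 < n)%N -> 0 < r ->
  \int[mu2]_z damp2 n a r z <= 4 * r ^+ 2 * log_mass n r ^+ 2.
Proof.
move=> n0 r0.
have id x : mu.-integrable setT (fun x' : P => (\1_(box a r) x' *
    (damp n (x.1 - x'.1) * damp n (x.2 - x'.2)))%:E).
  have := integrable_tensor (integrable_damp n a.1 r x.1) (integrable_damp n a.2 r x.2).
  apply: eq_integrable => // y _ /=; rewrite indic_box; congr EFin; ring.
have idx x : mu.-integrable setT (fun x' : P => (damp2 n a r (x, x'))%:E).
  have := integrableZl measurableT (\1_(box a r) x) (id x).
  exact: eq_integrable.
have [int1 E] := Fubini_Rintegral12 (integrable_damp2 n a r) idx.
rewrite E (_ : 4 * r ^+ 2 * log_mass n r ^+ 2 =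
    \int[mu]_x (log_mass n r ^+ 2 * \1_(box a r) x)); last first.
  by rewrite RintegralZl ?Rintegral_indic_box ?(ltW r0)//;
    [ring|exact: integrable_indic_box].
apply: le_Rintegral => //.
  have := integrableZl measurableT (log_mass n r ^+ 2) (integrable_indic_box a r).
  exact: eq_integrable.
move=> x _; rewrite (_ : \int[mu]_y damp2 n a r (x, y) =
    \1_(box a r) x * \int[mu]_x' (\1_(box a r) x' *
      (damp n (x.1 - x'.1) * damp n (x.2 - x'.2)))); last first.
  exact: (RintegralZl (\1_(box a r) x) measurableT (id x)).
rewrite !indicE; case: (boolP (x \in box a r)) => [|_]; last by rewrite mul0r mulr0.
rewrite inE mul1r mulr1 => /boxP[x1 x2].
rewrite (_ : \int[mu]_x' _ =
    (\int[mu1]_t (\1_(`[a.1 - r, a.1 + r]%classic) t * damp n (x.1 - t))) *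
    (\int[mu1]_t (\1_(`[a.2 - r, a.2 + r]%classic) t * damp n (x.2 - t)))); last first.
  rewrite -(Rintegral_tensor (integrable_damp n a.1 r x.1) (integrable_damp n a.2 r x.2)).
  by apply: eq_Rintegral => y _; rewrite indic_box; ring.
have dge0 c s : 0 <= \int[mu1]_t (\1_(`[c - r, c + r]%classic) t * damp n (s - t)).
  by apply: Rintegral_ge0 => t _; rewrite mulr_ge0// damp_ge0.
by rewrite [leRHS]expr2; apply: ler_pM => //; exact: integral_damp.
Qed.

Lemma ln_le_powR (be x : R) : 0 < be -> 0 < x -> ln x <= be^-1 * x `^ be.
Proof.
move=> be0 x0; rewrite mulrC ler_pdivlMr// mulrC -ln_powR.
by apply: ltW; apply: ln_sublinear; rewrite powR_gt0.
Qed.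

Lemma log_mass_le n (r delta : R) : (0 < n)%N -> 0 < r -> 0 < delta ->
  log_mass n r ^+ 2 <=
  (2 / (delta / 2) * (1 + 2 * r) `^ (delta / 2)) ^+ 2 * n%:R `^ (delta - 2).
Proof.
move=> n0 r0 delta0; have nR : 0 < n%:R :> R by rewrite ltr0n.
have n1 : 1 <= n%:R :> R by rewrite ler1n.
have be0 : 0 < delta / 2 by rewrite divr_gt0.
set be := delta / 2 in be0 *.
have rn : 0 <= 2 * r * n%:R by rewrite !mulr_ge0// ltW.
have -> : n%:R `^ (delta - 2) = (n%:R `^ be / n%:R) ^+ 2 :> R.
  rewrite powRB; last by apply/implyP => _; rewrite gt_eqF.
  rewrite exprMn exprVn -!powR_mulrn ?powR_ge0 ?ler0n// -powRrM.
  by rewrite /be divfK.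
rewrite -exprMn; apply: lerXn2r; rewrite ?nnegrE.
- by rewrite /log_mass divr_ge0// mulr_ge0// ln_ge0// lerDl.
- by rewrite !mulr_ge0 ?powR_ge0 ?invr_ge0// ltW.
rewrite /log_mass [leRHS]mulrA ler_wpM2r ?invr_ge0//.
rewrite (_ : _ * n%:R `^ be = 2 * (be^-1 * ((1 + 2 * r) `^ be * n%:R `^ be))); last first.
  by rewrite !mulrA.
rewrite ler_wpM2l//.
apply: (@le_trans _ _ (be^-1 * (1 + 2 * r * n%:R) `^ be)).
  by apply: ln_le_powR => //; rewrite ltr_pwDl.
rewrite ler_wpM2l ?invr_ge0 ?(ltW be0)// -powRM ?ler0n//; last first.
  by rewrite addr_ge0// mulr_ge0// ltW.
apply: ge0_ler_powR; rewrite ?nnegrE ?(ltW be0)//.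
- by rewrite addr_ge0.
- by rewrite mulr_ge0// addr_ge0// mulr_ge0// ltW.
- by rewrite [leRHS]mulrDl mul1r lerD2r.
Qed.

(** The phase restricted to a pair of boxes; [true] and [false] stand for its
real and imaginary parts. *)
Definition phase (k : bool) n x y : R :=
  if k then pcos n (x - y) else psin n (x - y).

Definition box_kernel (A : R) a b (r : R) n (k : bool) x y : R :=
  A * (\1_(box a r) x * (\1_(box b r) y * phase k n x y)).

Lemma measurable_phase2 k n : measurable_fun setT (fun z : P * P => phase k n z.1 z.2).
Proof.
have [mc ms] := @measurable_phase R n.
have mB : measurable_fun setT (fun z : P * P => (z.1 - z.2 : P)).
  apply: measurable_fun_pair; apply: measurable_funB.
  - exact: measurableT_comp measurable_fst measurable_fst.
  - exact: measurableT_comp measurable_fst measurable_snd.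
  - exact: measurableT_comp measurable_snd measurable_fst.
  - exact: measurableT_comp measurable_snd measurable_snd.
case: k.
  exact: (measurableT_comp mc mB).
exact: (measurableT_comp ms mB).
Qed.

Lemma phase_le1 k n x y : `|phase k n x y| <= 1.
Proof. by case: k; [exact: pcos_le1|exact: psin_le1]. Qed.

Lemma measurable_box_kernel A a b r n k :
  measurable_fun setT (fun z : P * P => box_kernel A a b r n k z.1 z.2).
Proof.
apply: measurable_funM; first exact: measurable_cst.
apply: measurable_funM; last apply: measurable_funM.
- apply: (measurableT_comp (measurable_indic (measurable_box a r))).
  exact: measurable_fst.
- apply: (measurableT_comp (measurable_indic (measurable_box b r))).
  exact: measurable_snd.
- exact: measurable_phase2.
Qed.

Lemma box_kernel_le A a b r n k x y :
  `|box_kernel A a b r n k x y| <= (`|A| *: \1_(box a r)) x * \1_(box b r) y.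
Proof.
rewrite /box_kernel !normrM.
rewrite (_ : (`|A| *: \1_(box a r)) x * _ = `|A| * (\1_(box a r) x * \1_(box b r) y)).
  rewrite ler_wpM2l//.
  rewrite [X in X * _]ger0_norm// ler_wpM2l// [X in X * _]ger0_norm// ler_piMr//.
  exact: phase_le1.
by rewrite mulrA.
Qed.

Lemma gram_box_kernel A a b r n (z : P * P) :
  gram_kernel (box_kernel A a b r n) z =
  A ^+ 2 * (\1_(box a r) z.1 * (\1_(box a r) z.2 * phase_gram n b r z.1 z.2)).
Proof.
rewrite /gram_kernel big_bool /inner2 /=.
have ik k : mu.-integrable setT (EFin \o (fun y : P =>
    box_kernel A a b r n k z.1 y * box_kernel A a b r n k z.2 y)).
  have b2 := Lfun2_indic_box b r.
  have K2 x : box_kernel A a b r n k x \in Lfun mu 2%:E.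
    apply: (@Lfun2_le _ P R mu _
      ((`|A| *: \1_(box a r)) x *: (\1_(box b r) : P -> R))).
    - exact: measurable_fun_pair2 (measurable_box_kernel A a b r n k).
    - by have := Lfun2_comb ((`|A| *: \1_(box a r)) x) b2 (Lfun2_0 mu); rewrite addr0.
    - by move=> y; rewrite (le_trans (box_kernel_le _ _ _ _ _ _ _ _))// ler_norm.
  exact: Lfun2_integrableM.
rewrite -RintegralD//; [|exact: ik..].
rewrite /phase_gram !mulrA -RintegralZl//; last first.
  apply: le_integrable (integrable_indic_box b r) => //.
    apply/measurable_EFinP; apply: measurable_funM.
      exact: measurable_indic (measurable_box _ _).
    exact: measurable_cosdiff.
  move=> y _; rewrite lee_fin normrM ler_piMr//; exact: cosdiff_le1.
apply: eq_Rintegral => y _; rewrite /box_kernel /phase /cosdiff.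
have : \1_(box b r) y * \1_(box b r) y = \1_(box b r) y :> R.
  by rewrite indicE; case: (_ \in _); rewrite ?mulr1 ?mulr0.
move: (\1_(box b r) y) (\1_(box a r) z.1) (\1_(box a r) z.2) => e e1 e2 ee.
move: (pcos _ _) (pcos _ _) (psin _ _) (psin _ _) => c1 c2 s1 s2.
transitivity (A ^+ 2 * e1 * e2 * (e * e) * (c1 * c2 + s1 * s2)); first by ring.
by rewrite ee; ring.
Qed.

(** The squared norm of the Gram kernel is of order [(ln n / n) ^+ 2]. With
[t] of that order as well, up to a constant, the finite rank bound leaves room
for a correlation [kappa] only when the rank is at least of order [1 / t]; the
logarithm is absorbed by [delta]. *)
Lemma local_rank_bound a b (r A kappa delta : R) : 0 < r ->
  64 * r <= enorm (a - b) -> 0 < kappa -> 0 < delta ->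
  exists2 c : R, 0 < c & forall n, (0 < n)%N ->
  forall (J : finType) (F : J -> P -> R) (G : bool -> J -> P -> R),
  (forall j, F j \in Lfun mu 2%:E) -> (forall k j, G k j \in Lfun mu 2%:E) ->
  let V k (z : P * P) := \sum_j F j z.1 * G k j z.2 in
  kappa <= \int[mu2]_z \sum_k
    (2 * box_kernel A a b r n k z.1 z.2 * V k z - V k z ^+ 2) ->
  c * n%:R `^ (2 - delta) <= #|J|%:R.
Proof.
move=> r0 rL kappa0 delta0.
set C := gram_const (enorm (a - b)) r.
have b1_2 : `|A| *: \1_(box a r) \in Lfun mu 2%:E.
  by have := Lfun2_comb `|A| (Lfun2_indic_box a r) (Lfun2_0 mu); rewrite addr0.
pose be := delta / 2; have be0 : 0 < be by rewrite divr_gt0.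
pose D := ((A ^+ 2 * C) ^+ 2 + 1) * (4 * r ^+ 2) * (2 / be * (1 + 2 * r) `^ be) ^+ 2.
have D0 : 0 < D.
  have p0 : 0 < (1 + 2 * r) `^ be by rewrite powR_gt0; lra.
  have A0 : 0 < (A ^+ 2 * C) ^+ 2 + 1 by rewrite ltr_wpDl// sqr_ge0.
  have r20 : 0 < r ^+ 2 by rewrite exprn_gt0.
  by apply: mulr_gt0; [apply: mulr_gt0 => //; lra|
    apply: exprn_gt0; apply: mulr_gt0 => //; apply: divr_gt0].
exists (kappa ^+ 2 / D); first by rewrite divr_gt0// exprn_gt0.
move=> n n0 J F G F2 G2 V kV.
have nR : 0 < n%:R :> R by rewrite ltr0n.
pose I := \int[mu2]_z (gram_kernel (box_kernel A a b r n) z ^+ 2).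
have I_le : I <= D * n%:R `^ (delta - 2).
  apply: (@le_trans _ _ ((A ^+ 2 * C) ^+ 2 * (4 * r ^+ 2 * log_mass n r ^+ 2))).
    apply: (@le_trans _ _ ((A ^+ 2 * C) ^+ 2 * \int[mu2]_z damp2 n a r z)); last first.
      by rewrite ler_wpM2l ?sqr_ge0// integral_damp2.
    have id2 := integrable_damp2 n a r.
    rewrite -RintegralZl//.
    have dom (z : P * P) : gram_kernel (box_kernel A a b r n) z ^+ 2 <=
        (A ^+ 2 * C) ^+ 2 * damp2 n a r z.
      rewrite gram_box_kernel /damp2 !indicE.
      case: (boolP (z.1 \in box a r)) => [|_]; last by rewrite !mul0r !mulr0 expr0n.
      case: (boolP (z.2 \in box a r)) => [|_]; last by rewrite !mul0r !mulr0 expr0n.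
      rewrite !inE !mul1r => z2 z1.
      rewrite exprMn [X in _ <= X * _]exprMn -[leRHS]mulrA ler_wpM2l ?sqr_ge0//.
      exact: phase_gram_damp.
    have HL2 := Lfun2_gram_kernel (measurable_box_kernel A a b r n)
      (box_kernel_le A a b r n) b1_2 (Lfun2_indic_box b r).
    rewrite /I; apply: le_Rintegral => //.
    - have := Lfun2_integrableM HL2 HL2.
      by apply: eq_integrable => // z _ /=; rewrite expr2.
    - have := integrableZl measurableT ((A ^+ 2 * C) ^+ 2) id2.
      exact: eq_integrable.
  pose y := 4 * r ^+ 2 * ((2 / be * (1 + 2 * r) `^ be) ^+ 2 * n%:R `^ (delta - 2)).
  have r2 : 0 <= 4 * r ^+ 2 by rewrite mulr_ge0// sqr_ge0.
  have y0 : 0 <= y.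
    by apply: mulr_ge0 => //; apply: mulr_ge0; [exact: sqr_ge0|exact: powR_ge0].
  apply: (@le_trans _ _ ((A ^+ 2 * C) ^+ 2 * y)).
    rewrite ler_wpM2l ?sqr_ge0// ler_wpM2l//.
    exact: log_mass_le.
  rewrite (_ : D * _ = ((A ^+ 2 * C) ^+ 2 + 1) * y); last by rewrite /D /y !mulrA.
  by rewrite ler_wpM2r// lerDl.
(* the value of [t] for which the term with the Gram kernel is at most half of [kappa] *)
pose t := D * n%:R `^ (delta - 2) / kappa.
have I'0 : 0 < D * n%:R `^ (delta - 2) by rewrite mulr_gt0 ?powR_gt0.
have t0 : 0 < t by rewrite divr_gt0.
have := finite_rank_bound (measurable_box_kernel A a b r n)
  (box_kernel_le A a b r n) b1_2 (Lfun2_indic_box b r) F2 G2 t0.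
move=> /(le_trans kV); rewrite -/I => fin.
have tI : t^-1 * I <= kappa.
  by rewrite /t invf_div mulrAC ler_pdivrMr// ler_wpM2l// ltW.
have kt : kappa <= t * #|J|%:R by lra.
rewrite -(opprB delta 2) powRN -mulrA -invfM ler_pdivrMr//.
by move: kt; rewrite /t mulrAC ler_pdivlMr// -expr2 [leRHS]mulrC.
Qed.

End LocalRank.

(** * Measurability of open sets of the plane *)

Section MeasurableBasis.

(** A countable family of measurable sets from which all open sets are obtained
as unions; it is inherited by products. *)
Definition measurable_basis d (M : measurableType d) (T : topologicalType)
    (f : M -> T) : Prop :=
  exists2 B : nat -> set T, (forall i, measurable (f @^-1` B i)) &
    forall x U, nbhs x U -> exists2 i, B i x & B i `<=` U.

Lemma measurable_basis_open d (M : measurableType d) (T : topologicalType)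
    (f : M -> T) (U : set T) :
  measurable_basis f -> open U -> measurable (f @^-1` U).
Proof.
move=> [B mB BU] oU.
rewrite (_ : f @^-1` U = \bigcup_i (if pselect (B i `<=` U) then f @^-1` B i else set0)).
  apply: bigcupT_measurable => i.
  by case: pselect => ? /=; [exact: mB|exact: measurable0].
apply/seteqP; split=> [x Ux|x [i _]]; last by case: pselect => // BiU /BiU.
have [|i Bix BiU] := BU (f x) U; first exact: open_nbhs_nbhs.
by exists i => //; case: pselect.
Qed.

Lemma measurable_basis_prod d1 d2 (M1 : measurableType d1) (M2 : measurableType d2)
    (T1 T2 : topologicalType) (f1 : M1 -> T1) (f2 : M2 -> T2) :
  measurable_basis f1 -> measurable_basis f2 ->
  measurable_basis (fun z : M1 * M2 => (f1 z.1, f2 z.2)).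
Proof.
move=> [B1 mB1 BU1] [B2 mB2 BU2].
pose B n := if @unpickle (nat * nat)%type n is Some ij then B1 ij.1 `*` B2 ij.2
            else set0.
exists B => [n|x U [[/= U1 U2] [n1 n2] UU]].
  rewrite /B; case: unpickle => [ij|]; last by rewrite preimage_set0.
  exact: (measurableX (mB1 ij.1) (mB2 ij.2)).
have [i1 B1x B1U] := BU1 _ _ n1; have [i2 B2x B2U] := BU2 _ _ n2.
exists (pickle (i1, i2)); rewrite /B pickleK//=.
by move=> z [z1 z2]; apply: UU; split; [exact: B1U|exact: B2U].
Qed.

Lemma measurable_basis_R (R : realType) :
  measurable_basis (id : measurableTypeR R -> R).
Proof.
pose B n := if @unpickle (rat * rat)%type n is Some cr then
            ball (ratr cr.1 : R) (ratr cr.2 : R) else set0.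
exists B => [n|x U].
  rewrite /B; case: unpickle => [cr|]; last exact: measurable0.
  exact: (measurable_ball (ratr cr.1 : R) (ratr cr.2)).
rewrite nbhsE => -[S [oS Sx] SU].
have [|c [r [xB BS]]] := @open_subball_rat R S x oS; first exact/mem_set.
exists (pickle (c, r)); rewrite /B pickleK//=.
  exact/set_mem.
exact: subset_trans BS SU.
Qed.

End MeasurableBasis.

Section PlaneMeasurability.
Context {R : realType}.
Local Notation P := (measurableTypeR R * measurableTypeR R)%type.

Lemma measurable_basis_plane : measurable_basis (id : P -> R * R).
Proof.
have := measurable_basis_prod (@measurable_basis_R R) (@measurable_basis_R R).
by congr (measurable_basis _); apply/funext => -[].
Qed.

Lemma open_plane_measurable (U : set (R * R)) : open U -> measurable (U : set P).
Proof. exact: measurable_basis_open measurable_basis_plane. Qed.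

Lemma compact_plane_measurable (K : set (R * R)) :
  compact K -> measurable (K : set P).
Proof.
move=> cK; rewrite -[K]setCK; apply: measurableC; apply: open_plane_measurable.
by rewrite openC; apply: compact_closed => //; exact: norm_hausdorff.
Qed.

Lemma continuous_plane2_measurable (W : set ((R * R) * (R * R)))
    (f : (R * R) * (R * R) -> R) : open W ->
  (forall z, W z -> {for z, continuous f}) ->
  measurable (W : set (P * P)) /\ measurable_fun (W : set (P * P)) (f : P * P -> R).
Proof.
move=> oW cf.
have bas : measurable_basis (id : P * P -> (R * R) * (R * R)).
  have := measurable_basis_prod measurable_basis_plane measurable_basis_plane.
  by congr (measurable_basis _); apply/funext => -[].
split; first exact: (measurable_basis_open bas oW).
move=> mW; apply: (measurability _ (RGenOpens.measurableE R)) => //.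
move=> _ [_ [a [b ->] <-]].
apply: (measurable_basis_open bas (U := W `&` f @^-1` _)).
rewrite openE => z [Wz fz]; rewrite /interior; apply: filterI.
  exact: open_nbhs_nbhs.
by apply: cf => //; apply: open_nbhs_nbhs; split => //; exact: interval_open.
Qed.

End PlaneMeasurability.

(** * Continuity of the amplitude *)

Section Amplitude.
Context {R : realType}.
Local Notation P := (measurableTypeR R * measurableTypeR R)%type.
Local Notation Q := ((R * R) * (R * R))%type.
Implicit Types (x y : R * R) (z : Q).

Lemma convex_segment (Omega : set (R * R)) x y (s : R) : convex_set Omega ->
  Omega x -> Omega y -> 0 <= s <= 1 -> Omega (x + s *: (y - x)).
Proof.
move=> cO Ox Oy /andP[s0 s1]; apply/set_mem.
have := cO y x (Itv01 s0 s1) (mem_set Oy) (mem_set Ox).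
suff -> : x + s *: (y - x) = s *: y + (1 - s) *: x by [].
by rewrite scalerBl scale1r scalerBr addrCA.
Qed.

Lemma continuous_enorm (u : R * R) : {for u, continuous (enorm : R * R -> R)}.
Proof.
have c1 : {for u, continuous (fun u : R * R => u.1)} by exact: cvg_fst.
have c2 : {for u, continuous (fun u : R * R => u.2)} by exact: cvg_snd.
have : {for u, continuous (fun u : R * R => u.1 ^+ 2 + u.2 ^+ 2)}.
  by apply: cvgD; [exact: (cvgM c1 c1)|exact: (cvgM c2 c2)].
by move=> /continuous_comp; apply; exact: sqrt_continuous.
Qed.

Lemma continuous_enorm_sub z :
  {for z, continuous (fun w : Q => enorm (w.1 - w.2))}.
Proof.
have : {for z, continuous (fun w : Q => w.1 - w.2)}.
  by apply: cvgB; [exact: cvg_fst|exact: cvg_snd].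
by move=> /continuous_comp; apply; exact: continuous_enorm.
Qed.

Lemma continuous_path (w : R * Q) :
  {for w, continuous (fun w : R * Q => w.2.1 + w.1 *: (w.2.2 - w.2.1))}.
Proof.
have c1 : {for w, continuous (fun w : R * Q => w.1)} by exact: cvg_fst.
have c2 : {for w, continuous (fun w : R * Q => w.2)} by exact: cvg_snd.
have c21 : {for w, continuous (fun w : R * Q => w.2.1)}.
  by move: c2 => /continuous_comp; apply; exact: cvg_fst.
have c22 : {for w, continuous (fun w : R * Q => w.2.2)}.
  by move: c2 => /continuous_comp; apply; exact: cvg_snd.
by apply: cvgD => //; apply: cvgZ => //; apply: cvgB.
Qed.

Variables (Omega : set (R * R)) (sigma : R * R -> R).
Hypothesis Omega_open : open Omega.
Hypothesis Omega_convex : convex_set Omega.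
Hypothesis sigma_cont : forall x, Omega x -> {for x, continuous sigma}.

Let path_mean z : R := \int[lebesgue1]_(s in `[0, 1]) sigma (z.1 + s *: (z.2 - z.1)).

Lemma integrable_path z : Omega z.1 -> Omega z.2 ->
  lebesgue1.-integrable `[0, 1] (fun s => (sigma (z.1 + s *: (z.2 - z.1)))%:E).
Proof.
move=> O1 O2; apply: (@continuous_compact_integrable R
  (fun s => sigma (z.1 + s *: (z.2 - z.1))) `[0, 1]%classic).
  exact: segment_compact.
apply: continuous_in_subspaceT => s /[!inE]/= /[!in_itv]/= s01.
have c : {for s, continuous (fun s : R => (s, z))}.
  by apply: (@cvg_pair _ _ _ (nbhs s) (nbhs s) (nbhs z)); [exact: cvg_id|exact: cvg_cst].
have := continuous_comp c (@continuous_path (s, z)).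
move=> /continuous_comp; apply; apply: sigma_cont.
exact: convex_segment.
Qed.

Lemma near_path_point z (s e : R) : Omega z.1 -> Omega z.2 -> 0 <= s <= 1 ->
  0 < e -> \forall s' \near s & w \near z,
  `|sigma (z.1 + s' *: (z.2 - z.1)) - sigma (w.1 + s' *: (w.2 - w.1))| <= e.
Proof.
move=> O1 O2 s01 e0; have e20 : 0 < e / 2 by rewrite divr_gt0.
have Os : Omega (z.1 + s *: (z.2 - z.1)) by exact: convex_segment.
have cs : {for (s, z), continuous (fun w : R * Q =>
    sigma (w.2.1 + w.1 *: (w.2.2 - w.2.1)))}.
  by have := @continuous_path (s, z); move=> /continuous_comp; apply;
    apply: sigma_cont.
have h1 : \forall s' \near s & w \near z,
   `|sigma (z.1 + s *: (z.2 - z.1)) - sigma (w.1 + s' *: (w.2 - w.1))| < e / 2.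
  by move/cvgrPdist_lt : cs => /(_ _ e20).
have c1 : {for s, continuous (fun s : R => sigma (z.1 + s *: (z.2 - z.1)))}.
  have c : {for s, continuous (fun s : R => (s, z))}.
    by apply: (@cvg_pair _ _ _ (nbhs s) (nbhs s) (nbhs z)); [exact: cvg_id|exact: cvg_cst].
  have := continuous_comp c (@continuous_path (s, z)).
  by move=> /continuous_comp; apply; apply: sigma_cont.
have h2 : \forall s' \near s & w \near z,
   `|sigma (z.1 + s *: (z.2 - z.1)) - sigma (z.1 + s' *: (z.2 - z.1))| < e / 2.
  have kf (w : R * Q) : {for w, continuous (fun w : R * Q => w.1)}.
    exact: cvg_fst.
  by move/cvgrPdist_lt : c1 => /(_ _ e20) /(kf (s, z)).
move: h1 h2; apply: filterS2 => -[s' w] /= k1 k2.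
rewrite (le_trans (ler_distD (sigma (z.1 + s *: (z.2 - z.1))) _ _))//.
by rewrite [leRHS]splitr lerD ?(ltW k1)// distrC ltW.
Qed.

(** By compactness of the segment, [sigma] is close to its values along a
segment on all nearby segments, uniformly. *)
Lemma continuous_path_mean z : Omega z.1 -> Omega z.2 ->
  {for z, continuous path_mean}.
Proof.
move=> O1 O2.
have k1 : {for z, continuous (fun w : Q => w.1)} by exact: cvg_fst.
have k2 : {for z, continuous (fun w : Q => w.2)} by exact: cvg_snd.
have O1z : \forall w \near z, Omega w.1.
  exact: (k1 Omega (open_nbhs_nbhs (conj Omega_open O1))).
have O2z : \forall w \near z, Omega w.2.
  exact: (k2 Omega (open_nbhs_nbhs (conj Omega_open O2))).
have near_path e : 0 < e -> \forall w \near z, forall s, 0 <= s <= 1 ->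
    `|sigma (z.1 + s *: (z.2 - z.1)) - sigma (w.1 + s *: (w.2 - w.1))| <= e.
  move=> e0; have cpt := @segment_compact R 0 1.
  have /compact_near_coveringP cov := cpt.
  suff : \forall w \near z, `[0, 1]%classic `<=` [set s |
      `|sigma (z.1 + s *: (z.2 - z.1)) - sigma (w.1 + s *: (w.2 - w.1))| <= e].
    by apply: filterS => w sub s s01; apply: sub; rewrite /= in_itv.
  apply: (cov _ (nbhs z) (fun w s =>
    `|sigma (z.1 + s *: (z.2 - z.1)) - sigma (w.1 + s *: (w.2 - w.1))| <= e)) => s.
  by rewrite /= in_itv/= => s01; exact: near_path_point.
apply/cvgrPdist_le => e e0; near=> w.
have Ow1 : Omega w.1 by near: w.
have Ow2 : Omega w.2 by near: w.
have iz := integrable_path O1 O2; have iw := integrable_path Ow1 Ow2.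
rewrite /path_mean -RintegralB//.
have mI : measurable (`[0, 1]%classic : set (measurableTypeR R)).
  exact: measurable_itv.
have ib := integrableB mI iz iw.
apply: (le_trans (le_normr_Rintegral mI ib)).
rewrite (_ : e = \int[lebesgue1]_(s in `[0, 1]) e); last first.
  by rewrite Rintegral_cst//= lebesgue_measure_itv/= lte_fin ltr01/= subr0 mulr1.
apply: le_Rintegral => //.
- exact: (integrable_norm ib).
- by apply: continuous_compact_integrable; [exact: segment_compact|
    apply: continuous_subspaceT => ?; exact: cvg_cst].
- move=> s /=; rewrite in_itv/= => s01.
  by move: s s01; near: w; exact: near_path.
Unshelve. all: by end_near. Qed.

Definition amplitude z : R := kernelE sigma z.1 z.2 / enorm (z.1 - z.2).

Lemma amplitude_gt0 z : 0 < enorm (z.1 - z.2) -> 0 < amplitude z.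
Proof. by move=> e0; rewrite divr_gt0// expR_gt0. Qed.

Lemma continuous_amplitude z : Omega z.1 -> Omega z.2 ->
  0 < enorm (z.1 - z.2) -> {for z, continuous amplitude}.
Proof.
move=> O1 O2 e0.
have ce := @continuous_enorm_sub z.
have cm := continuous_path_mean O1 O2.
have cE : {for z, continuous (fun w : Q => kernelE sigma w.1 w.2)}.
  have : {for z, continuous (fun w : Q => - (enorm (w.1 - w.2) * path_mean w))}.
    by apply: cvgN; exact: (cvgM ce cm).
  by move=> /continuous_comp; apply; exact: continuous_expR.
by apply: cvgM => //; apply: cvgV => //; rewrite gt_eqF.
Qed.

End Amplitude.

(** * Cells *)

Section Cells.
Context {R : realType}.
Local Notation P := (measurableTypeR R * measurableTypeR R)%type.
Local Notation mu := (@lebesgue2 R).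
Local Notation mu2 := (@lebesgue4 R).
Implicit Types (n : nat).

Lemma nsq_sub_gt0 (X Y : set (R * R)) x y :
  X `&` Y = set0 -> X x -> Y y -> 0 < nsq (x - y).
Proof.
move=> XY0 Xx Yy; rewrite lt_neqAle nsq_ge0 andbT eq_sym paddr_eq0 ?sqr_ge0//.
rewrite !sqrf_eq0 !subr_eq0; apply/negP => /andP[/eqP e1 /eqP e2].
have : (X `&` Y) x.
  by split=> //; rewrite [x]surjective_pairing e1 e2 -surjective_pairing.
by rewrite XY0.
Qed.

Lemma Lfun2_cut d (T : measurableType d) (m : {measure set T -> \bar R})
    (D : set T) (f : T -> R) : measurable D -> f \in Lfun m 2%:E ->
  (fun x => \1_D x * f x) \in Lfun m 2%:E.
Proof.
move=> mD f2; apply: (Lfun2_le _ f2).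
  by apply: measurable_funM; [exact: measurable_indic|exact: Lfun2_measurable f2].
by move=> x; rewrite normrM ler_piMl// ger0_norm// indicE lern1 leq_b1.
Qed.

(** Truncating a function by a rough set in each variable is harmless: the lower
bound only sees the boxes containing these sets. *)
Lemma local_rank_bound_cut (a b : R * R) (r A kappa delta : R) : 0 < r ->
  64 * r <= enorm (a - b) -> 0 < kappa -> 0 < delta ->
  exists2 c : R, 0 < c & forall n, (0 < n)%N ->
  forall (J : finType) (F : J -> P -> R) (G : bool -> J -> P -> R),
  (forall j, F j \in Lfun mu 2%:E) -> (forall k j, G k j \in Lfun mu 2%:E) ->
  forall X' Y' : set P, measurable X' -> measurable Y' ->
  X' `<=` box a r -> Y' `<=` box b r ->
  let V k (z : P * P) := \sum_j F j z.1 * G k j z.2 in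
  kappa <= \int[mu2]_(z in X' `*` Y') \sum_k
    (2 * (A * phase k n z.1 z.2) * V k z - V k z ^+ 2) ->
  c * n%:R `^ (2 - delta) <= #|J|%:R.
Proof.
move=> r0 rL kappa0 delta0.
have [c c0 H] := local_rank_bound A r0 rL kappa0 delta0.
exists c => // n n0 J F G F2 G2 X' Y' mX mY Xa Yb V kV.
apply: (H n n0 J (fun j x => \1_X' x * F j x) (fun k j y => \1_Y' y * G k j y)).
- by move=> j; exact: Lfun2_cut.
- by move=> k j; exact: Lfun2_cut.
apply: (le_trans kV); rewrite le_eqVlt; apply/orP; left; apply/eqP.
rewrite -Rintegral_indic; apply: eq_Rintegral => z _.
rewrite mulr_sumr; apply: eq_bigr => k _.
have -> : \sum_j \1_X' z.1 * F j z.1 * (\1_Y' z.2 * G k j z.2) =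
    \1_X' z.1 * \1_Y' z.2 * V k z.
  by rewrite mulr_sumr; apply: eq_bigr => j _; ring.
have -> : \1_(X' `*` Y') z = \1_X' z.1 * \1_Y' z.2 :> R.
  by rewrite !indicE -natrM mulnb in_setX.
rewrite /box_kernel !indicE.
case: (boolP (z.1 \in X')) => [|_]; last by rewrite !mul0r mulr0 expr0n subr0.
case: (boolP (z.2 \in Y')) => [|_]; last by rewrite !(mulr0, mul0r) expr0n subr0.
by rewrite !inE => /Yb zb /Xa za; rewrite !mem_set// !mul1r.
Qed.

(** An additive function of sets keeps a fixed fraction of its value on
one piece of any finite cover; the pieces are split off one at a time, so that
each of them is measurable. *)
Lemma pigeonhole_cover (Phi : set P -> R) (rho : R) (s : seq (R * R)) (A : set P)
    (kappa : R) : Phi set0 = 0 ->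
  (forall A B, measurable A -> measurable B -> Phi A = Phi (A `&` B) + Phi (A `\` B)) ->
  measurable A -> (forall x, A x -> exists2 c, c \in s & box c rho x) ->
  0 < kappa -> kappa <= Phi A ->
  exists2 c, c \in s & exists A' : set P,
    [/\ measurable A', A' `<=` A, A' `<=` box c rho &
        kappa / 2 ^+ size s <= Phi A'].
Proof.
move=> Phi0 PhiD; elim: s A kappa => [|c s IHs] A kappa mA cov kappa0 kA.
  have A0 : A = set0 by apply/seteqP; split=> // x /cov[].
  by move: kA; rewrite A0 Phi0 leNgt kappa0.
have mB := @measurable_box R c rho.
have [big|small] := leP (kappa / 2) (Phi (A `&` box c rho)).
  exists c; first exact: mem_head.
  exists (A `&` box c rho); split.
  - exact: measurableI.
  - exact: subIsetl.
  - exact: subIsetr.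
  - apply: le_trans big; rewrite ler_pM2l// lef_pV2 ?posrE ?exprn_gt0//.
    by rewrite exprS ler_peMr// exprn_ege1// ler1n.
have [||||c' c's [A' [mA' A'A A'c' kA']]] := IHs (A `\` box c rho) (kappa / 2).
- exact: measurableD.
- move=> x [/cov[c' + c'x] ncx]; rewrite in_cons => /predU1P[c'c|c's].
    by rewrite c'c in c'x.
  by exists c'.
- by rewrite divr_gt0.
- by move: kA; rewrite (PhiD A (box c rho))//; lra.
exists c'; first by rewrite in_cons c's orbT.
exists A'; split=> //; first by move=> x /A'A[].
by rewrite exprS invfM mulrA.
Qed.

Lemma Rintegral_additive d (T : measurableType d) (m : {measure set T -> \bar R})
    (D : T -> R) (A B : set T) : m.-integrable setT (EFin \o D) ->
  measurable A -> measurable B ->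
  \int[m]_(x in A) D x = \int[m]_(x in A `&` B) D x + \int[m]_(x in A `\` B) D x.
Proof.
move=> iD mA mB; rewrite -{1}(setUIDK A B) Rintegral_setU//.
- exact: measurableI.
- exact: measurableD.
- by rewrite setUIDK; apply: integrableS iD.
- by apply/disj_setPS => x [[_ Bx] [_ /(_ Bx)]].
Qed.

Lemma uniform_pos (T : eqType) (s : seq T) (Pr : T -> R -> Prop) :
  (forall x c c', Pr x c -> c' <= c -> Pr x c') ->
  (forall x, x \in s -> exists2 c, 0 < c & Pr x c) ->
  exists2 c, 0 < c & forall x, x \in s -> Pr x c.
Proof.
move=> mono; elim: s => [|x s IHs] H; first by exists 1.
have [|c c0 cs] := IHs; first by move=> y ys; apply: H; rewrite in_cons ys orbT.
have [c' c'0 c'x] := H x (mem_head _ _).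
exists (Num.min c c'); first by rewrite lt_min c0.
move=> y; rewrite in_cons => /predU1P[->|/cs ys].
  by apply: (mono _ _ _ c'x); rewrite ge_min lexx orbT.
by apply: (mono _ _ _ ys); rewrite ge_min lexx.
Qed.

(** The centers are taken in [X] because the amplitude on a cell is compared with
its value at the center. *)
Lemma compact_box_cover (X : set (R * R)) (rho : R) : compact X -> 0 < rho ->
  exists2 s : seq (R * R), (forall c, c \in s -> X c) &
    forall x, X x -> exists2 c, c \in s & box c rho x.
Proof.
move=> cX rho0; have /compact_near_coveringP cov := cX.
pose F : set_system (seq (R * R)) := fun A : set (seq (R * R)) =>
  exists2 s0 : seq (R * R), (forall c, c \in s0 -> X c) &
    forall s : seq (R * R), {subset s0 <= s} -> (forall c, c \in s -> X c) -> A s.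
have FF : Filter F.
  split.
  - by exists [::].
  - move=> A B [s sX sA] [s' s'X s'B]; exists (s ++ s').
      by move=> c; rewrite mem_cat => /orP[/sX|/s'X].
    move=> t st tX; split; [apply: sA|apply: s'B] => // c cs; apply: st.
      by rewrite mem_cat cs.
    by rewrite mem_cat cs orbT.
  - move=> A B AB [s sX sA]; exists s => // t st tX.
    by apply: AB; exact: sA.
have [s sX sC] : \forall s \near F, X `<=` (fun x => exists2 c, c \in s & box c rho x).
- apply: cov => x Xx; exists (ball x rho, [set s : seq (R * R) | x \in s]) => /=.
    split; first exact: nbhsx_ballx.
    exists [:: x] => [c|s xs _ /=]; first by rewrite inE => /eqP ->.
    by apply: xs; rewrite mem_head.
  move=> [y s] /= [[y1 y2] xs]; exists x => //; apply/boxP.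
  by rewrite distrC (distrC y.2); split; exact: ltW.
- by exists s => // x Xx; exact: (sC s (fun _ => id) sX x Xx).
Qed.

(** Size, uniform over the pairs of points of [X] and [Y], of the boxes on which
the amplitude is almost constant and the phase does not degenerate. *)
Lemma uniform_scale (X Y : set (R * R)) (A : (R * R) * (R * R) -> R) (eta : R) :
  compact X -> compact Y -> X `&` Y = set0 -> 0 < eta ->
  (forall z, X z.1 -> Y z.2 -> {for z, continuous A}) ->
  exists2 rho : R, 0 < rho & forall x y, X x -> Y y ->
    64 * rho <= enorm (x - y) /\
    forall x' y', X x' -> Y y' -> box x rho x' -> box y rho y' ->
      `|A (x, y) - A (x', y')| <= eta.
Proof.
move=> cX cY XY0 eta0 cA.
pose S : set ((R * R) * (R * R)) := X `*` Y.
have cS : compact S by exact: compact_setX.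
pose good rho z := 64 * rho <= enorm (z.1 - z.2) /\
    forall w, S w -> box z.1 rho w.1 -> box z.2 rho w.2 -> `|A z - A w| <= eta.
have /compact_near_coveringP cov := cS.
have : \forall rho \near (0 : R)^'+, S `<=` good rho.
  apply: (cov _ (0 : R)^'+ good) => z [Xz Yz].
  have e0 : 0 < enorm (z.1 - z.2) by rewrite enorm_gt0 (nsq_sub_gt0 XY0).
  have ce := @continuous_enorm_sub R z.
  have n1 : \forall w \near z, enorm (z.1 - z.2) / 2 < enorm (w.1 - w.2).
    have e20 : 0 < enorm (z.1 - z.2) / 2 by rewrite divr_gt0.
    move/cvgrPdist_lt : ce => /(_ _ e20); apply: filterS => w.
    by rewrite ltr_distlC => /andP[+ _]; lra.
  have eta20 : 0 < eta / 2 by rewrite divr_gt0.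
  have [d /= d0 dA] : exists2 d : R, 0 < d & forall w, ball z d w -> `|A z - A w| < eta / 2.
    move/cvgrPdist_lt : (cA z Xz Yz) => /(_ _ eta20) /nbhs_ballP[d /= d0 h].
    by exists d.
  have d20 : 0 < d / 2 by rewrite divr_gt0.
  have n2 : \forall w \near z, ball z (d / 2) w by exact: nbhsx_ballx.
  have n3 : \forall rho \near (0 : R)^'+, rho < d / 2 by exact: nbhs_right_lt.
  have n4 : \forall rho \near (0 : R)^'+, rho < enorm (z.1 - z.2) / 128.
    by apply: nbhs_right_lt; rewrite divr_gt0.
  exists ([set w | ball z (d / 2) w /\ enorm (z.1 - z.2) / 2 < enorm (w.1 - w.2)],
    [set rho | rho < d / 2 /\ rho < enorm (z.1 - z.2) / 128]).
    by split; apply: filterI.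
  move=> [w rho] /= [[zw ew] [rd re]]; split; first by lra.
  move=> w' _ /boxP[b1 b2] /boxP[c1 c2].
  have zw' : ball z d w'.
    rewrite (splitr d); apply: (ball_triangle zw).
    split; split; rewrite /ball/= distrC.
    - exact: le_lt_trans b1 rd.
    - exact: le_lt_trans b2 rd.
    - exact: le_lt_trans c1 rd.
    - exact: le_lt_trans c2 rd.
  have zw2 : ball z d w.
    by apply: le_ball zw; rewrite ler_pdivrMr// ler_peMr ?ler1n// ltW.
  rewrite (le_trans (ler_distD (A z) _ _))// [leRHS]splitr lerD ?ltW ?dA//.
  by rewrite distrC dA.
move=> H; have [rho [rho0 rg]] : exists rho : R, 0 < rho /\ S `<=` good rho.
  near (0 : R)^'+ => rho; exists rho; split.
    by near: rho; exact: nbhs_right_gt.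
  by near: rho.
exists rho => // x y Xx Yy; have [g1 g2] := rg (x, y) (conj Xx Yy).
by split=> // x' y' Xx' Yy'; exact: (g2 (x', y') (conj Xx' Yy')).
Unshelve. all: by end_near. Qed.

End Cells.

(** * Real form of complex separated sums *)

Section ComplexLp.
Context {R : realType}.
Local Notation normc := (@ComplexField.Normc.normc R).

Lemma Re_sum I (r : seq I) (f : I -> R[i]) :
  complex.Re (\sum_(i <- r) f i) = \sum_(i <- r) complex.Re (f i).
Proof.
elim: r => [|i r IHr]; first by rewrite !big_nil.
by rewrite !big_cons -IHr; case: (f i) (\sum_(j <- r) f j) => a b [].
Qed.

Lemma Im_sum I (r : seq I) (f : I -> R[i]) :
  complex.Im (\sum_(i <- r) f i) = \sum_(i <- r) complex.Im (f i).
Proof.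
elim: r => [|i r IHr]; first by rewrite !big_nil.
by rewrite !big_cons -IHr; case: (f i) (\sum_(j <- r) f j) => a b [].
Qed.

Lemma sqr_normc (z : R[i]) : normc z ^+ 2 = complex.Re z ^+ 2 + complex.Im z ^+ 2.
Proof. by case: z => a b; rewrite sqr_sqrtr// addr_ge0// sqr_ge0. Qed.

Lemma normc_ge0 (z : R[i]) : 0 <= normc z.
Proof. by case: z => a b; exact: sqrtr_ge0. Qed.

Context {d} {T : measurableType d}.
Variable mu : {measure set T -> \bar R}.

Lemma measurable_cut (D : set T) (f : T -> R) : measurable D ->
  measurable_fun D f -> measurable_fun setT (fun x => \1_D x * f x).
Proof.
move=> mD mf; have := (measurable_restrictT f mD).1 mf.
by apply: eq_measurable_fun => x _; rewrite patch_indic mulrC.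
Qed.

(** On a set of finite measure a bounded function is square integrable, so both
values of [p] reduce to [2]. *)
Lemma in_Lp_cut (p : \bar R) (D : set T) (f : T -> R[i]) :
  p = 2%:E \/ p = +oo%E -> measurable D -> (mu D < +oo)%E -> (0 < mu setT)%E ->
  in_Lp mu p D f ->
  (fun x => \1_D x * complex.Re (f x)) \in Lfun mu 2%:E /\
  (fun x => \1_D x * complex.Im (f x)) \in Lfun mu 2%:E.
Proof.
move=> pE mD Doo T0 [mre mim fp].
have mRe := measurable_cut mD mre; have mIm := measurable_cut mD mim.
pose h x := \1_D x * normc (f x).
have i01 x : \1_D x * \1_D x = \1_D x :> R.
  by rewrite indicE; case: (_ \in _); rewrite ?mulr1 ?mulr0.
have hE x : h x ^+ 2 = (\1_D x * complex.Re (f x)) ^+ 2 + (\1_D x * complex.Im (f x)) ^+ 2.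
  by rewrite /h !exprMn sqr_normc mulrDr.
have h0 x : 0 <= h x by rewrite mulr_ge0// normc_ge0.
have mh : measurable_fun setT h.
  have m2 := measurable_funD (measurable_funX 2 mRe) (measurable_funX 2 mIm).
  have ms : measurable_fun setT (@Num.sqrt R).
    by apply: continuous_measurable_fun => x; exact: sqrt_continuous.
  have := measurableT_comp ms m2; apply: eq_measurable_fun => x _ /=.
  by rewrite -hE sqrtr_sqr ger0_norm.
have h2 : h \in Lfun mu 2%:E.
  case: pE fp => -> fp.
    rewrite inE; apply/andP; split; rewrite inE//=.
  apply/Lfun2P; split=> //; apply/integrableP; split.
    by apply/measurable_EFinP; exact: measurable_funX.
  move: fp; rewrite /Lp_norm unlock /Lnorm T0 => fp.
  pose M := ess_sup mu (fun x => `|(h x)%:E|%E).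
  have Mfin : (M < +oo)%E by [].
  have M0 : (0 <= M)%E by apply: ess_sup_gee => //; apply: nearW => x.
  have Mh := ess_sup_ge mu (fun x => `|(h x)%:E|%E).
  have ME : M = (fine M)%:E by rewrite fineK// ge0_fin_numE.
  apply: (@le_lt_trans _ _ (\int[mu]_x (fine M ^+ 2 * \1_D x)%R%:E)%E).
    apply: ae_ge0_le_integral => //.
    - by apply: measurableT_comp => //; apply/measurable_EFinP; exact: measurable_funX.
    - by move=> x _; rewrite lee_fin mulr_ge0// sqr_ge0.
    - by apply/measurable_EFinP; apply: measurable_funM => //; exact: measurable_indic.
    - move: Mh; apply: filterS => x; rewrite -/M ME lee_fin => hM _ /=.
      rewrite lee_fin ger0_norm ?sqr_ge0//.
      have -> : h x ^+ 2 = h x ^+ 2 * \1_D x by rewrite /h exprMn expr2 i01 mulrAC i01.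
      rewrite ler_wpM2r// -(ger0_norm (h0 x)) lerXn2r ?nnegrE//.
      exact: le_trans hM.
  under eq_integral do rewrite EFinM.
  rewrite ge0_integralZl//; last 2 first.
    by apply/measurable_EFinP; exact: measurable_indic.
    by rewrite lee_fin sqr_ge0.
  by rewrite integral_indic// setIT lte_mul_pinfty// lee_fin sqr_ge0.
have part (g : T -> R) : measurable_fun setT g -> (forall x, g x ^+ 2 <= h x ^+ 2) ->
    g \in Lfun mu 2%:E.
  move=> mg gh; apply: (Lfun2_le mg h2) => x.
  by rewrite -[leLHS]sqrtr_sqr -[leRHS]sqrtr_sqr ler_sqrt ?sqr_ge0.
by split; apply: part => // x; rewrite hE ?lerDl ?lerDr sqr_ge0.
Qed.

End ComplexLp.

Section Identity.
Context {R : realType}.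
Local Notation normc := (@ComplexField.Normc.normc R).
Implicit Types (X Y : set (R * R)) (z : (R * R) * (R * R)).

(** The real and imaginary parts of [f] (resp. [g]) arranged so that the real
part of [\sum_l f l x * g l y], and the opposite of its imaginary part, become
sums of products over the same functions of [x]: the rank is then counted only
once for both. *)
Definition real_part (c : bool) (w : R[i]) : R :=
  if c then complex.Re w else complex.Im w.

Definition left_factor X N (f : 'I_N -> R * R -> R[i]) (j : 'I_N * bool) (x : R * R) : R :=
  \1_X x * real_part j.2 (f j.1 x).

Definition right_factor Y N (g : 'I_N -> R * R -> R[i]) (k : bool)
    (j : 'I_N * bool) (y : R * R) : R :=
  (if k && j.2 then 1 else -1) * (\1_Y y * real_part (k == j.2) (g j.1 y)).

Lemma sum_factors X Y N (f g : 'I_N -> R * R -> R[i]) k z : X z.1 -> Y z.2 ->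
  \sum_j left_factor X f j z.1 * right_factor Y g k j z.2 =
  let w := \sum_(l < N) f l z.1 * g l z.2 in
  if k then complex.Re w else - complex.Im w.
Proof.
move=> Xz Yz /=.
rewrite -(pair_bigA _ (fun l b => left_factor X f (l, b) z.1 *
  right_factor Y g k (l, b) z.2)) /= Re_sum Im_sum -sumrN.
under eq_bigr => l _.
  rewrite big_bool /left_factor /right_factor /= !indicE !mem_set// !mul1r.
  over.
by case: k => /=; apply: eq_bigr => l _; case: (f l _) => a b; case: (g l _) => c d;
  rewrite /real_part /=; ring.
Qed.

Lemma sqr_phase n z : 0 < nsq (z.1 - z.2) ->
  phase true n z.1 z.2 ^+ 2 + phase false n z.1 z.2 ^+ 2 = 1 :> R.
Proof.
move=> z0; rewrite /phase /pcos /psin -sqr_normc.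
have c1 : normc (circ (z.1 - z.2)) = 1.
  apply/eqP; rewrite -(@eqrXn2 _ 2) ?normc_ge0// expr1n sqr_normc /=.
  by rewrite !exprMn exprVn -mulrDl enorm_sqr divff// gt_eqF.
elim: n => [|n IHn]; first by rewrite expr0 ComplexField.Normc.normc1 expr1n.
by rewrite [circ _ ^+ n.+1]exprS ComplexField.Normc.normcM exprMn IHn c1 expr1n mulr1.
Qed.

Lemma sqr_kernelG sigma n z : 0 < nsq (z.1 - z.2) ->
  normc (kernelG sigma n z.1 z.2) ^+ 2 = amplitude sigma z ^+ 2.
Proof.
move=> z0; rewrite /kernelG expi_polar_angle// sqr_normc /=.
rewrite -/(amplitude sigma z) !(mul0r, mulr0, subr0, addr0).
by rewrite !exprMn -mulrDr sqrrN (sqr_phase n z0) mulr1.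
Qed.

Lemma sqr_error X Y N (f g : 'I_N -> R * R -> R[i]) sigma n z : X z.1 -> Y z.2 ->
  0 < nsq (z.1 - z.2) ->
  normc (kernelG sigma n z.1 z.2 - \sum_(l < N) f l z.1 * g l z.2) ^+ 2 =
  \sum_k (amplitude sigma z * phase k n z.1 z.2 -
    \sum_j left_factor X f j z.1 * right_factor Y g k j z.2) ^+ 2.
Proof.
move=> Xz Yz z0; rewrite big_bool !(sum_factors _ _ _ Xz Yz) /=.
set w := \sum_l _; rewrite sqr_normc /kernelG expi_polar_angle//.
rewrite -/(amplitude sigma z); case: w => a b /=; ring.
Qed.

(** Completing the square, [2 * (A * ph k) * v k - v k ^+ 2] sums to
[A ^+ 2] minus the squared error; replacing [A] by the constant [A0] costs
[eta * (1 + v k ^+ 2)], and [v k ^+ 2] is at most twice [(A * ph k) ^+ 2] plus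
twice the squared error. *)
Lemma cell_gap (A A0 eta : R) (ph v : bool -> R) : `|A0 - A| <= eta ->
  (forall k, `|ph k| <= 1) -> ph true ^+ 2 + ph false ^+ 2 = 1 ->
  A ^+ 2 * (1 - 2 * eta) - 2 * eta -
    (1 + 2 * eta) * \sum_k (A * ph k - v k) ^+ 2 <=
  \sum_k (2 * (A0 * ph k) * v k - v k ^+ 2).
Proof.
move=> Aeta ph1 ph2; have eta0 : 0 <= eta := le_trans (normr_ge0 _) Aeta.
have step k : 2 * (A * ph k) * v k - v k ^+ 2 - eta * (1 + v k ^+ 2) <=
    2 * (A0 * ph k) * v k - v k ^+ 2.
  rewrite -subr_ge0.
  have -> : 2 * (A0 * ph k) * v k - v k ^+ 2 -
      (2 * (A * ph k) * v k - v k ^+ 2 - eta * (1 + v k ^+ 2)) =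
      eta * (1 + v k ^+ 2) + 2 * ((A0 - A) * (ph k * v k)) by ring.
  have := prod_bound Aeta (lexx `|ph k * v k|) => /andP[h _].
  have h2 : 2 * `|ph k * v k| <= 1 + v k ^+ 2.
    rewrite normrM -[v k ^+ 2]ger0_norm ?sqr_ge0// normrX.
    have h3 : `|ph k| * `|v k| <= `|v k| by rewrite ler_piMl.
    have := sqr_ge0 (1 - `|v k|); rewrite sqrrB expr1n mul1r; lra.
  have := ler_wpM2l eta0 h2; lra.
have vk k : v k ^+ 2 <= 2 * (A * ph k) ^+ 2 + 2 * (A * ph k - v k) ^+ 2.
  rewrite -subr_ge0.
  have -> : 2 * (A * ph k) ^+ 2 + 2 * (A * ph k - v k) ^+ 2 - v k ^+ 2 =
    (2 * (A * ph k) - v k) ^+ 2 by ring.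
  exact: sqr_ge0.
rewrite !big_bool /=; apply: le_trans (lerD (step true) (step false)).
have := lerD (vk true) (vk false) => /(ler_wpM2l eta0).
set p := ph true in ph2 *; set q := ph false in ph2 *.
set v1 := v true; set v2 := v false.
have -> : A ^+ 2 = (A * p) ^+ 2 + (A * q) ^+ 2 by rewrite !exprMn -mulrDr ph2 mulr1.
move: (A * p) (A * q) => a b; lra.
Qed.

End Identity.

(** * Measure of boxes and the deficit *)

Section BoxMeasure.
Context {R : realType}.
Local Notation P := (measurableTypeR R * measurableTypeR R)%type.
Local Notation mu := (@lebesgue2 R).
Local Notation mu2 := (@lebesgue4 R).

Lemma lebesgue2_box (c : R * R) (r : R) : 0 < r ->
  mu (box c r) = (4 * r ^+ 2)%:E.
Proof.
move=> r0; pose I s : set (measurableTypeR R) := `[s - r, s + r]%classic.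
have mI s : measurable (I s) by exact: measurable_itv.
transitivity (@lebesgue_measure R (I c.1) * @lebesgue_measure R (I c.2))%E.
  exact: (product_measure1E _ _ (mI c.1) (mI c.2)).
have l s : (@lebesgue_measure R (I s) = (2 * r)%:E)%E.
  rewrite /I lebesgue_measure_itv/= lte_fin ifT; last by lra.
  by rewrite -EFinB; congr EFin; ring.
by rewrite !l -EFinM; congr EFin; ring.
Qed.

Lemma lebesgue2_gt0 (A : set P) (c : R * R) (r : R) : measurable A -> 0 < r ->
  box c r `<=` A -> (0 < mu A)%E.
Proof.
move=> mA r0 cA; apply: (@lt_le_trans _ _ (mu (box c r))).
  by rewrite lebesgue2_box// lte_fin mulr_gt0// exprn_gt0.
by apply: le_measure; rewrite ?inE//; exact: measurable_box.
Qed.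

Lemma lebesgue4_setX (A B : set P) : measurable A -> measurable B ->
  mu2 (A `*` B) = (mu A * mu B)%E.
Proof. by move=> mA mB; exact: product_measure1E. Qed.

Lemma lebesgue2_compact (K : set (R * R)) : compact K -> (mu (K : set P) < +oo)%E.
Proof.
move=> cK; have [M [_ KM]] := compact_bounded cK.
pose r := `|M| + 1.
have r0 : 0 < r by rewrite ltr_wpDl.
have Kr : K `<=` box (0, 0) r.
  move=> x Kx; have : `|x| <= r.
    by apply: (KM r) => //; rewrite (le_lt_trans (ler_norm M))// ltrDl.
  by rewrite prod_normE ge_max => /andP[x1 x2]; apply/boxP; rewrite /= !subr0.
apply: (@le_lt_trans _ _ (mu (box (0, 0) r))).
  apply: le_measure; rewrite ?inE//; last exact: measurable_box.
  exact: compact_plane_measurable.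
by rewrite lebesgue2_box// ltry.
Qed.

Lemma ball_box (c : R * R) (r d : R) : r < d -> box c r `<=` ball c d.
Proof.
move=> rd x /boxP[x1 x2]; split; rewrite /ball/= distrC.
  exact: le_lt_trans x1 rd.
exact: le_lt_trans x2 rd.
Qed.

(** Every point of [X] is a limit of interior points, so that [X] has positive
measure in any neighbourhood of any of its points. *)
Lemma compact_domain_box (X : set (R * R)) (x : R * R) (rho : R) :
  compact_domain X -> X x -> 0 < rho ->
  exists c, exists2 r : R, 0 < r & box c r `<=` X `&` box x rho.
Proof.
move=> [_ _ _ clX] Xx rho0.
have [c [Xc xc]] : (X° `&` ball x rho) !=set0.
  by rewrite -clX in Xx; apply: Xx; exact: nbhsx_ballx.
have : nbhs c (X `&` ball x rho).
  by apply: filterI => //; apply: open_nbhs_nbhs; split => //; exact: ball_open.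
move=> /nbhs_ballP[d /= d0 cd]; exists c; exists (d / 2); first by rewrite divr_gt0.
have d2 : d / 2 < d by rewrite ltr_pdivrMr// ltr_pMr// ltr1n.
move=> y /(ball_box d2) /cd[Xy [y1 y2]]; split=> //; apply/boxP.
by rewrite distrC (distrC y.2); split; exact: ltW.
Qed.

End BoxMeasure.

Section Separability.
Context {R : realType}.
Local Notation P := (measurableTypeR R * measurableTypeR R)%type.
Local Notation Q := ((R * R) * (R * R))%type.
Local Notation mu := (@lebesgue2 R).
Local Notation mu2 := (@lebesgue4 R).
Variables (Omega : set (R * R)) (sigma : R * R -> R) (X Y : set (R * R)).
Hypothesis Omega_open : open Omega.
Hypothesis Omega_convex : convex_set Omega.
Hypothesis sigma_cont : forall x, Omega x -> {for x, continuous sigma}.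
Hypothesis cX : compact X.
Hypothesis cY : compact Y.
Hypothesis X_sub : X `<=` Omega.
Hypothesis Y_sub : Y `<=` Omega.
Hypothesis XY0 : X `&` Y = set0.

Local Notation A := (amplitude sigma).

Let mX : measurable (X : set P). Proof. exact: compact_plane_measurable. Qed.
Let mY : measurable (Y : set P). Proof. exact: compact_plane_measurable. Qed.

Lemma continuous_amplitudeXY (z : Q) : X z.1 -> Y z.2 -> {for z, continuous A}.
Proof.
move=> Xz Yz; apply: (continuous_amplitude Omega_open Omega_convex sigma_cont).
- exact: X_sub.
- exact: Y_sub.
- by rewrite enorm_gt0 (nsq_sub_gt0 XY0).
Qed.

Let within_amplitude : {within X `*` Y, continuous A}.
Proof.
apply: continuous_in_subspaceT => z /[!inE] -[Xz Yz].
exact: continuous_amplitudeXY.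
Qed.

Lemma amplitude_max : X !=set0 -> Y !=set0 ->
  exists z : Q, [/\ X z.1, Y z.2 & forall w, X w.1 -> Y w.2 -> A w <= A z].
Proof.
move=> [x Xx] [y Yy].
have [|z /[!inE] -[Xz Yz] zM] := compact_EVT_max _ (compact_setX cX cY) within_amplitude.
  by exists (x, y).
by exists z; split => // w Xw Yw; apply: zM; rewrite inE.
Qed.

Lemma amplitude_min : X !=set0 -> Y !=set0 ->
  exists2 m : R, 0 < m & forall w, X w.1 -> Y w.2 -> m <= A w.
Proof.
move=> [x Xx] [y Yy].
have [|z /[!inE] -[Xz Yz] zm] := compact_EVT_min _ (compact_setX cX cY) within_amplitude.
  by exists (x, y).
exists (A z); first by rewrite amplitude_gt0// enorm_gt0 (nsq_sub_gt0 XY0).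
by move=> w Xw Yw; apply: zm; rewrite inE.
Qed.

Definition indXY (z : Q) : R := \1_X z.1 * \1_Y z.2.

Lemma indXY1 (z : Q) : X z.1 -> Y z.2 -> indXY z = 1.
Proof. by move=> Xz Yz; rewrite /indXY !indicE !mem_set// mul1r. Qed.

Lemma indXY_cases (z : Q) : (X z.1 /\ Y z.2) \/ indXY z = 0.
Proof.
rewrite /indXY !indicE; case: (boolP (z.1 \in X)) => [|_]; last by right; rewrite mul0r.
case: (boolP (z.2 \in Y)) => [|_]; last by right; rewrite mulr0.
by rewrite !inE; left.
Qed.

Lemma Lfun2_indXY : indXY \in Lfun mu2 2%:E.
Proof.
have ind (K : set P) : measurable K -> (mu K < +oo)%E -> (\1_K : P -> R) \in Lfun mu 2%:E.
  move=> mK Koo; apply/Lfun2P; split; first exact: measurable_indic.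
  apply/integrableP; split.
    by apply/measurable_EFinP; apply: measurable_funX; exact: measurable_indic.
  rewrite (eq_integral (fun x => (\1_K x)%:E)); first by rewrite integral_indic// setIT.
  move=> x _; rewrite /= ger0_norm ?sqr_ge0// indicE.
  by case: (_ \in _); rewrite ?expr1n ?expr0n.
by apply: Lfun2_tensor; apply: ind => //; exact: lebesgue2_compact.
Qed.

Definition cut_amplitude (z : Q) : R := indXY z * A z.

Lemma Lfun2_cut_amplitude : cut_amplitude \in Lfun mu2 2%:E.
Proof.
pose W : set Q := [set z | [/\ Omega z.1, Omega z.2 & 0 < enorm (z.1 - z.2)]].
have oW : open W.
  rewrite openE => z [Oz1 Oz2 e0]; rewrite /interior.
  have n1 : \forall w \near z, Omega w.1.
    by apply: (cvg_fst (F := nbhs z.1) (G := nbhs z.2)); exact: open_nbhs_nbhs.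
  have n2 : \forall w \near z, Omega w.2.
    by apply: (cvg_snd (F := nbhs z.1) (G := nbhs z.2)); exact: open_nbhs_nbhs.
  have n3 : \forall w \near z, 0 < enorm (w.1 - w.2).
    by move/cvgrPdist_lt : (@continuous_enorm_sub R z) => /(_ _ e0); apply: filterS => w;
      rewrite ltr_distlC subrr => /andP[].
  by apply: filterS3 n1 n2 n3 => w h1 h2 h3.
have cW z : W z -> {for z, continuous A}.
  move=> [Oz1 Oz2 e0].
  exact: (continuous_amplitude Omega_open Omega_convex sigma_cont Oz1 Oz2 e0).
have [mW mA] := continuous_plane2_measurable oW cW.
have mXY : measurable (X `*` Y : set (P * P)) by exact: measurableX.
have XYW : (X `*` Y : set (P * P)) `<=` W.
  move=> z [Xz Yz]; split; [exact: X_sub|exact: Y_sub|].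
  by rewrite enorm_gt0 (nsq_sub_gt0 XY0).
have mcut : measurable_fun setT (cut_amplitude : P * P -> R).
  have := measurable_cut mXY (measurable_funS mW XYW mA).
  apply: eq_measurable_fun => z _; rewrite /cut_amplitude /indXY.
  by rewrite !indicE -natrM mulnb in_setX.
have [X0|/set0P X0] := eqVneq X set0.
  have -> : cut_amplitude = (0 : P * P -> R); last exact: Lfun2_0.
  by apply/funext => z; rewrite /cut_amplitude /indXY X0 indic0 !mul0r.
have [Y0|/set0P Y0] := eqVneq Y set0.
  have -> : cut_amplitude = (0 : P * P -> R); last exact: Lfun2_0.
  by apply/funext => z; rewrite /cut_amplitude /indXY Y0 indic0 mulr0 !mul0r.
have [z0 [Xz0 Yz0 zM]] := amplitude_max X0 Y0.
have A0 z : X z.1 -> Y z.2 -> 0 < A z.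
  by move=> Xz Yz; rewrite amplitude_gt0// enorm_gt0 (nsq_sub_gt0 XY0).
apply: (@Lfun2_le _ _ R mu2 _ (A z0 *: indXY)) => //.
  by have := Lfun2_comb (A z0) Lfun2_indXY (Lfun2_0 mu2); rewrite addr0.
move=> z; rewrite /cut_amplitude [leRHS](_ : _ = `|A z0 * indXY z|)//.
have [[Xz Yz]|->] := indXY_cases z; last by rewrite mul0r mulr0.
by rewrite indXY1// mul1r mulr1 !gtr0_norm ?A0// zM.
Qed.

Variables (N n : nat) (f g : 'I_N -> R * R -> R[i]).
Hypothesis F2 : forall j, left_factor X f j \in Lfun mu 2%:E.
Hypothesis G2 : forall k j, right_factor Y g k j \in Lfun mu 2%:E.

Definition rank_part k (z : Q) : R :=
  \sum_j left_factor X f j z.1 * right_factor Y g k j z.2.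

(** The squared modulus of the error, cut to [X `*` Y]. *)
Definition error2 (z : Q) : R :=
  \sum_k (cut_amplitude z * phase k n z.1 z.2 - rank_part k z) ^+ 2.

Lemma rank_part0 k (z : Q) : indXY z = 0 -> rank_part k z = 0.
Proof.
move=> z0; apply: big1 => j _; rewrite /left_factor /right_factor.
rewrite (_ : _ * _ = indXY z * (real_part j.2 (f j.1 z.1) *
  ((if k && j.2 then 1 else -1) * real_part (k == j.2) (g j.1 z.2)))); last first.
  by rewrite (mulrCA _ (\1_Y z.2)) mulrACA.
by rewrite z0 mul0r.
Qed.

Lemma error20 (z : Q) : indXY z = 0 -> error2 z = 0.
Proof.
move=> z0; apply: big1 => k _.
by rewrite rank_part0// /cut_amplitude z0 !mul0r subr0 expr0n.
Qed.

Lemma Lfun2_rank_part k : rank_part k \in Lfun mu2 2%:E.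
Proof.
rewrite (_ : rank_part k = \sum_j 1 *: (fun z : P * P =>
    left_factor X f j z.1 * right_factor Y g k j z.2)).
  by apply: Lfun2_sum => j; exact: Lfun2_tensor.
by apply/funext => z; rewrite fct_sumE; apply: eq_bigr => j _; rewrite scale1r.
Qed.

Lemma integrable_error2 : mu2.-integrable setT (EFin \o error2).
Proof.
apply: integrable_sumR => k; apply: Lfun2_integrable_sqr.
have h : (fun z : P * P => cut_amplitude z * phase k n z.1 z.2) \in Lfun mu2 2%:E.
  apply: Lfun2_le Lfun2_cut_amplitude _.
    apply: measurable_funM; last exact: measurable_phase2.
    exact: Lfun2_measurable Lfun2_cut_amplitude.
  by move=> z; rewrite normrM ler_piMr// phase_le1.
have := Lfun2_comb (-1) (Lfun2_rank_part k) h.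
by rewrite scaleN1r addrC.
Qed.

(** On a cell where the amplitude varies by at most [eta], the lower bound of
[cell_gap] for the correlation of the finite rank function with the phase; it is
large where the error is a fraction of the amplitude. *)
Definition deficit (eta : R) (z : Q) : R :=
  cut_amplitude z ^+ 2 * (1 - 2 * eta) - 2 * eta * indXY z -
  (1 + 2 * eta) * error2 z.

Lemma integrable_deficit eta : mu2.-integrable setT (EFin \o deficit eta).
Proof.
have i1 := Lfun2_integrable_sqr Lfun2_cut_amplitude.
have i2 := Lfun2_integrable_sqr Lfun2_indXY.
have i3 := integrable_error2.
have := integrableB measurableT (integrableB measurableT
  (integrableZl measurableT (1 - 2 * eta) i1) (integrableZl measurableT (2 * eta) i2))
  (integrableZl measurableT (1 + 2 * eta) i3).
apply: eq_integrable => // z _ /=; rewrite -!EFinM -!EFinB; congr EFin.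
rewrite /deficit mulrC; congr (_ - _ * _ - _).
by have [[Xz Yz]|->] := indXY_cases z; rewrite ?indXY1 ?expr1n ?expr0n.
Qed.

End Separability.

(** * Rank forced by a deficit *)

Section DeficitRank.
Context {R : realType}.
Local Notation P := (measurableTypeR R * measurableTypeR R)%type.
Local Notation Q := ((R * R) * (R * R))%type.
Local Notation mu := (@lebesgue2 R).
Local Notation mu2 := (@lebesgue4 R).

Lemma Rintegral_additiveX (D : P * P -> R) (B C A : set P) :
  mu2.-integrable setT (EFin \o D) -> measurable A -> measurable B -> measurable C ->
  \int[mu2]_(z in A `*` C) D z =
  \int[mu2]_(z in (A `&` B) `*` C) D z + \int[mu2]_(z in (A `\` B) `*` C) D z.
Proof.
move=> iD mA mB mC.
rewrite (@Rintegral_additive _ _ _ _ D (A `*` C) (B `*` C)) //; [|exact: measurableX..].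
congr (_ + _); apply: (congr1 (fun S => \int[mu2]_(z in S) D z));
  apply/seteqP; split=> z.
- by move=> [[Az Cz] [Bz _]].
- by move=> [[Az Bz] Cz].
- by move=> [[Az Cz] nBC]; split=> //; split=> // Bz; exact: nBC.
- by move=> [[Az nBz] Cz]; split=> // -[Bz _].
Qed.

Lemma Rintegral_additiveY (D : P * P -> R) (B C A : set P) :
  mu2.-integrable setT (EFin \o D) -> measurable A -> measurable B -> measurable C ->
  \int[mu2]_(z in C `*` A) D z =
  \int[mu2]_(z in C `*` (A `&` B)) D z + \int[mu2]_(z in C `*` (A `\` B)) D z.
Proof.
move=> iD mA mB mC.
rewrite (@Rintegral_additive _ _ _ _ D (C `*` A) (C `*` B)) //; [|exact: measurableX..].
congr (_ + _); apply: (congr1 (fun S => \int[mu2]_(z in S) D z));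
  apply/seteqP; split=> z.
- by move=> [[Cz Az] [_ Bz]].
- by move=> [Cz [Az Bz]].
- by move=> [[Cz Az] nBC]; split=> //; split=> // Bz; exact: nBC.
- by move=> [Cz [Az nBz]]; split=> // -[_ Bz].
Qed.

(** By compactness, finitely many pairs of boxes with nearly constant amplitude
are enough to cover [X `*` Y], and one of them keeps a fixed fraction of the
deficit; the rank is bounded there as if the amplitude were its value at the
center. The cover does not depend on [n]. *)
Lemma deficit_rank_bound (Omega : set (R * R)) (sigma : R * R -> R)
    (X Y : set (R * R)) (eta kappa delta : R) :
  open Omega -> convex_set Omega ->
  (forall x, Omega x -> {for x, continuous sigma}) ->
  compact X -> compact Y -> X `<=` Omega -> Y `<=` Omega -> X `&` Y = set0 ->
  0 < eta -> 0 < kappa -> 0 < delta ->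
  exists2 c : R, 0 < c & forall n, (0 < n)%N ->
  forall (N : nat) (f g : 'I_N -> R * R -> R[i]),
  (forall j, left_factor X f j \in Lfun mu 2%:E) ->
  (forall k j, right_factor Y g k j \in Lfun mu 2%:E) ->
  forall X1 Y1 : set P, measurable X1 -> measurable Y1 -> X1 `<=` X -> Y1 `<=` Y ->
  kappa <= \int[mu2]_(z in X1 `*` Y1) deficit sigma X Y n f g eta z ->
  c * n%:R `^ (2 - delta) <= N%:R.
Proof.
move=> oO cvO cs cX cY XO YO XY0 eta0 kappa0 delta0.
have cA z : X z.1 -> Y z.2 -> {for z, continuous (amplitude sigma)}.
  exact: (continuous_amplitudeXY oO cvO cs XO YO XY0).
have [rho rho0 scale] := uniform_scale cX cY XY0 eta0 cA.
have [sX sXX covX] := compact_box_cover cX rho0.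
have [sY sYY covY] := compact_box_cover cY rho0.
pose kap := kappa / 2 ^+ size sX / 2 ^+ size sY.
have kapX : 0 < kappa / 2 ^+ size sX by rewrite divr_gt0// exprn_gt0.
have kap0 : 0 < kap by rewrite divr_gt0// exprn_gt0.
pose Pr (z : Q) (c : R) := forall n, (0 < n)%N ->
  forall (J : finType) (F : J -> P -> R) (G : bool -> J -> P -> R),
  (forall j, F j \in Lfun mu 2%:E) -> (forall k j, G k j \in Lfun mu 2%:E) ->
  forall X' Y' : set P, measurable X' -> measurable Y' ->
  X' `<=` box z.1 rho -> Y' `<=` box z.2 rho ->
  let V k (z : P * P) := \sum_j F j z.1 * G k j z.2 in
  kap <= \int[mu2]_(w in X' `*` Y') \sum_k
    (2 * (amplitude sigma z * phase k n w.1 w.2) * V k w - V k w ^+ 2) ->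
  c * n%:R `^ (2 - delta) <= #|J|%:R.
have [||c c0 HP] := @uniform_pos R _ [seq (a, b) | a <- sX, b <- sY] Pr.
- move=> z c c' Pc cc n n0 J F G F2 G2 X' Y' mX' mY' X'z Y'z V kV.
  apply: le_trans (Pc n n0 J F G F2 G2 X' Y' mX' mY' X'z Y'z kV).
  by rewrite ler_wpM2r// powR_ge0.
- move=> _ /allpairsP[[a b] /= [aX bY ->]].
  have [sep _] := scale a b (sXX a aX) (sYY b bY).
  exact: (local_rank_bound_cut (amplitude sigma (a, b)) rho0 sep kap0 delta0).
exists (c / 2); first by rewrite divr_gt0.
move=> n n0 N f g F2 G2 X1 Y1 mX1 mY1 X1X Y1Y big.
pose D : P * P -> R := deficit sigma X Y n f g eta.
have iD : mu2.-integrable setT (EFin \o D).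
  exact: (integrable_deficit oO cvO cs cX cY XO YO XY0 n F2 G2 eta).
have [||||||a aX [X' [mX' X'X1 X'a X'k]]] :=
    @pigeonhole_cover R (fun A => \int[mu2]_(z in A `*` Y1) D z) rho sX X1 kappa.
- by rewrite set0X Rintegral_set0.
- by move=> A B mA mB; exact: Rintegral_additiveX.
- exact: mX1.
- by move=> x /X1X; exact: covX.
- exact: kappa0.
- exact: big.
have [||||||b bY [Y' [mY' Y'Y1 Y'b Y'k]]] :=
    @pigeonhole_cover R (fun A => \int[mu2]_(z in X' `*` A) D z) rho sY Y1
      (kappa / 2 ^+ size sX).
- by rewrite setX0 Rintegral_set0.
- by move=> A B mA mB; exact: Rintegral_additiveY.
- exact: mY1.
- by move=> x /Y1Y; exact: covY.
- exact: kapX.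
- exact: X'k.
have [sep near] := scale a b (sXX a aX) (sYY b bY).
have ab : (a, b) \in [seq (a, b) | a <- sX, b <- sY].
  by apply/allpairsP; exists (a, b).
have := HP (a, b) ab n n0 _ _ _ F2 G2 X' Y' mX' mY' X'a Y'b.
(* [N] complex products are [N * 2] real ones *)
rewrite card_prod card_ord card_bool natrM => H.
rewrite mulrAC ler_pdivrMr//; apply: H; apply: (le_trans Y'k).
have XYX z : (X' `*` Y') z -> X z.1 /\ Y z.2.
  by move=> [Xz Yz]; split; [exact/X1X/X'X1|exact/Y1Y/Y'Y1].
have mS : measurable (X' `*` Y' : set (P * P)) by exact: measurableX.
have iV : mu2.-integrable (X' `*` Y') (EFin \o (fun w : P * P => \sum_k
    (2 * (amplitude sigma (a, b) * phase k n w.1 w.2) * rank_part X Y f g k w -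
     rank_part X Y f g k w ^+ 2))).
  pose ph k (w : P * P) := indXY X Y w * phase k n w.1 w.2.
  have ph2 k : ph k \in Lfun mu2 2%:E.
    apply: Lfun2_le (Lfun2_indXY cX cY) _.
      apply: measurable_funM; last exact: measurable_phase2.
      exact: Lfun2_measurable (Lfun2_indXY cX cY).
    by move=> z; rewrite normrM ler_piMr// phase_le1.
  have V2 := Lfun2_rank_part F2 G2.
  have i k : mu2.-integrable setT (EFin \o (fun w : P * P =>
      2 * amplitude sigma (a, b) * (ph k w * rank_part X Y f g k w) -
      rank_part X Y f g k w * rank_part X Y f g k w)).
    have := integrableB measurableT (integrableZl measurableT
      (2 * amplitude sigma (a, b)) (Lfun2_integrableM (ph2 k) (V2 k)))
      (Lfun2_integrableM (V2 k) (V2 k)).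
    exact: eq_integrable.
  have := integrableS measurableT mS (@subsetT _ _) (integrable_sumR (index_enum _) i).
  apply: eq_integrable => // z /[!inE] /XYX[Xz Yz] /=; congr EFin.
  by apply: eq_bigr => k _; rewrite /ph indXY1// mul1r expr2; ring.
apply: le_Rintegral => //; first exact: integrableS iD.
move=> z Sz; have [Xz Yz] := XYX z Sz; case: (Sz) => X'z Y'z.
have Aeta := near z.1 z.2 Xz Yz (X'a _ X'z) (Y'b _ Y'z).
rewrite -surjective_pairing in Aeta.
have z0 := nsq_sub_gt0 XY0 Xz Yz.
have := cell_gap (fun k => rank_part X Y f g k z) Aeta
  (fun k => phase_le1 k n z.1 z.2) (sqr_phase n z0).
by apply: le_trans; rewrite /D /deficit /error2 /cut_amplitude indXY1// mul1r mulr1.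
Qed.
End DeficitRank.

(** * Deficit forced by a small error *)

Section NormInequality.
Context d (T : measurableType d) {R : realType}.
Variables (m : {measure set T -> \bar R}) (D : set T).
Local Notation normc := (@ComplexField.Normc.normc R).

Lemma sqr_Lp_norm2 (F : T -> R[i]) :
  (Lp_norm m 2%:E D F `^ 2 = \int[m]_x (\1_D x * normc (F x) ^+ 2)%:E)%E.
Proof.
rewrite /Lp_norm poweR_Lnorm//; apply: eq_integral => x _.
rewrite abse_EFin poweR_EFin powR_mulrn// ger0_norm; last first.
  by rewrite mulr_ge0// normc_ge0.
by rewrite exprMn indicE; case: (_ \in _); rewrite ?expr1n ?expr0n.
Qed.

Lemma Lp_norm2_le (F G : T -> R[i]) (eps : R) (u v : T -> R) : 0 <= eps ->
  (forall x, \1_D x * normc (F x) ^+ 2 = u x) ->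
  (forall x, \1_D x * normc (G x) ^+ 2 = v x) ->
  m.-integrable setT (EFin \o u) -> m.-integrable setT (EFin \o v) ->
  (Lp_norm m 2%:E D F <= eps%:E * Lp_norm m 2%:E D G)%E ->
  \int[m]_x u x <= eps ^+ 2 * \int[m]_x v x.
Proof.
move=> eps0 uE vE iu iv.
have N0 H : (0 <= Lp_norm m 2%:E D H)%E by exact: Lnorm_ge0.
have E0 : (0 <= eps%:E * Lp_norm m 2%:E D G)%E by rewrite mule_ge0 ?lee_fin.
move=> /(gt0_ler_poweR (ler0n R 2)).
rewrite !in_itv/= !leey !andbT => /(_ (N0 F) E0).
rewrite poweRM ?lee_fin// !sqr_Lp_norm2 poweR_EFin powR_mulrn//.
under eq_integral do rewrite uE.
under [X in (_ <= _ * X)%E]eq_integral do rewrite vE.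
rewrite -(fineK (integrable_fin_num measurableT iu)).
by rewrite -(fineK (integrable_fin_num measurableT iv)) -EFinM lee_fin.
Qed.

Lemma Lp_normy_le (F G : T -> R[i]) (eps M : R) : (0 < m setT)%E ->
  0 <= eps -> 0 <= M -> (forall x, D x -> normc (G x) <= M) ->
  (Lp_norm m +oo%E D F <= eps%:E * Lp_norm m +oo%E D G)%E ->
  {ae m, forall x, D x -> normc (F x) <= eps * M}.
Proof.
move=> m0 eps0 M0 GM; rewrite /Lp_norm unlock /Lnorm m0 => FG.
have GMe : (ess_sup m (abse \o (fun x => (\1_D x * normc (G x))%:E)) <= M%:E)%E.
  apply/ess_supP; apply: nearW => x /=.
  rewrite lee_fin ger0_norm ?mulr_ge0 ?normc_ge0// indicE.
  case: (boolP (x \in D)) => [|_]; last by rewrite mul0r.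
  by rewrite inE mul1r; exact: GM.
have := le_trans FG (lee_wpmul2l (eps0 : (0 <= eps%:E)%E) GMe).
rewrite -EFinM => /ess_supP; apply: filterS => x /= + Dx.
by rewrite lee_fin indicE mem_set// mul1r ger0_norm// normc_ge0.
Qed.

End NormInequality.

Section LargeDeficit.
Context {R : realType}.
Local Notation P := (measurableTypeR R * measurableTypeR R)%type.
Local Notation Q := ((R * R) * (R * R))%type.
Local Notation mu := (@lebesgue2 R).
Local Notation mu2 := (@lebesgue4 R).
Local Notation normc := (@ComplexField.Normc.normc R).
Variables (Omega : set (R * R)) (sigma : R * R -> R) (X Y : set (R * R)).
Hypothesis Omega_open : open Omega.
Hypothesis Omega_convex : convex_set Omega.
Hypothesis sigma_cont : forall x, Omega x -> {for x, continuous sigma}.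
Hypothesis X_domain : compact_domain X.
Hypothesis Y_domain : compact_domain Y.
Hypothesis X_sub : X `<=` Omega.
Hypothesis Y_sub : Y `<=` Omega.
Hypothesis XY0 : X `&` Y = set0.

Local Notation A := (amplitude sigma).
Local Notation S := (X `*` Y).

Let cX : compact X. Proof. by case: X_domain. Qed.
Let cY : compact Y. Proof. by case: Y_domain. Qed.
Let mX : measurable (X : set P). Proof. exact: compact_plane_measurable. Qed.
Let mY : measurable (Y : set P). Proof. exact: compact_plane_measurable. Qed.

Let X_neq0 : X !=set0.
Proof. by case: X_domain => _ [x /interior_subset Xx] _ _; exists x. Qed.
Let Y_neq0 : Y !=set0.
Proof. by case: Y_domain => _ [y /interior_subset Yy] _ _; exists y. Qed.

Lemma indic_setX_eq (z : Q) : \1_S z = indXY X Y z.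
Proof. by rewrite /indXY !indicE -natrM mulnb in_setX. Qed.

Lemma cut_sqr_amplitude n (z : Q) :
  \1_S z * normc (kernelG sigma n z.1 z.2) ^+ 2 = cut_amplitude sigma X Y z ^+ 2.
Proof.
rewrite indic_setX_eq /cut_amplitude.
have [[Xz Yz]|->] := indXY_cases X Y z; last by rewrite !mul0r expr0n.
by rewrite indXY1// !mul1r sqr_kernelG//; exact: (nsq_sub_gt0 XY0).
Qed.

Lemma cut_sqr_error n N (f g : 'I_N -> R * R -> R[i]) (z : Q) :
  \1_S z * normc (kernelG sigma n z.1 z.2 - \sum_(l < N) f l z.1 * g l z.2) ^+ 2 =
  error2 sigma X Y n f g z.
Proof.
rewrite indic_setX_eq.
have [[Xz Yz]|z0] := indXY_cases X Y z; last by rewrite error20// z0 mul0r.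
rewrite indXY1// mul1r (sqr_error f g sigma n Xz Yz (nsq_sub_gt0 XY0 Xz Yz)).
by rewrite /error2 /cut_amplitude indXY1// mul1r.
Qed.

Let iA E : measurable E ->
  mu2.-integrable E (EFin \o (fun z : P * P => cut_amplitude sigma X Y z ^+ 2)).
Proof.
move=> mE; apply: (integrableS measurableT mE (@subsetT _ _)).
apply: Lfun2_integrable_sqr.
exact: (Lfun2_cut_amplitude Omega_open Omega_convex sigma_cont cX cY X_sub Y_sub XY0).
Qed.

Let iI E : measurable E -> mu2.-integrable E (EFin \o (indXY X Y : P * P -> R)).
Proof.
move=> mE; have := integrableS measurableT mE (@subsetT _ _)
  (Lfun2_integrable_sqr (Lfun2_indXY cX cY)).
apply: eq_integrable => // z _ /=; congr EFin.
by have [[Xz Yz]|->] := indXY_cases X Y z; rewrite ?indXY1 ?expr1n ?expr0n.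
Qed.

Let iE E n N (f g : 'I_N -> R * R -> R[i]) :
  (forall j, left_factor X f j \in Lfun mu 2%:E) ->
  (forall k j, right_factor Y g k j \in Lfun mu 2%:E) -> measurable E ->
  mu2.-integrable E (EFin \o (error2 sigma X Y n f g : P * P -> R)).
Proof.
move=> F2 G2 mE; apply: (integrableS measurableT mE (@subsetT _ _)).
exact: (integrable_error2 Omega_open Omega_convex sigma_cont cX cY X_sub Y_sub XY0).
Qed.

Lemma Rintegral_deficit n N (f g : 'I_N -> R * R -> R[i]) eta (E : set (P * P)) :
  (forall j, left_factor X f j \in Lfun mu 2%:E) ->
  (forall k j, right_factor Y g k j \in Lfun mu 2%:E) -> measurable E ->
  \int[mu2]_(z in E) deficit sigma X Y n f g eta z =
  (1 - 2 * eta) * (\int[mu2]_(z in E) cut_amplitude sigma X Y z ^+ 2) -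
  2 * eta * (\int[mu2]_(z in E) indXY X Y z) -
  (1 + 2 * eta) * \int[mu2]_(z in E) error2 sigma X Y n f g z.
Proof.
move=> F2 G2 mE.
have j1 := integrableZl mE (1 - 2 * eta) (iA mE).
have j2 := integrableZl mE (2 * eta) (iI mE).
have j3 := integrableZl mE (1 + 2 * eta) (iE n F2 G2 mE).
have j12 := integrableB mE j1 j2.
transitivity (\int[mu2]_(z in E) ((1 - 2 * eta) * cut_amplitude sigma X Y z ^+ 2 -
  2 * eta * indXY X Y z - (1 + 2 * eta) * error2 sigma X Y n f g z)).
  by apply: eq_Rintegral => z _; rewrite /deficit mulrC.
rewrite RintegralB// RintegralB//.
rewrite (RintegralZl _ mE (iA mE)) (RintegralZl _ mE (iI mE)).
by rewrite (RintegralZl _ mE (iE n F2 G2 mE)).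
Qed.

Lemma Rintegral_indXY (X1 Y1 : set P) : measurable X1 -> measurable Y1 ->
  X1 `<=` X -> Y1 `<=` Y ->
  \int[mu2]_(z in X1 `*` Y1) indXY X Y z = fine (mu2 (X1 `*` Y1)).
Proof.
move=> mX1 mY1 X1X Y1Y.
have mS : measurable (X1 `*` Y1) by exact: measurableX.
rewrite -[RHS]mul1r -(Rintegral_cst mu2 mS 1); apply: eq_Rintegral => z.
by rewrite inE => -[/X1X Xz /Y1Y Yz]; rewrite indXY1.
Qed.

Lemma fine_lebesgue4_gt0 (X1 Y1 : set P) : measurable X1 -> measurable Y1 ->
  X1 `<=` X -> Y1 `<=` Y -> (0 < mu X1)%E -> (0 < mu Y1)%E ->
  0 < fine (mu2 (X1 `*` Y1)).
Proof.
move=> mX1 mY1 X1X Y1Y X10 Y10; rewrite lebesgue4_setX//.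
have fin (K K1 : set P) : measurable K1 -> K1 `<=` K -> compact (K : set (R * R)) ->
    (mu K1 < +oo)%E.
  move=> mK1 KK cK; apply: le_lt_trans (lebesgue2_compact cK).
  by apply: le_measure; rewrite ?inE//; exact: compact_plane_measurable.
have fX := fin _ _ mX1 X1X cX; have fY := fin _ _ mY1 Y1Y cY.
rewrite fine_gt0// mule_gt0//= lte_mul_pinfty//.
by rewrite ge0_fin_numE.
Qed.

(** In mean square the error takes away at most the fraction [eps ^+ 2] of the
mass of the squared amplitude, so that the whole of [X `*` Y] can be used. *)
Lemma large_deficit_L2 (eps : R) : 0 < eps -> eps < 1 ->
  exists eta kappa, [/\ 0 < eta, 0 < kappa &
  forall n N (f g : 'I_N -> R * R -> R[i]),
  (forall j, left_factor X f j \in Lfun mu 2%:E) ->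
  (forall k j, right_factor Y g k j \in Lfun mu 2%:E) ->
  (Lp_norm mu2 2%:E S
     (fun z => kernelG sigma n z.1 z.2 - \sum_(l < N) f l z.1 * g l z.2)%R <=
   eps%:E * Lp_norm mu2 2%:E S (fun z => kernelG sigma n z.1 z.2))%E ->
  kappa <= \int[mu2]_(z in S) deficit sigma X Y n f g eta z].
Proof.
move=> eps0 eps1; have [a a0 Aa] := amplitude_min Omega_open Omega_convex
  sigma_cont cX cY X_sub Y_sub XY0 X_neq0 Y_neq0.
have mS : measurable (S : set (P * P)) by exact: measurableX.
pose I := \int[mu2]_(z in S) cut_amplitude sigma X Y z ^+ 2.
pose B := \int[mu2]_(z in S) indXY X Y z.
have B0 : 0 < B.
  have pos (K : set (R * R)) : compact_domain K -> K !=set0 -> (0 < mu (K : set P))%E.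
    move=> dK [x Kx]; have [c [r r0 cK]] := compact_domain_box dK Kx ltr01.
    apply: (lebesgue2_gt0 _ r0) => [|y /cK[]//].
    by apply: compact_plane_measurable; case: dK.
  by rewrite /B Rintegral_indXY// fine_lebesgue4_gt0//; exact: pos.
have aBI : a ^+ 2 * B <= I.
  rewrite /I /B -(RintegralZl _ mS (iI mS)); apply: le_Rintegral => //.
  - exact: (integrableZl mS (a ^+ 2) (iI mS)).
  - exact: iA.
  move=> z [Xz Yz]; rewrite /cut_amplitude indXY1// mulr1 mul1r.
  have h := Aa z Xz Yz.
  by rewrite lerXn2r ?nnegrE ?(ltW a0) ?(le_trans (ltW a0) h).
have a20 : 0 < a ^+ 2 by rewrite exprn_gt0.
have I0 : 0 < I by apply: lt_le_trans aBI; rewrite mulr_gt0.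
have eps2 : 0 < 1 - eps ^+ 2 by rewrite subr_gt0 expr_lt1// ltW.
(* the terms in [eta] cost half of the fraction [1 - eps ^+ 2] that is left *)
pose eta := (1 - eps ^+ 2) / (4 * (2 + (a ^+ 2)^-1)).
have b0 : 0 < (a ^+ 2)^-1 by rewrite invr_gt0.
have den0 : 0 < 4 * (2 + (a ^+ 2)^-1) by rewrite mulr_gt0// addr_gt0.
have eta0 : 0 < eta by rewrite divr_gt0.
exists eta, ((1 - eps ^+ 2) / 2 * I); split => //.
  by rewrite mulr_gt0// divr_gt0.
move=> n N f g F2 G2 Lp; rewrite Rintegral_deficit// -/I -/B.
have ET : \int[mu2]_(z in S) error2 sigma X Y n f g z <= eps ^+ 2 * I.
  have offS (u : Q -> R) : (forall z, indXY X Y z = 0 -> u z = 0) ->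
      \int[mu2]_z u z = \int[mu2]_(z in S) u z.
    move=> u0; rewrite -[RHS]Rintegral_indic; apply: eq_Rintegral => z _.
    rewrite indic_setX_eq; have [[Xz Yz]|z0] := indXY_cases X Y z.
      by rewrite indXY1// mul1r.
    by rewrite z0 mul0r u0.
  have := @Lp_norm2_le _ (P * P)%type R mu2 S _ _ eps _ _ (ltW eps0) (cut_sqr_error n f g) (cut_sqr_amplitude n)
    (iE n F2 G2 measurableT) (iA measurableT) Lp.
  rewrite (offS (error2 sigma X Y n f g)); last by move=> z; exact: error20.
  rewrite (offS (fun z => cut_amplitude sigma X Y z ^+ 2))// => z z0.
  by rewrite /cut_amplitude z0 mul0r expr0n.
have etaE : 4 * eta * (2 + (a ^+ 2)^-1) = 1 - eps ^+ 2.
  by rewrite mulrAC mulrC /eta divfK// gt_eqF.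
have BI : B <= (a ^+ 2)^-1 * I by rewrite ler_pdivlMl.
have h1 := ler_wpM2l (ltW eta0) BI.
have e1 : 0 <= 1 + 2 * eta by rewrite addr_ge0// mulr_ge0// ltW.
have h2 := ler_wpM2l e1 ET.
have h3 : eta * eps ^+ 2 * I <= eta * I.
  by rewrite ler_wpM2r ?(ltW I0)// ler_piMr ?(ltW eta0)//; lra.
have h4 : (1 - eps ^+ 2) / 2 * I = (1 - eps ^+ 2) * I -
    (4 * eta * I + 2 * (eta * ((a ^+ 2)^-1 * I))).
  by rewrite -etaE; field; rewrite gt_eqF.
rewrite h4; lra.
Qed.

(** In sup norm the error is compared with the maximum [M] of the amplitude, and
[eps * M] may exceed the amplitude elsewhere; so the deficit is taken over a
small neighbourhood of a maximum point. *)
Lemma large_deficit_sup (eps : R) : 0 < eps -> eps < 1 ->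
  exists eta kappa, [/\ 0 < eta, 0 < kappa & exists X1 Y1 : set P,
  [/\ measurable X1, measurable Y1, X1 `<=` X, Y1 `<=` Y &
  forall n N (f g : 'I_N -> R * R -> R[i]),
  (forall j, left_factor X f j \in Lfun mu 2%:E) ->
  (forall k j, right_factor Y g k j \in Lfun mu 2%:E) ->
  (Lp_norm mu2 +oo%E S
     (fun z => kernelG sigma n z.1 z.2 - \sum_(l < N) f l z.1 * g l z.2)%R <=
   eps%:E * Lp_norm mu2 +oo%E S (fun z => kernelG sigma n z.1 z.2))%E ->
  kappa <= \int[mu2]_(z in X1 `*` Y1) deficit sigma X Y n f g eta z]].
Proof.
move=> eps0 eps1; have [z0 [Xz0 Yz0 zM]] := amplitude_max Omega_open Omega_convex
  sigma_cont cX cY X_sub Y_sub XY0 X_neq0 Y_neq0.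
have half (E K e b : R) : 4 * e * K = E -> E / 2 * b = E * b - 2 * e * K * b.
  by move=> <-; field.
have total (K e b q I J : R) : (K ^+ 2 - 2 * K * e) * b <= I ->
    (1 + 2 * e) * J <= (1 + 2 * e) * (q * K ^+ 2 * b) -> e * I <= e * (K ^+ 2 * b) ->
    e * (q * K ^+ 2 * b) <= e * (K ^+ 2 * b) ->
    K ^+ 2 * (1 - q) * b - 2 * e * (K + 2 * K ^+ 2 + 1) * b <=
    (1 - 2 * e) * I - 2 * e * b - (1 + 2 * e) * J by lra.
have nsq0 := nsq_sub_gt0 XY0.
have Apos z : X z.1 -> Y z.2 -> 0 < A z.
  by move=> Xz Yz; rewrite amplitude_gt0// enorm_gt0 nsq0.
pose M := A z0; have M0 : 0 < M by exact: Apos.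
have eps2 : 0 < 1 - eps ^+ 2 by rewrite subr_gt0 expr_lt1// ltW.
(* the terms in [eta] cost half of the [M ^+ 2 * (1 - eps ^+ 2)] that is left *)
pose eta := M ^+ 2 * (1 - eps ^+ 2) / (4 * (M + 2 * M ^+ 2 + 1)).
have den0 : 0 < 4 * (M + 2 * M ^+ 2 + 1).
  by rewrite mulr_gt0// !addr_gt0// mulr_gt0// exprn_gt0.
have eta0 : 0 < eta by rewrite divr_gt0// mulr_gt0// exprn_gt0.
have cA z : X z.1 -> Y z.2 -> {for z, continuous A}.
  exact: (continuous_amplitudeXY Omega_open Omega_convex sigma_cont X_sub Y_sub XY0).
have [rho rho0 scale] := uniform_scale cX cY XY0 eta0 cA.
have [_ near0] := scale z0.1 z0.2 Xz0 Yz0.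
pose X1 : set P := X `&` box z0.1 rho; pose Y1 : set P := Y `&` box z0.2 rho.
have mX1 : measurable X1 by apply: measurableI => //; exact: measurable_box.
have mY1 : measurable Y1 by apply: measurableI => //; exact: measurable_box.
have X1X : X1 `<=` X by exact: subIsetl.
have Y1Y : Y1 `<=` Y by exact: subIsetl.
have mS : measurable (X1 `*` Y1) by exact: measurableX.
pose B := \int[mu2]_(z in X1 `*` Y1) indXY X Y z.
have B0 : 0 < B.
  have pos (K : set (R * R)) x : compact_domain K -> K x ->
      measurable (K `&` box x rho : set P) -> (0 < mu (K `&` box x rho : set P))%E.
    move=> dK Kx mK; have [c [r r0 cK]] := compact_domain_box dK Kx rho0.
    exact: (lebesgue2_gt0 mK r0 cK).
  by rewrite /B Rintegral_indXY// fine_lebesgue4_gt0//; exact: pos.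
exists eta, (M ^+ 2 * (1 - eps ^+ 2) / 2 * B); split => //.
  by rewrite mulr_gt0// divr_gt0// mulr_gt0// exprn_gt0.
exists X1, Y1; split => // n N f g F2 G2 Lp; rewrite Rintegral_deficit// -/B.
have mu20 : (0 < mu2 setT)%E.
  apply: (@lt_le_trans _ _ (mu2 (X1 `*` Y1))).
    rewrite lt0e measure_ge0 andbT; apply: contraTneq B0 => e0.
    by rewrite /B Rintegral_indXY// e0 ltxx.
  by apply: le_measure; rewrite ?inE.
have Gle z : S z -> normc (kernelG sigma n z.1 z.2) <= M.
  move=> [Xz Yz]; rewrite -ler_sqr ?nnegrE ?normc_ge0 ?(ltW M0)//.
  rewrite sqr_kernelG ?nsq0// lerXn2r ?nnegrE ?(ltW M0) ?(ltW (Apos _ Xz Yz))//.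
  exact: zM.
have ET : \int[mu2]_(z in X1 `*` Y1) error2 sigma X Y n f g z <= (eps * M) ^+ 2 * B.
  have iE1 := iE n F2 G2 mS; have iI1 := iI mS.
  have iIM := integrableZl mS ((eps * M) ^+ 2) iI1.
  rewrite /B -(RintegralZl _ mS iI1) /Rintegral fine_le ?integrable_fin_num//.
  have ge0 z : 0 <= error2 sigma X Y n f g z by rewrite sumr_ge0// => k _; exact: sqr_ge0.
  apply: ae_ge0_le_integral => //.
  - by move=> z _; rewrite lee_fin.
  - exact: measurable_int iE1.
  - move=> z [/X1X Xz /Y1Y Yz]; rewrite lee_fin indXY1// mulr1 sqr_ge0.
    by [].
  - exact: measurable_int iIM.
  have := @Lp_normy_le _ (P * P)%type R mu2 S _ _ eps M mu20 (ltW eps0) (ltW M0) Gle Lp.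
  apply: filterS => z + Sz; have [/X1X Xz /Y1Y Yz] := Sz.
  move=> /(_ (conj Xz Yz)) ez; rewrite lee_fin indXY1// mulr1.
  rewrite -cut_sqr_error indic_setX_eq indXY1// mul1r.
  have eM0 : 0 <= eps * M by rewrite mulr_ge0// ltW.
  by rewrite lerXn2r ?nnegrE ?normc_ge0.
have AT : (M ^+ 2 - 2 * M * eta) * B <=
    \int[mu2]_(z in X1 `*` Y1) cut_amplitude sigma X Y z ^+ 2.
  rewrite /B -(RintegralZl _ mS (iI mS)); apply: le_Rintegral => //.
  - exact: (integrableZl mS _ (iI mS)).
  - exact: iA.
  move=> z [[Xz Xb] [Yz Yb]]; rewrite /cut_amplitude indXY1// mulr1 mul1r.
  have := near0 z.1 z.2 Xz Yz Xb Yb; rewrite -!surjective_pairing -/M.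
  rewrite ler_norml => /andP[_ h].
  have := sqr_ge0 (A z - M); have := ler_wpM2l (ltW M0) h.
  rewrite sqrrB; lra.
have AU : \int[mu2]_(z in X1 `*` Y1) cut_amplitude sigma X Y z ^+ 2 <= M ^+ 2 * B.
  rewrite /B -(RintegralZl _ mS (iI mS)); apply: le_Rintegral => //.
  - exact: iA.
  - exact: (integrableZl mS _ (iI mS)).
  move=> z [/X1X Xz /Y1Y Yz]; rewrite /cut_amplitude indXY1// mulr1 mul1r.
  rewrite lerXn2r ?nnegrE ?(ltW M0) ?(ltW (Apos _ Xz Yz))//.
  exact: zM.
have etaE : 4 * eta * (M + 2 * M ^+ 2 + 1) = M ^+ 2 * (1 - eps ^+ 2).
  by rewrite mulrAC mulrC /eta divfK// gt_eqF.
have e1 : 0 <= 1 + 2 * eta by rewrite addr_ge0// mulr_ge0// ltW.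
have h1 := ler_wpM2l e1 ET.
have h2 := ler_wpM2l (ltW eta0) AU.
have h3 : eta * (eps ^+ 2 * M ^+ 2 * B) <= eta * (M ^+ 2 * B).
  rewrite ler_wpM2l ?(ltW eta0)// ler_wpM2r ?(ltW B0)//.
  by rewrite ler_piMl ?sqr_ge0// ltW// -subr_gt0.
rewrite (half _ _ _ B etaE).
rewrite exprMn in h1.
exact: total AT h1 h2 h3.
Qed.

End LargeDeficit.

(** * Square integrability of the factors *)

Section Factors.
Context {R : realType}.
Local Notation P := (measurableTypeR R * measurableTypeR R)%type.
Local Notation mu := (@lebesgue2 R).

Lemma lebesgue2_setT_gt0 : (0 < mu setT)%E.
Proof. exact: (@lebesgue2_gt0 R setT (0, 0) 1 measurableT ltr01). Qed.

Lemma Lfun2_left_factor p (X : set (R * R)) N (f : 'I_N -> R * R -> R[i]) j :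
  p = 2%:E \/ p = +oo%E -> compact X -> (forall l, in_Lp mu p X (f l)) ->
  left_factor X f j \in Lfun mu 2%:E.
Proof.
move=> pE cX fp; have mX := compact_plane_measurable cX.
have [re im] := in_Lp_cut pE mX (lebesgue2_compact cX) lebesgue2_setT_gt0 (fp j.1).
by rewrite /left_factor /real_part; case: j.2.
Qed.

Lemma Lfun2_right_factor p (Y : set (R * R)) N (g : 'I_N -> R * R -> R[i]) k j :
  p = 2%:E \/ p = +oo%E -> compact Y -> (forall l, in_Lp mu p Y (g l)) ->
  right_factor Y g k j \in Lfun mu 2%:E.
Proof.
move=> pE cY gp; have mY := compact_plane_measurable cY.
have [re im] := in_Lp_cut pE mY (lebesgue2_compact cY) lebesgue2_setT_gt0 (gp j.1).
have h : (fun y : P => \1_Y y * real_part (k == j.2) (g j.1 y)) \in Lfun mu 2%:E.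
  by rewrite /real_part; case: (k == j.2).
by have := Lfun2_comb (if k && j.2 then 1 else -1) h (Lfun2_0 mu); rewrite addr0.
Qed.

End Factors.

Unset Implicit Arguments.
Set Strict Implicit.

Theorem theorem3p3 (R : realType)
    (Omega : set (R * R)) (sigma : R * R -> R) (sigma0 sigma1 : R)
    (X Y : set (R * R)) (gamma : R) (p : \bar R) (eps delta : R)
    (Omega_open : open Omega) (Omega_bounded : bounded_set Omega)
    (Omega_convex : convex_set Omega)
    (sigma_smooth : smooth_on Omega sigma)
    (sigma0_gt0 : 0 < sigma0)
    (sigma_bounds : forall x, Omega x -> sigma0 <= sigma x <= sigma1)
    (X_domain : compact_domain X) (Y_domain : compact_domain Y)
    (X_sub : X `<=` Omega) (Y_sub : Y `<=` Omega)
    (XY_disjoint : X `&` Y = set0)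
    (gamma_gt0 : 0 < gamma)
    (XY_dist : gamma * diam Y <= dist_set X Y)
    (p_eq : p = 2%:E \/ p = +oo%E)
    (eps_gt0 : 0 < eps) (eps_lt1 : eps < 1)
    (delta_gt0 : 0 < delta) :
  exists2 c : R, 0 < c &
  exists n0 : nat, forall n : nat, (n0 <= n)%N ->
  forall (N : nat) (f g : 'I_N -> R * R -> R[i]),
    (forall l, in_Lp lebesgue2 p X (f l)) ->
    (forall l, in_Lp lebesgue2 p Y (g l)) ->
    (Lp_norm lebesgue4 p (X `*` Y)
        (fun z => kernelG sigma n z.1 z.2 - \sum_(l < N) f l z.1 * g l z.2)%R
      <= eps%:E * Lp_norm lebesgue4 p (X `*` Y)
                    (fun z => kernelG sigma n z.1 z.2))%E ->
    c * n%:R `^ (2 - delta) <= N%:R.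
Proof.
have sigma_cont x : Omega x -> {for x, continuous sigma}.
  by move=> Ox; have [] := sigma_smooth [::] x Ox.
have cX : compact X by case: X_domain.
have cY : compact Y by case: Y_domain.
have [eta [kappa [eta0 kappa0 [X1 [Y1 [mX1 mY1 X1X Y1Y big]]]]]] :
    exists eta kappa : R, [/\ 0 < eta, 0 < kappa &
    exists X1 Y1 : set (measurableTypeR R * measurableTypeR R),
    [/\ measurable X1, measurable Y1, X1 `<=` X, Y1 `<=` Y &
    forall n N (f g : 'I_N -> R * R -> R[i]),
    (forall j, left_factor X f j \in Lfun lebesgue2 2%:E) ->
    (forall k j, right_factor Y g k j \in Lfun lebesgue2 2%:E) ->
    (Lp_norm lebesgue4 p (X `*` Y)
       (fun z => kernelG sigma n z.1 z.2 - \sum_(l < N) f l z.1 * g l z.2)%R <=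
     eps%:E * Lp_norm lebesgue4 p (X `*` Y) (fun z => kernelG sigma n z.1 z.2))%E ->
    kappa <= \int[lebesgue4]_(z in X1 `*` Y1) deficit sigma X Y n f g eta z]].
  case: p_eq => ->.
    have [eta [kappa [eta0 kappa0 H]]] := large_deficit_L2 Omega_open Omega_convex
      sigma_cont X_domain Y_domain X_sub Y_sub XY_disjoint eps_gt0 eps_lt1.
    exists eta, kappa; split => //; exists X, Y; split => //.
      exact: compact_plane_measurable.
    exact: compact_plane_measurable.
  exact: (large_deficit_sup Omega_open Omega_convex sigma_cont X_domain Y_domain
    X_sub Y_sub XY_disjoint eps_gt0 eps_lt1).
have [c c0 H] := deficit_rank_bound Omega_open Omega_convex sigma_cont cX cY
  X_sub Y_sub XY_disjoint eta0 kappa0 delta_gt0.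
exists c => //; exists 1%N => n n0 N f g fp gp Lp.
have F2 j := Lfun2_left_factor j p_eq cX fp.
have G2 k j := Lfun2_right_factor k j p_eq cY gp.
exact: (H n n0 N f g F2 G2 X1 Y1 mX1 mY1 X1X Y1Y (big n N f g F2 G2 Lp)).
Qed.
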